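(* Let $f\in\mathcal{N}_{sym}$ be such that neither $f$ nor $-f$ is a Herglotz-Nevanlinna function, and let $A_f$ be a model relation corresponding to $f$. Then $A_f$ is partially fundamentally reducible.
   Context: $\mathbb{C}^+$ and $\mathbb{C}^-$ are the open upper and lower half-planes, and $\mathcal{H}^\infty(\mathbb{C}^{+})$ is the space of bounded analytic functions on $\mathbb{C}^+$ with the supremum norm. $\mathcal{N}(\mathbb{C}^+)$ is the set of meromorphic functions on $\mathbb{C}^+$ of the form $f_1/f_2$ with $f_1,f_2\in\mathcal{H}^\infty(\mathbb{C}^+)$, $f_2\not\equiv 0$; $\mathcal{N}(\mathbb{C}^-)$ is defined analogously. $\mathcal{N}(\mathbb{C}\setminus\mathbb{R})$ is the set of meromorphic functions $f$ on $\mathbb{C}\setminus\mathbb{R}$ with $f_{|\mathbb{C}^+}\in\mathcal{N}(\mathbb{C}^+)$ and $f_{|\mathbb{C}^-}\in\mathcal{N}(\mathbb{C}^-)$. For $g$ on $\mathbb{C}^+$, $SR(g)(z)=\overline{g(\overline{z})}$ on $\mathbb{C}^-$. $\mathcal{N}_{sym}=\{f\in\mathcal{N}(\mathbb{C}\setminus\mathbb{R}): f_{|\mathbb{C}^-}=SR(f_{|\mathbb{C}^+})\}$. A Herglotz-Nevanlinna function is an analytic $q:\mathbb{C}\setminus\mathbb{R}\to\mathbb{C}$ with $q(\overline{\zeta})=\overline{q(\zeta)}$ and $\mathrm{Im}\,q\ge0$ on $\mathbb{C}^+$. For $f\in\mathcal{N}(\mathbb{C}\setminus\mathbb{R})$,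 $U_{ext}(f)$ is the union of the domain of analyticity of $f$ in $\mathbb{C}\setminus\mathbb{R}$ and all $\zeta\in\mathbb{R}$ for which there is an open interval $(a,b)\ni\zeta$ such that $f$ can be analytically extended through $(a,b)$ (there is an analytic function on an open neighbourhood of $(a,b)$ agreeing with $f$ off $\mathbb{R}$). $\mathcal{S}_0$ is the set of $h\in\mathcal{N}(\mathbb{C}\setminus\mathbb{R})$ with $h_{|\mathbb{C}^+}\in\mathcal{H}^\infty(\mathbb{C}^+)\setminus\{0\}$, $\|h_{|\mathbb{C}^+}\|_{\mathcal{H}^\infty(\mathbb{C}^+)}\le 1$ and $h_{|\mathbb{C}^-}=1/SR(h_{|\mathbb{C}^+})$. $h_1$ divides $h_2$ (both in $\mathcal{S}_0$) if $h_2=h_1h_3$ for some $h_3\in\mathcal{S}_0$; $h_1,h_2$ are relatively prime if every $h \in \mathcal{S}_0$ dividing both restricts on $\mathbb{C}^+$ to a constant of modulus one. For $h\in\mathcal{S}_0$, $\mathcal{B}(h)$ is the reproducing kernel Hilbert space of analytic functions on $U_{ext}(h)$ with kernel $s_h(z,w)=\frac{1-h(z)\overline{h(w)}}{-\mathrm{i}(z-\overline{w})}$ (extended by continuity to $z=\overline{w}$); its elements are regarded as meromorphic functions on $\mathbb{C}\setminus\mathbb{R}$. A Krein space is a complex vector space $\mathcal{K}$ with a sesquilinear form that has a direct orthogonal decomposition $\mathcal{K}=\mathcal{K}_+[+]\mathcal{K}_-$ (a fundamental decomposition) such that $\mathcal{K}_+$ and $-\mathcal{K}_-:=(\mathcal{K}_-,-[\cdot,\cdot])$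 are Hilbert spaces. A relation is a linear subspace $A\subset\mathcal{K}\times\mathcal{K}$, with adjoint $A^+=\{(u,v):[u,y]=[v,x]\ \forall(x,y)\in A\}$; $A$ is self-adjoint if $A=A^+$, and symmetric if $A\subset A^+$. $D_w(g)(\zeta)=\frac{g(\zeta)-g(w)}{\zeta-w}$ for $\zeta\neq w$, $D_w(g)(w)=g'(w)$. Model relation: for $f\in\mathcal{N}_{sym}$ non-constant on $\mathbb{C}^+$, let $h_1,h_2\in\mathcal{S}_0$ be relatively prime with $f=\mathrm{i}\frac{h_2-h_1}{h_2+h_1}$ (such a pair exists, and $\mathcal{B}(h_1)\cap\mathcal{B}(h_2)=\{0\}$). Put $\mathcal{L}(f)=\frac{\sqrt2}{h_1+h_2}\cdot(\mathcal{B}(h_1)\oplus(-\mathcal{B}(h_2)))$, the space of functions $\frac{\sqrt2}{h_1+h_2}(g_1+g_2)$, $g_i\in\mathcal{B}(h_i)$, with the Krein space inner product $\left[\frac{\sqrt2}{h_1+h_2}(g_1+g_2),\frac{\sqrt2}{h_1+h_2}(g_1'+g_2')\right]=[g_1,g_1']_{\mathcal{B}(h_1)}-[g_2,g_2']_{\mathcal{B}(h_2)}$. Its elements extend analytically to $U_{ext}(f)$, and $D_w$ is bounded on $\mathcal{L}(f)$ for $w\in U_{ext}(f)$. The model relation $A_f$ is the self-adjoint relation in $\mathcal{L}(f)$ with $\varrho(A_f)=U_{ext}(f)$ and $(A_f-w)^{-1}=D_w$; explicitly $A_f=\{(h,g)\in\mathcal{L}(f)\times\mathcal{L}(f):\exists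 c\in\mathbb{C}: g(\zeta)-\zeta h(\zeta)\equiv c\}$. A self-adjoint relation $A$ in a Krein space $\mathcal{K}$ with $\varrho(A)\ne\emptyset$ is partially fundamentally reducible if there is a fundamental decomposition $\mathcal{K}=\mathcal{K}_+[+]\mathcal{K}_-$ such that $S_+:=A\cap(\mathcal{K}_+\times\mathcal{K}_+)$ and $S_-:=A\cap(\mathcal{K}_-\times\mathcal{K}_-)$ are closed, simple symmetric operators on the Hilbert spaces $\mathcal{K}_+$ and $-\mathcal{K}_-$ with deficiency index $(1,1)$. Here operators are identified with their graphs and need not be densely defined; the deficiency index of $S$ is $(\dim\ker(S^+-\mathrm{i}),\dim\ker(S^++\mathrm{i}))$; and $S$ is simple if there is no non-trivial orthogonal decomposition $\mathcal{H}=\mathcal{H}_1\oplus\mathcal{H}_2$ of the Hilbert space for which $S=S_1\oplus S_2$ with $S_2$ self-adjoint in $\mathcal{H}_2$. *)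

(* Defs.v *)
From HB Require Import structures.
From mathcomp Require Import all_boot all_order all_algebra.
From mathcomp Require Import generic_quotient ring_quotient complex.
From mathcomp Require Import all_classical all_reals all_analysis.

Set Implicit Arguments.
Unset Strict Implicit.
Unset Printing Implicit Defensive.

Import Order.TTheory GRing.Theory Num.Theory numFieldNormedType.Exports.

Local Open Scope classical_set_scope.
Local Open Scope ring_scope.
Local Open Scope quotient_scope.

(* The topology on R[i] induced by the modulus. *)
HB.instance Definition _ (R : realType) :=
  NormedModule.copy R[i] (R[i] : numFieldType)^o.

(* Hilbert and Krein spaces are linear subsets E of an ambient complex vector
   space V, with a form q : V -> V -> R[i] that matters only on E.  Forms are
   linear in the first argument.  In the order of R[i], 0 <= c means that c is
   real and nonnegative. *)
Section KreinSpaces.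
Context (R : realType) (V : lmodType R[i]).
Local Notation C := R[i].
Implicit Types (E H K : set V) (q : V -> V -> C) (A S : set (V * V)).

Definition hermitian_on E q :=
  (forall a x y z, E x -> E y -> E z -> q (a *: x + y) z = a * q x z + q y z) /\
  (forall x y, E x -> E y -> q y x = (q x y)^*).

Definition converges_to q (u : nat -> V) (x : V) :=
  (fun n => q (u n - x) (u n - x)) @ \oo --> (0 : C).

Record hilbert_space E q : Prop := HilbertSpace {
  hilbert_submod : submod_closed (mem E);
  hilbert_hermitian : hermitian_on E q;
  hilbert_pos : forall x, E x -> x != 0 -> 0 < q x x;
  hilbert_complete : forall u : nat -> V, (forall n, E (u n)) ->
    (forall e : C, 0 < e -> exists N, forall m n, (N <= m)%N -> (N <= n)%N ->
       q (u m - u n) (u m - u n) < e) ->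
    exists2 x, E x & converges_to q u x }.

Record fundamental_decomposition K q (Kp Km : set V) : Prop :=
  FundamentalDecomposition {
  fd_subp : Kp `<=` K;
  fd_subm : Km `<=` K;
  fd_sum : K = [set x + y | x in Kp & y in Km];
  fd_direct : Kp `&` Km = [set 0];
  fd_orth : forall x y, Kp x -> Km y -> q x y = 0;
  fd_hilbertp : hilbert_space Kp q;
  fd_hilbertm : hilbert_space Km (fun x y => - q x y) }.

Definition krein_space K q :=
  [/\ submod_closed (mem K), hermitian_on K q &
      exists Kp Km, fundamental_decomposition K q Kp Km].

Definition linear_relation K A := A `<=` K `*` K /\ submod_closed (mem A).

Definition adjoint K q A : set (V * V) :=
  [set p | K p.1 /\ K p.2 /\ forall x y, A (x, y) -> q p.1 y = q p.2 x].

Definition self_adjoint K q A := linear_relation K A /\ A = adjoint K q A.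

Definition symmetric_relation K q S :=
  linear_relation K S /\ S `<=` adjoint K q S.

(* (A - w)^-1 is defined everywhere on K, single-valued, and bounded for the
   norm sqrt ([x+, x+] - [x-, x-]) of a fundamental decomposition; all these
   norms are equivalent. *)
Definition resolvent_set K q A : set C :=
  [set w | (forall y, K y -> exists! x, A (x, y + w *: x)) /\
     exists Kp Km, fundamental_decomposition K q Kp Km /\
       exists M : R, forall xp xm yp ym, Kp xp -> Km xm -> Kp yp -> Km ym ->
         A (xp + xm, (yp + ym) + w *: (xp + xm)) ->
         q xp xp - q xm xm <= M%:C%C * (q yp yp - q ym ym)].

Definition is_operator S := forall y, S (0, y) -> y = 0.

Definition closed_relation H q S := forall (u v : nat -> V) x y,
  (forall n, S (u n, v n)) -> H x -> H y ->
  converges_to q u x -> converges_to q v y -> S (x, y).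

(* The sum of S1 and S2 is the sum of pairs in V * V. *)
Definition simple_relation H q S := forall (H1 H2 : set V) (S1 S2 : set (V * V)),
  hilbert_space H1 q -> hilbert_space H2 q ->
  (forall x y, H1 x -> H2 y -> q x y = 0) ->
  H = [set x + y | x in H1 & y in H2] ->
  linear_relation H1 S1 -> self_adjoint H2 q S2 ->
  S = [set r + s | r in S1 & s in S2] ->
  H2 = [set 0].

Definition has_dim E (n : nat) := exists b : 'I_n -> V, (forall i, E (b i)) /\
  forall x, E x -> exists! c : 'rV[C]_n, x = \sum_(i < n) c 0 i *: b i.

Definition ker_sub A (w : C) : set V := [set u | A (u, w *: u)].

Definition deficiency_index H q S (n m : nat) :=
  has_dim (ker_sub (adjoint H q S) 'i) n /\
  has_dim (ker_sub (adjoint H q S) (- 'i)) m.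

Definition closed_simple_symmetric_11 H q S :=
  [/\ is_operator S, closed_relation H q S, simple_relation H q S,
      symmetric_relation H q S & deficiency_index H q S 1 1].

Definition partially_fundamentally_reducible K q A :=
  [/\ krein_space K q, self_adjoint K q A, resolvent_set K q A !=set0 &
    exists Kp Km, [/\ fundamental_decomposition K q Kp Km,
      closed_simple_symmetric_11 Kp q (A `&` (Kp `*` Kp)) &
      closed_simple_symmetric_11 Km (fun x y => - q x y)
        (A `&` (Km `*` Km))]].

End KreinSpaces.

Section ComplexFunctions.
Context (R : realType).
Local Notation C := R[i].
Implicit Types (f g h : C -> C) (U : set C).

Definition upper : set C := [set z | 0 < complex.Im z].
Definition lower : set C := [set z | complex.Im z < 0].
Definition offR : set C := [set z | complex.Im z != 0].

Definition analytic_at f (z : C) := exists a : nat -> C,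
  \forall x \near z, series (fun n => a n * (x - z) ^+ n) @ \oo --> f x.

Definition analytic_on U f := forall z, U z -> analytic_at f z.

Definition pole_at f (z : C) := exists (n : nat) (g : C -> C),
  [/\ (0 < n)%N, analytic_at g z, g z != 0 &
      \forall x \near z^', f x = g x / (x - z) ^+ n].

(* A meromorphic function is represented by a total function whose removable
   singularities have been removed; its values at poles are irrelevant. *)
Definition meromorphic_on U f := forall z, U z -> analytic_at f z \/ pole_at f z.

(* Equality of meromorphic functions on U: equality off a set of isolated
   points of U. *)
Definition mero_eq U f g := forall z, U z -> \forall x \near z^', f x = g x.

Definition Hinfty U f := analytic_on U f /\
  exists M : R, forall z, U z -> `|f z| <= M%:C%C.

Definition Nclass_on U f := meromorphic_on U f /\ exists f1 f2,
  [/\ Hinfty U f1, Hinfty U f2, ~ (forall z, U z -> f2 z = 0) &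
      mero_eq U f (fun z => f1 z / f2 z)].

Definition Nclass f :=
  [/\ meromorphic_on offR f, Nclass_on upper f & Nclass_on lower f].

Definition SR g (z : C) : C := (g (z^*))^*.

Definition Nsym f := Nclass f /\ mero_eq lower f (SR f).

Definition herglotz_nevanlinna f :=
  [/\ analytic_on offR f, (forall z, offR z -> f (z^*) = (f z)^*) &
      forall z, upper z -> 0 <= complex.Im (f z)].

Definition Uext f : set C := [set z |
  (offR z /\ analytic_at f z) \/
  exists a b t : R, [/\ a < t < b, z = t%:C%C &
    exists (O : set C) (F : C -> C), [/\ open O,
      (forall s : R, a < s < b -> O (s%:C%C)), analytic_on O F &
      forall x, O x -> offR x -> F x = f x]]].

(* Value of the analytic extension of f at a point of Uext f; the values of
   the total function f on the real axis carry no information. *)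
Definition ext f (z : C) : C := lim (f x @[x --> within offR z^']).

Record S0 h : Prop := InS0 {
  S0_N : Nclass h;
  S0_Hinfty : Hinfty upper h;
  S0_neq0 : ~ (forall z, upper z -> h z = 0);
  S0_le1 : forall z, upper z -> `|h z| <= 1;
  S0_lower : mero_eq lower h (fun z => (SR h z)^-1) }.

Definition S0_divides h1 h2 := exists h3, S0 h3 /\
  mero_eq offR h2 (fun z => h1 z * h3 z).

Definition relatively_prime h1 h2 := forall h, S0 h ->
  S0_divides h h1 -> S0_divides h h2 ->
  exists c : C, `|c| = 1 /\ forall z, upper z -> h z = c.

Definition s_quot h (z w : C) : C :=
  (1 - ext h z * (ext h w)^*) / (- 'i * (z - w^*)).

Definition s_kernel h (z w : C) : C :=
  if z == w^* then lim (s_quot h x w @[x --> z^']) else s_quot h z w.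

Definition s_fun h (w : C) : C -> C := (fun z => s_kernel h z w) \_ (Uext h).

(* (B, ip) is the reproducing kernel Hilbert space B(h).  Functions on Uext h
   are extended by 0 to total functions. *)
Record is_Bspace h (B : set (C -> C)) (ip : (C -> C) -> (C -> C) -> C) : Prop :=
  IsBspace {
  Bspace_hilbert : hilbert_space B ip;
  Bspace_analytic : forall g, B g -> analytic_on (Uext h) g;
  Bspace_out : forall g z, B g -> ~ Uext h z -> g z = 0;
  Bspace_kernel : forall w, Uext h w -> B (s_fun h w);
  Bspace_repro : forall g w, B g -> Uext h w -> ip g (s_fun h w) = g w }.

(* Functions on the complement of the real axis modulo mero_eq offR.
   Meromorphic functions are considered as elements of this quotient. *)
Definition mero_null : {pred (C -> C)} := [pred f | `[< mero_eq offR f 0 >]].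

Lemma mero_null_zmod_closed : zmod_closed mero_null.
Proof.
split; first by apply/asboolP => z _; near=> x.
move=> f g /asboolP f0 /asboolP g0; apply/asboolP => z Uz.
near=> x; rewrite !fctE.
have -> : f x = 0 by near: x; apply: f0.
have -> : g x = 0 by near: x; apply: g0.
by rewrite subr0.
Unshelve. all: by end_near. Qed.

HB.instance Definition _ :=
  GRing.isZmodClosed.Build (C -> C) mero_null mero_null_zmod_closed.

Definition mero : Type := {ideal_quot mero_null}.

HB.instance Definition _ := GRing.Zmodule.on mero.

Definition mclass f : mero := \pi_({ideal_quot mero_null}) f.

Lemma mclassP f g : mclass f = mclass g <-> mero_eq offR f g.
Proof.
have mE : mclass f = mclass g <-> mero_eq offR (f - g) 0.
  rewrite /mclass; split.
    by move/eqP; rewrite -Quotient.idealrBE => /asboolP.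
  by move=> fg; apply/eqP; rewrite -Quotient.idealrBE; apply/asboolP.
rewrite mE; split => fg z Uz; near=> x.
  by apply/eqP; rewrite -subr_eq0; apply/eqP; near: x; apply: fg.
rewrite !fctE; apply/eqP; rewrite subr_eq0; apply/eqP.
by near: x; apply: fg.
Unshelve. all: by end_near. Qed.

Lemma mclassK (u : mero) : mclass (repr u) = u.
Proof. exact: reprK. Qed.

Lemma mclassD f g : mclass (f + g) = mclass f + mclass g.
Proof. by rewrite /mclass !piE. Qed.

Definition mero_scale (a : C) (u : mero) : mero := mclass (a *: repr u).

Lemma mclassZ a f : mclass (a *: f) = mero_scale a (mclass f).
Proof.
apply/mclassP => z Uz.
have /mclassP/(_ z Uz) e : mclass f = mclass (repr (mclass f)).
  by rewrite mclassK.
by near=> x; rewrite !fctE; congr (_ * _); near: x.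
Unshelve. all: by end_near. Qed.

Fact mero_scaleA a b u : mero_scale a (mero_scale b u) = mero_scale (a * b) u.
Proof. by rewrite -(mclassK u) -!mclassZ scalerA. Qed.

Fact mero_scale1 : left_id 1 mero_scale.
Proof. by move=> u; rewrite -(mclassK u) -mclassZ scale1r. Qed.

Fact mero_scaleDr : right_distributive mero_scale +%R.
Proof.
move=> a u v; rewrite -(mclassK u) -(mclassK v) -mclassD -!mclassZ.
by rewrite scalerDr mclassD.
Qed.

Fact mero_scaleDl u : {morph mero_scale^~ u : a b / a + b}.
Proof.
by move=> a b; rewrite -(mclassK u) -!mclassZ -mclassD scalerDl.
Qed.

HB.instance Definition _ := GRing.Zmodule_isLmodule.Build C mero
  mero_scaleA mero_scale1 mero_scaleDr mero_scaleDl.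

(* The condition on h2 + h1 excludes the convention x / 0 = 0. *)
Definition cayley_pair f h1 h2 := [/\ S0 h1, S0 h2, relatively_prime h1 h2,
  ~ (forall z, upper z -> h2 z + h1 z = 0) &
  mero_eq offR f (fun z => 'i * (h2 z - h1 z) / (h2 z + h1 z))].

Definition model_fun h1 h2 (g1 g2 : C -> C) : mero :=
  mclass (fun z => sqrtC 2 / (h1 z + h2 z) * (g1 z + g2 z)).

Definition model_relation (L : set mero) : set (mero * mero) := [set p |
  [/\ L p.1, L p.2 & exists u v (c : C), [/\ p.1 = mclass u, p.2 = mclass v &
      mero_eq offR (fun z => v z - z * u z) (fun=> c)]]].

(* (L, q) is the space L(f) with its inner product and A the relation A_f, for
   some admissible choice of h1 and h2. *)
Definition is_model_relation f (L : set mero) (q : mero -> mero -> C)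
    (A : set (mero * mero)) :=
  exists (h1 h2 : C -> C) (B1 B2 : set (C -> C))
         (ip1 ip2 : (C -> C) -> (C -> C) -> C),
  [/\ cayley_pair f h1 h2, is_Bspace h1 B1 ip1, is_Bspace h2 B2 ip2 &
  [/\ L = [set model_fun h1 h2 g1 g2 | g1 in B1 & g2 in B2],
      (forall g1 g2 g1' g2', B1 g1 -> B2 g2 -> B1 g1' -> B2 g2' ->
         q (model_fun h1 h2 g1 g2) (model_fun h1 h2 g1' g2') =
         ip1 g1 g1' - ip2 g2 g2') &
      A = model_relation L]].

End ComplexFunctions.

(* Main.v *)
Require Import Defs.
From mathcomp Require Import all_boot all_order all_algebra complex.
From mathcomp Require Import all_classical all_reals all_analysis.
From mathcomp Require Import ring lra.
Set Implicit Arguments.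
Unset Strict Implicit.
Unset Printing Implicit Defensive.
Import Order.TTheory GRing.Theory Num.Theory numFieldNormedType.Exports.
Local Open Scope classical_set_scope.
Local Open Scope ring_scope.

(* In B(h) the multiplication by z is a symmetric relation whose adjoint consists
   of the pairs (x, y) with y - z x = al + be h.  Green's identity
     [y, x'] - [x, y'] = -i (al conj(al') - be conj(be'))
   holds on the span of the reproducing kernels, by the formula for the kernel,
   and it bounds the difference-quotient operators there.  These are therefore
   everywhere defined, and the identity extends to all pairs.  It follows that
   multiplication by z in B(h) is simple with deficiency index (1,1) unless h is
   a unimodular constant.

   A pair of L(f) belongs to A_f iff its components satisfy
     y1 - z x1 = al + c h1,  y2 - z x2 = -al + c h2
   for some al and c, so that the boundary terms of h1 and h2 cancel; this makes
   A_f self-adjoint.  If both components of the pair vanish in B(h2) (or in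
   B(h1)), then al = c = 0 unless h2 (or h1) is a unimodular constant, that is,
   unless f or -f is a Herglotz-Nevanlinna function.  Hence the decomposition
   of L(f) into the images of B(h1) and B(h2) is the required one. *)

(** * Complex moduli and Hilbert spaces *)

(** Elements of B(h) are accessible only through the reproducing kernels, and h may have poles in
    the lower half-plane. Nevertheless a vector is needed at every nonreal point, because the
    resolvent at [w0] is built from the vector at the conjugate of [w0]. Replacing h by homogeneous
    coordinates (a : b) and rescaling the kernel accordingly gives a Gram formula that makes sense
    at poles too. With the coefficients al and be made explicit, the rest becomes linear algebra
    with two coefficients per space. For the coupled relation this is a 2x2 system whose determinant
    a1 b2 + a2 b1 equals h1 + h2 on the upper half-plane. It is nonzero at some w and, by
    reflection, at the conjugate of w; together with symmetry this gives self-adjointness. That an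
    element of L(f) splits uniquely into its two components is read off from the given form: the
    form depends only on classes of functions, and a common element of both components is orthogonal
    to itself. *)

Section ComplexNumbers.
Context (R : realType).
Local Notation C := R[i].
Implicit Types (z w : C) (r : R).

Lemma conjE z : z^* = conjc z. Proof. by []. Qed.

Lemma ReD z w : complex.Re (z + w) = complex.Re z + complex.Re w.
Proof. by case: z w => [? ?] [? ?]. Qed.

Lemma ReN z : complex.Re (- z) = - complex.Re z.
Proof. by case: z. Qed.

Lemma ReZ r z : complex.Re (r%:C%C * z) = r * complex.Re z.
Proof. by case: z => [a b] /=; rewrite mul0r subr0. Qed.

Lemma ReiM z : complex.Re ('i * z) = - complex.Im z.
Proof. by case: z => [a b] /=; rewrite mul0r mul1r sub0r. Qed.

Lemma conj_real r : (r%:C%C)^* = r%:C%C :> C.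
Proof. by rewrite conjE /= oppr0. Qed.

Lemma conj_i : 'i^* = - 'i :> C.
Proof. by rewrite conjE; apply/eqP; rewrite eq_complex /= oppr0 !eqxx. Qed.

Lemma gt0_complexP (e : C) : 0 < e -> exists2 r : R, 0 < r & e = r%:C%C.
Proof.
by case: e => a b; rewrite ltcE /= => /andP[/eqP -> a0]; exists a.
Qed.

Lemma ge0_complexE z : 0 <= z -> z = (complex.Re z)%:C%C.
Proof. by case: z => a b; rewrite lecE /= => /andP[/eqP -> _]. Qed.

Lemma complex0P z : complex.Re z = 0 -> complex.Im z = 0 -> z = 0.
Proof. by case: z => a b /= -> ->. Qed.

Definition cmod z : R := Num.sqrt (complex.Re z ^+ 2 + complex.Im z ^+ 2).

Lemma cmodE z : `|z| = (cmod z)%:C%C. Proof. exact: normc_def. Qed.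

Lemma cmod_ge0 z : 0 <= cmod z. Proof. exact: sqrtr_ge0. Qed.

Lemma cmodD z w : cmod (z + w) <= cmod z + cmod w.
Proof. by rewrite -lecR rmorphD /= -!cmodE; exact: ler_normD. Qed.

Lemma cmodM z w : cmod (z * w) = cmod z * cmod w.
Proof. by apply: complexI; rewrite rmorphM /= -!cmodE; exact: normrM. Qed.

Lemma cmodN z : cmod (- z) = cmod z.
Proof. by rewrite /cmod; case: z => a b /=; rewrite !sqrrN. Qed.

Lemma cmodBC z w : cmod (z - w) = cmod (w - z).
Proof. by rewrite -cmodN opprB. Qed.

Lemma cmodB z w : cmod (z - w) <= cmod z + cmod w.
Proof. by rewrite -[X in _ <= _ + X]cmodN; exact: cmodD. Qed.

Lemma cmod_distD w z t : cmod (z - t) <= cmod (z - w) + cmod (w - t).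
Proof. by rewrite -[z - t](subrKA w); exact: cmodD. Qed.

Lemma cmod_conj z : cmod z^* = cmod z.
Proof. by rewrite /cmod conjE; case: z => a b /=; rewrite sqrrN. Qed.

Lemma cmod_real r : cmod r%:C%C = `|r|.
Proof. by rewrite /cmod /= expr0n /= addr0 sqrtr_sqr. Qed.

Lemma cmod_nat n : cmod n%:R = n%:R.
Proof. by rewrite -(rmorph_nat (real_complex R)) cmod_real ger0_norm. Qed.

Lemma cmod0 : cmod 0 = 0. Proof. exact: (cmod_nat 0). Qed.
Lemma cmod1 : cmod 1 = 1. Proof. exact: (cmod_nat 1). Qed.

Lemma cmodX z n : cmod (z ^+ n) = cmod z ^+ n.
Proof.
by elim: n => [|n IH]; rewrite ?expr0 ?cmod1 // !exprS cmodM IH.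
Qed.

Lemma cmod_sqrE z : ((cmod z) ^+ 2)%:C%C = z * z^*.
Proof. by rewrite rmorphXn /= -cmodE normCK. Qed.

Lemma cmod_eq0 z : (cmod z == 0) = (z == 0).
Proof.
apply/eqP/eqP => [z0|->]; last exact: cmod0.
have : z * z^* == 0 by rewrite -cmod_sqrE z0 expr0n.
by rewrite mulf_eq0 conjC_eq0 orbb => /eqP.
Qed.

Lemma cmod_gt0 z : (0 < cmod z) = (z != 0).
Proof. by rewrite lt_def cmod_eq0 cmod_ge0 andbT. Qed.

Lemma cmodV z : cmod z^-1 = (cmod z)^-1.
Proof.
have [->|z0] := eqVneq z 0; first by rewrite invr0 cmod0 invr0.
apply: (@mulfI _ (cmod z)); first by rewrite cmod_eq0.
by rewrite -cmodM !divff ?cmod_eq0 // cmod1.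
Qed.

Lemma normC_ltE z r : (`|z| < r%:C%C) = (cmod z < r).
Proof. by rewrite cmodE; exact: ltcR. Qed.

Lemma cvgCP {T : Type} {F : set_system T} {FF : Filter F} (u : T -> C) z :
  u @ F --> z <-> forall e : R, 0 < e -> \forall t \near F, cmod (u t - z) < e.
Proof.
split=> [/cvgr_distC_lt uz e e0|uz].
  have e0' : 0 < e%:C%C by rewrite ltcR.
  by apply: filterS (uz _ e0') => t; rewrite -normC_ltE.
apply/cvgrPdist_lt => _ /gt0_complexP[e e0 ->].
by apply: filterS (uz _ e0) => t; rewrite cmodBC -normC_ltE.
Qed.

Section ComplexLimits.
Context {T : Type} {F : set_system T} {FF : Filter F}.
Implicit Types u v : T -> C.

Lemma cvgC_cst z : (fun _ : T => z) @ F --> z.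
Proof. exact: cvg_cst. Qed.

Lemma cvgCD u v z w : u @ F --> z -> v @ F --> w ->
  (fun t => u t + v t) @ F --> z + w.
Proof. exact: cvgD. Qed.

Lemma cvgCB u v z w : u @ F --> z -> v @ F --> w ->
  (fun t => u t - v t) @ F --> z - w.
Proof. exact: cvgB. Qed.

Lemma cvgCM u v z w : u @ F --> z -> v @ F --> w ->
  (fun t => u t * v t) @ F --> z * w.
Proof. exact: cvgM. Qed.

Lemma cvgCV u z : z != 0 -> u @ F --> z -> (fun t => (u t)^-1) @ F --> z^-1.
Proof. exact: cvgV. Qed.

End ComplexLimits.

Lemma cvg_conj {T : Type} {F : set_system T} {FF : Filter F} (u : T -> C) z :
  u @ F --> z -> (fun t => (u t)^*) @ F --> z^*.
Proof.
move=> /cvgCP uz; apply/cvgCP => e /uz.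
by apply: filterS => t; rewrite -rmorphB cmod_conj.
Qed.

Lemma cvg_eq {T : Type} {F : set_system T} {FF : ProperFilter F} (u : T -> C) z w :
  u @ F --> z -> u @ F --> w -> z = w.
Proof. exact: (cvg_unique (@norm_hausdorff C C)). Qed.

End ComplexNumbers.
Arguments cvgC_cst {R T F FF} z.

(** * Norm, convergence and closed subspaces of a Hilbert space *)

Section HilbertSpaces.
Context (R : realType) (V : lmodType R[i]) (E : set V) (q : V -> V -> R[i]).
Hypothesis hE : hilbert_space E q.
Local Notation C := R[i].
Implicit Types (x y z : V) (a : C).

Let Esub : submod_closed (mem E) := hilbert_submod hE.

Lemma hilb0 : E 0.
Proof. by have [] := Esub; rewrite inE. Qed.

Lemma hilbL a x y : E x -> E y -> E (a *: x + y).
Proof.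
move=> Ex Ey; have [_ /(_ a x y)] := Esub.
by rewrite !inE; apply.
Qed.

Lemma hilbD x y : E x -> E y -> E (x + y).
Proof. by move=> Ex Ey; rewrite -[x]scale1r; exact: hilbL. Qed.

Lemma hilbZ a x : E x -> E (a *: x).
Proof. by move=> Ex; rewrite -[_ *: _]addr0; apply: hilbL => //; exact: hilb0. Qed.

Lemma hilbN x : E x -> E (- x).
Proof. by rewrite -scaleN1r; exact: hilbZ. Qed.

Lemma hilbB x y : E x -> E y -> E (x - y).
Proof. by move=> Ex Ey; apply: hilbD => //; exact: hilbN. Qed.

Ltac memE := repeat first
  [ assumption | exact: hilb0
  | match goal with H : forall n, E (_ n) |- _ => apply: H end
  | apply: hilbD | apply: hilbB
  | apply: hilbZ | apply: hilbN ].
#[local] Hint Extern 0 (E _) => solve [memE] : core.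

Lemma hilbLl a x y z : E x -> E y -> E z -> q (a *: x + y) z = a * q x z + q y z.
Proof. by have [+ _] := hilbert_hermitian hE; apply. Qed.

Lemma hilbC x y : E x -> E y -> q y x = (q x y)^*.
Proof. by have [_] := hilbert_hermitian hE; apply. Qed.

Lemma hilbDl x y z : E x -> E y -> E z -> q (x + y) z = q x z + q y z.
Proof. by move=> *; rewrite -{1}[x]scale1r hilbLl // mul1r. Qed.

Lemma hilb0l z : E z -> q 0 z = 0.
Proof.
by move=> Ez; apply: (addrI (q 0 z)); rewrite -hilbDl // !addr0.
Qed.

Lemma hilbZl a x z : E x -> E z -> q (a *: x) z = a * q x z.
Proof. by move=> *; rewrite -[_ *: _]addr0 hilbLl // hilb0l // addr0. Qed.

Lemma hilbNl x z : E x -> E z -> q (- x) z = - q x z.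
Proof. by move=> *; rewrite -scaleN1r hilbZl // mulN1r. Qed.

Lemma hilbBl x y z : E x -> E y -> E z -> q (x - y) z = q x z - q y z.
Proof. by move=> *; rewrite hilbDl // hilbNl. Qed.

Lemma hilb0r z : E z -> q z 0 = 0.
Proof. by move=> Ez; rewrite hilbC // hilb0l // rmorph0. Qed.

Lemma hilbDr x y z : E x -> E y -> E z -> q z (x + y) = q z x + q z y.
Proof.
by move=> *; rewrite hilbC // hilbDl // rmorphD /= -!hilbC.
Qed.

Lemma hilbZr a x z : E x -> E z -> q z (a *: x) = a^* * q z x.
Proof. by move=> *; rewrite hilbC // hilbZl // rmorphM /= -hilbC. Qed.

Lemma hilbNr x z : E x -> E z -> q z (- x) = - q z x.
Proof. by move=> *; rewrite hilbC // hilbNl // rmorphN /= -hilbC. Qed.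

Lemma hilbBr x y z : E x -> E y -> E z -> q z (x - y) = q z x - q z y.
Proof. by move=> *; rewrite hilbDr // hilbNr. Qed.

Lemma hilb_ge0 x : E x -> 0 <= q x x.
Proof.
move=> Ex; have [->|x0] := eqVneq x 0; first by rewrite hilb0l.
exact/ltW/(hilbert_pos hE).
Qed.

Lemma hilb_eq0 x : E x -> q x x = 0 -> x = 0.
Proof.
move=> Ex xx; apply/eqP; apply: contraT => x0.
by have := hilbert_pos hE Ex x0; rewrite xx ltxx.
Qed.

Definition nrm2 x : R := complex.Re (q x x).

Lemma nrm2E x : E x -> q x x = (nrm2 x)%:C%C.
Proof. by move=> Ex; apply: ge0_complexE; exact: hilb_ge0. Qed.

Lemma nrm2_ge0 x : E x -> 0 <= nrm2 x.
Proof. by move=> Ex; rewrite -ler0c -nrm2E // hilb_ge0. Qed.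

Definition rdot x y : R := complex.Re (q x y).

Lemma rdotC x y : E x -> E y -> rdot y x = rdot x y.
Proof. by move=> *; rewrite /rdot hilbC //; case: (q x y). Qed.

Lemma nrm2D x y : E x -> E y -> nrm2 (x + y) = nrm2 x + 2 * rdot x y + nrm2 y.
Proof.
move=> Ex Ey; rewrite /nrm2 hilbDl // !hilbDr // !ReD.
by have := rdotC Ex Ey; rewrite /rdot => ->; ring.
Qed.

Lemma nrm2Z a x : E x -> nrm2 (a *: x) = cmod a ^+ 2 * nrm2 x.
Proof.
by move=> Ex; rewrite /nrm2 hilbZl // hilbZr // mulrA -cmod_sqrE ReZ.
Qed.

Lemma nrm2N x : E x -> nrm2 (- x) = nrm2 x.
Proof. by move=> Ex; rewrite /nrm2 hilbNl // hilbNr // opprK. Qed.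

Lemma nrm2BC x y : E x -> E y -> nrm2 (x - y) = nrm2 (y - x).
Proof. by move=> Ex Ey; rewrite -nrm2N // opprB. Qed.

Lemma rdotNr x y : E x -> E y -> rdot x (- y) = - rdot x y.
Proof. by move=> *; rewrite /rdot hilbNr // ReN. Qed.

Lemma nrm2_parallelogram x y : E x -> E y ->
  nrm2 (x + y) + nrm2 (x - y) = 2 * nrm2 x + 2 * nrm2 y.
Proof.
by move=> *; rewrite !nrm2D // nrm2N // rdotNr //; ring.
Qed.

Lemma nrm2D_le x y : E x -> E y -> nrm2 (x + y) <= 2 * nrm2 x + 2 * nrm2 y.
Proof.
move=> Ex Ey; rewrite -nrm2_parallelogram // lerDl.
by apply: nrm2_ge0.
Qed.

Lemma cauchy_schwarz x y : E x -> E y -> cmod (q x y) ^+ 2 <= nrm2 x * nrm2 y.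
Proof.
move=> Ex Ey; have [->|y0] := eqVneq y 0.
  by rewrite hilb0r // /nrm2 hilb0l // cmod0 expr0n mulr0.
have yy : 0 < nrm2 y by rewrite -ltcR -nrm2E //; exact: (hilbert_pos hE).
pose t := q x y / (nrm2 y)%:C%C.
have ct : q x y = (nrm2 y)%:C%C * t.
  by rewrite /t mulrC divfK // gt_eqF // ltcR.
have := @nrm2_ge0 (x - t *: y) _.
rewrite nrm2D // nrm2N // nrm2Z // rdotNr // {1}/rdot hilbZr // => /(_ _)/wrap[] //.
rewrite {1}ct mulrCA -[_^* * _]mulrC -cmod_sqrE -rmorphM /= => h.
rewrite ct cmodM cmod_real gtr0_norm // exprMn expr2 -mulrA mulrC ler_pM2r //.
lra.
Qed.

Lemma converges_toP (u : nat -> V) x : (forall n, E (u n)) -> E x ->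
  converges_to q u x <->
  (forall e : R, 0 < e -> \forall n \near \oo, nrm2 (u n - x) < e).
Proof.
move=> Eu Ex; split => [/cvgCP ux e /ux|ux].
  apply: filterS => n; rewrite subr0 nrm2E // cmod_real.
  by rewrite ger0_norm // nrm2_ge0.
apply/cvgCP => e /ux; apply: filterS => n.
by rewrite subr0 nrm2E // cmod_real ger0_norm // nrm2_ge0.
Qed.

Lemma converges_to_ql (u : nat -> V) x z : (forall n, E (u n)) -> E x -> E z ->
  converges_to q u x -> (fun n => q (u n) z) @ \oo --> q x z.
Proof.
move=> Eu Ex Ez /converges_toP -/(_ Eu Ex) ux; apply/cvgCP => e e0.
have z1 : 0 < nrm2 z + 1 by rewrite ltr_pwDr // nrm2_ge0.
have d0 : 0 < e ^+ 2 / (nrm2 z + 1) by rewrite divr_gt0 // exprn_gt0.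
apply: filterS (ux _ d0) => n h.
rewrite -hilbBl // -(@ltr_pXn2r _ 2) ?nnegrE ?cmod_ge0 ?(ltW e0) //.
have EB : E (u n - x) by [].
apply: le_lt_trans (cauchy_schwarz EB Ez) _.
apply: (@le_lt_trans _ _ (nrm2 (u n - x) * (nrm2 z + 1))).
  by rewrite ler_wpM2l ?nrm2_ge0 // lerDl.
by rewrite -ltr_pdivlMr.
Qed.

Lemma converges_to_qr (u : nat -> V) x z : (forall n, E (u n)) -> E x -> E z ->
  converges_to q u x -> (fun n => q z (u n)) @ \oo --> q z x.
Proof.
move=> Eu Ex Ez ux; rewrite (hilbC Ex Ez).
have -> : (fun n => q z (u n)) = (fun n => (q (u n) z)^*).
  by apply/funext => n; exact: hilbC.
by apply: cvg_conj; exact: converges_to_ql.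
Qed.

Lemma hilb_cauchy (u : nat -> V) : (forall n, E (u n)) ->
  (forall e : R, 0 < e -> exists N, forall m n, (N <= m)%N -> (N <= n)%N ->
     nrm2 (u m - u n) < e) -> exists2 x, E x & converges_to q u x.
Proof.
move=> Eu cu; apply: (hilbert_complete hE) => // _ /gt0_complexP[e e0 ->].
have [N hN] := cu _ e0; exists N => m n Nm Nn.
by rewrite nrm2E // ltcR; exact: hN.
Qed.

(** Expanding [nrm2 (u m - u n)] leaves only Gram entries, all close to [G], so the sequence is
    Cauchy. This is how kernels at points approaching a pole of h are shown to converge. *)
Lemma hilb_gram_cvg (u : nat -> V) (G : C) : (forall n, E (u n)) ->
  (fun p : nat * nat => q (u p.1) (u p.2)) @ (\oo, \oo) --> G ->
  exists2 x, E x & converges_to q u x.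
Proof.
move=> Eu /cvgCP cG; apply: (hilb_cauchy Eu) => e e0.
have e4 : 0 < e / 4 by rewrite divr_gt0.
have [[P Q] /= [[N1 _ hP] [N2 _ hQ]] PQ] := cG _ e4.
exists (maxn N1 N2) => m n; rewrite !geq_max => /andP[m1 m2] /andP[n1 n2].
have close i j : (N1 <= i)%N -> (N2 <= j)%N -> `|rdot (u i) (u j) - complex.Re G| < e / 4.
  move=> i1 j2; have := PQ (i, j) (conj (hP _ i1) (hQ _ j2)).
  move=> /= h; apply: le_lt_trans h.
  by rewrite /rdot -ReN -ReD /cmod -sqrtr_sqr ler_wsqrtr // lerDl sqr_ge0.
rewrite nrm2D // nrm2N // rdotNr //.
have := close _ _ m1 m2; have := close _ _ n1 n2; have := close _ _ m1 n2.
rewrite !ltr_norml /rdot -/(nrm2 (u m)) -/(nrm2 (u n)).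
move=> /andP[h1 _] /andP[_ h2] /andP[_ h3]; lra.
Qed.

Lemma converges_to_cauchy (u : nat -> V) x : (forall n, E (u n)) -> E x ->
  converges_to q u x ->
  forall e : R, 0 < e -> exists N, forall m n, (N <= m)%N -> (N <= n)%N ->
     nrm2 (u m - u n) < e.
Proof.
move=> Eu Ex /converges_toP -/(_ Eu Ex) ux e e0.
have [|N _ hN] := ux (e / 4); first by rewrite divr_gt0.
exists N => m n /hN /= hm /hN /= hn.
have := @nrm2D_le (u m - x) (x - u n) _ _.
rewrite subrKA (@nrm2BC x) // => /(_ _ _)/wrap[] // /wrap[] //; lra.
Qed.

Lemma converges_toD (u v : nat -> V) x y : (forall n, E (u n)) ->
  (forall n, E (v n)) -> E x -> E y -> converges_to q u x ->
  converges_to q v y -> converges_to q (fun n => u n + v n) (x + y).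
Proof.
move=> Eu Ev Ex Ey /converges_toP -/(_ Eu Ex) ux.
move=> /converges_toP -/(_ Ev Ey) vy; apply/converges_toP => // e e0.
have e4 : 0 < e / 4 by rewrite divr_gt0.
apply: filterS2 (ux _ e4) (vy _ e4) => n h1 h2.
have := @nrm2D_le (u n - x) (v n - y) _ _.
by rewrite addrACA -opprD => /(_ _ _)/wrap[] // /wrap[] //; lra.
Qed.

Lemma converges_toZ (u : nat -> V) x a : (forall n, E (u n)) -> E x ->
  converges_to q u x -> converges_to q (fun n => a *: u n) (a *: x).
Proof.
move=> Eu Ex /converges_toP -/(_ Eu Ex) ux; apply/converges_toP => // e e0.
have a1 : 0 < cmod a ^+ 2 + 1 by rewrite ltr_pwDr // exprn_ge0 // cmod_ge0.
have d0 : 0 < e / (cmod a ^+ 2 + 1) by rewrite divr_gt0.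
apply: filterS (ux _ d0) => n; rewrite ltr_pdivlMr // => h.
rewrite -scalerBr nrm2Z //; apply: le_lt_trans h.
by rewrite mulrC ler_wpM2l ?nrm2_ge0 // lerDl.
Qed.

(* A vector minimizing the distance to F exists by the parallelogram identity
   and completeness; the difference is orthogonal to F. *)
Lemma closed_total (F : set V) : F `<=` E -> submod_closed (mem F) ->
  (forall (u : nat -> V) x, (forall n, F (u n)) -> E x -> converges_to q u x -> F x) ->
  (forall y, E y -> (forall x, F x -> q y x = 0) -> y = 0) -> E `<=` F.
Proof.
move=> FE [F0 FL] Fcl Ftot g Eg.
have {}F0 : F 0 by rewrite inE in F0.
have {}FL a x y : F x -> F y -> F (a *: x + y).
  by move=> Fx Fy; have := FL a x y; rewrite !inE; apply.
have FZ a x : F x -> F (a *: x) by move=> Fx; rewrite -[_ *: _]addr0; exact: FL.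
pose D := [set nrm2 (g - x) | x in F].
have D0 : D !=set0 by exists (nrm2 (g - 0)); exists 0.
have Dlb : has_lbound D.
  by exists 0 => _ [x /FE Ex <-]; apply: nrm2_ge0.
have Dinf : has_inf D by split.
have infD x : F x -> inf D <= nrm2 (g - x).
  by move=> Fx; apply: ge_inf => //; exists x.
have /choice[u hu] : forall n, exists x, F x /\ nrm2 (g - x) < inf D + n.+1%:R^-1.
  move=> n; have [|_ [x Fx <-] lt_x] := @inf_adherent _ D n.+1%:R^-1 _ Dinf.
    by rewrite invr_gt0.
  by exists x.
have Fu n : F (u n) by have [] := hu n.
have Eu n : E (u n) by exact: FE.
have hu' n : nrm2 (g - u n) < inf D + n.+1%:R^-1 by have [] := hu n.
have inv_le m N : (N <= m)%N -> m.+1%:R^-1 <= N.+1%:R^-1 :> R.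
  by move=> Nm; rewrite lef_pV2 ?posrE // ler_nat.
have invN (e : R) : 0 < e -> exists N, N.+1%:R^-1 < e.
  move=> e0; exists (Num.truncn e^-1); rewrite -[ltRHS]invrK ltf_pV2 ?posrE ?invr_gt0 //.
  exact: truncnS_gt.
have [x Ex ux] : exists2 x, E x & converges_to q u x.
  apply: hilb_cauchy => // e e0; have [|N hN] := invN (e / 4).
    by rewrite divr_gt0.
  exists N => m n Nm Nn.
  (* The midpoint lies in [F], so the parallelogram identity bounds [nrm2 (u m - u n)] by 2/(m+1) +
     2/(n+1). *)
  have mid : F (2^-1 *: (u m + u n)).
    by apply: FZ; rewrite -[u m]scale1r; exact: FL.
  have := @nrm2_parallelogram (g - u m) (g - u n) _ _ => /(_ _ _)/wrap[] // /wrap[] //.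
  have -> : g - u m + (g - u n) = (2 : C) *: (g - 2^-1 *: (u m + u n)).
    rewrite scalerBr scalerA divff ?pnatr_eq0 // scale1r scaler_nat mulr2n.
    by rewrite opprD addrACA.
  have -> : g - u m - (g - u n) = u n - u m.
    by rewrite opprB addrC addrA subrK.
  rewrite nrm2Z // (cmod_nat R 2) (@nrm2BC (u n)) // => par.
  have := infD _ mid; have := hu' m; have := hu' n.
  have := inv_le _ _ Nm; have := inv_le _ _ Nn; move: hN par.
  rewrite -natrX; move: (nrm2 _) (nrm2 _) (nrm2 _) (nrm2 _) (inf D).
  move: (N.+1%:R^-1) (n.+1%:R^-1) (m.+1%:R^-1) => *; lra.
have Fx : F x by exact: Fcl ux.
suff : g - x = 0 by move/eqP; rewrite subr_eq0 => /eqP ->.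
have rdot0 y : F y -> rdot (g - x) y = 0.
  move=> Fy; have Ey := FE _ Fy.
  (* The point u n - t y of [F] has squared distance at least inf D from [g]; expanding and letting
     n grow gives the inequality. The value of t that minimizes the quadratic then forces [rdot] to
     vanish. *)
  have key (t : R) : 0 <= 2 * t * rdot (g - x) y + t ^+ 2 * nrm2 y.
    rewrite leNgt; apply/negP => neg.
    set w := 2 * t * _ + _ in neg.
    have cv : (fun n => rdot (g - u n) y) @ \oo --> rdot (g - x) y.
      have : (fun n => q (g - u n) y) @ \oo --> q (g - x) y.
        have -> : (fun n => q (g - u n) y) = (fun n => q g y - q (u n) y).
          by apply/funext => n; rewrite hilbBl.
        rewrite (hilbBl Eg Ex Ey); apply: cvgCB; first exact: cvgC_cst.
        exact: converges_to_ql.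
      move=> /cvgCP cq; apply/cvgrPdist_lt => e /cq; apply: filterS => n.
      apply: le_lt_trans; rewrite /rdot distrC.
      case: (q _ _) (q _ _) => [a b] [c d] /=; rewrite /cmod /=.
      by rewrite -sqrtr_sqr ler_wsqrtr // lerDl sqr_ge0.
    have cv2 : (fun n => 2 * t * rdot (g - u n) y + t ^+ 2 * nrm2 y +
        n.+1%:R^-1) @ \oo --> w + 0.
      apply: cvgD; last exact: cvg_harmonic.
      by apply: cvgD; [apply: cvgMr|exact: cvg_cst].
    have : 0 <= w + 0.
      apply: (cvgr_to_ge cv2); apply: nearW => n /=.
      have tR : F (u n - t%:C%C *: y).
        by rewrite addrC -scaleNr; exact: FL.
      have := infD _ tR; have := hu' n.
      have -> : g - (u n - t%:C%C *: y) = g - u n + t%:C%C *: y.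
        by rewrite opprB addrCA addrC.
      rewrite (@nrm2D (g - u n)) // nrm2Z // cmod_real.
      have -> : rdot (g - u n) (t%:C%C *: y) = t * rdot (g - u n) y.
        by rewrite /rdot hilbZr // conj_real ReZ.
      rewrite real_normK ?num_real //; move: n.+1%:R^-1 => d; lra.
    by rewrite addr0 leNgt neg.
  have [Ny|Ny] := eqVneq (nrm2 y) 0.
    have := key (- rdot (g - x) y); rewrite Ny mulr0 addr0 mulrN mulNr oppr_ge0 -mulrA.
    rewrite pmulr_rle0 // -expr2 => h.
    by apply/eqP; rewrite -sqrf_eq0 eq_le h sqr_ge0.
  have Ny0 : 0 < nrm2 y by rewrite lt_def Ny nrm2_ge0.
  have := key (- rdot (g - x) y / nrm2 y).
  have -> : 2 * (- rdot (g - x) y / nrm2 y) * rdot (g - x) y +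
      (- rdot (g - x) y / nrm2 y) ^+ 2 * nrm2 y = - (rdot (g - x) y ^+ 2 / nrm2 y).
    by field.
  rewrite oppr_ge0 pmulr_lle0 ?invr_gt0 // => h.
  by apply/eqP; rewrite -sqrf_eq0 eq_le h sqr_ge0.
apply: Ftot => // y Fy; have Ey := FE _ Fy.
apply: complex0P; first exact: rdot0.
(* Real orthogonality to ['i *: y] is the vanishing of the imaginary part. *)
have := rdot0 _ (FZ 'i _ Fy); rewrite /rdot hilbZr // conj_i mulNr ReN ReiM opprK.
by [].
Qed.

End HilbertSpaces.

(** * Boundary models *)

Section BoundaryModels.
Context (R : realType) (V : lmodType R[i]) (E : set V) (q : V -> V -> R[i]).
Local Notation C := R[i].
Local Notation nrm2 := (nrm2 q).
Local Notation Im := complex.Im.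

Lemma conj_upper (w : C) : upper w -> lower w^*.
Proof. by rewrite /upper /lower /= conjE; case: w => x y /=; rewrite oppr_lt0. Qed.

Lemma conj_lower (w : C) : lower w -> upper w^*.
Proof. by rewrite /upper /lower /= conjE; case: w => x y /=; rewrite oppr_gt0. Qed.

Lemma upper_offR (w : C) : upper w -> offR w.
Proof. by rewrite /upper /offR /= => /gt_eqF ->. Qed.

Lemma lower_offR (w : C) : lower w -> offR w.
Proof. by rewrite /lower /offR /= => /lt_eqF ->. Qed.

Lemma offRP (w : C) : offR w -> upper w \/ lower w.
Proof. by rewrite /offR /upper /lower /= neq_lt => /orP[]; [right|left]. Qed.

Lemma conj_offR (w : C) : offR w -> offR w^*.
Proof. by case/offRP => [/conj_upper/lower_offR|/conj_lower/upper_offR]. Qed.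

Lemma opp_offR (w : C) : offR w -> offR (- w).
Proof. by rewrite /offR /=; case: w => x y /=; rewrite oppr_eq0. Qed.

Lemma upper_i : upper ('i : C).
Proof. by rewrite /upper /= ltr01. Qed.

(* e w is a nonzero multiple of the reproducing kernel at w, and (a w, b w)
   are homogeneous coordinates of the value at w of the function h in S0 that
   determines the space; poles of h are not exceptional. *)
Record boundary_model (e : C -> V) (a b : C -> C) : Prop := BoundaryModel {
  bm_hilbert : hilbert_space E q;
  bm_mem : forall w, offR w -> E (e w);
  bm_gram : forall v w, offR v -> offR w ->
    - 'i * (v - w^*) * q (e w) (e v) = a v * (a w)^* - b v * (b w)^*;
  bm_total : forall w0 x, E x ->
    (forall w, offR w -> w != w0 -> q x (e w) = 0) -> x = 0;
  bm_upper : forall w, upper w -> a w = 1;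
  bm_lower : forall w, lower w -> b w = 1 }.

(* For the space B(h) this says that y z - z * x z = al + be * h z. *)
Definition bdrel (e : C -> V) (a b : C -> C) x y (al be : C) :=
  [/\ E x, E y & forall w, offR w ->
     q y (e w) - w * q x (e w) = al * a w + be * b w].

Section Model.
Context (e : C -> V) (a b : C -> C).
Hypothesis M : boundary_model e a b.
Let hE : hilbert_space E q := bm_hilbert M.
Local Notation bdrel := (bdrel e a b).

Ltac memE := repeat first
  [ assumption | exact: (hilb0 hE)
  | match goal with H : forall n, E (_ n) |- _ => apply: H end
  | match goal with H : bdrel _ _ _ _ |- _ => by case: H end
  | apply: (bm_mem M) | apply: (hilbD hE) | apply: (hilbB hE)
  | apply: (hilbZ hE) | apply: (hilbN hE)].
#[local] Hint Extern 0 (E _) => solve [memE] : core.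

Lemma bdrelL c x y al be x' y' al' be' :
  bdrel x y al be -> bdrel x' y' al' be' ->
  bdrel (c *: x + x') (c *: y + y') (c * al + al') (c * be + be').
Proof.
move=> [Ex Ey r] [Ex' Ey' r']; split=> // w ow; have Ew := bm_mem M ow.
rewrite !(hilbLl hE) //.
have -> : (c * al + al') * a w + (c * be + be') * b w =
  c * (al * a w + be * b w) + (al' * a w + be' * b w) by ring.
by rewrite -r // -r' //; ring.
Qed.

(** This is the Gram formula multiplied by [- 'i]: the kernel at [v] is an eigenvector, with
    eigenvalue [v^*], of the relation formed by all boundary pairs. *)
Lemma bdrel_gen v : offR v ->
  bdrel (e v) (v^* *: e v) (- 'i * (a v)^*) ('i * (b v)^*).
Proof.
move=> ov; have Ev := bm_mem M ov; split => // w ow; have Ew := bm_mem M ow.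
rewrite (hilbZl hE) //; have := bm_gram M ow ov.
move=> /(congr1 ( *%R (- 'i))); rewrite !mulrA mulrNN -expr2 sqrCi.
move: (a v)^* (b v)^* => A B h.
transitivity (-1 * (w - v^*) * q (e v) (e w)); first by ring.
by rewrite h; ring.
Qed.

(** Demanding Green's identity against every boundary pair at once makes these pairs closed under
    linear combinations and limits, so that they can be generated from the kernels. In the end every
    boundary pair turns out to be of this kind. *)
Definition green x' y' (al' be' : C) := bdrel x' y' al' be' /\
  forall x y al be, bdrel x y al be ->
    q y x' - q x y' = - 'i * (al * al'^* - be * be'^*).

Lemma greenL c x y al be x' y' al' be' :
  green x y al be -> green x' y' al' be' ->
  green (c *: x + x') (c *: y + y') (c * al + al') (c * be + be').
Proof.
move=> [r g] [r' g']; split; first exact: bdrelL.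
move=> x0 y0 al0 be0 r0.
rewrite !(hilbDr hE) // !(hilbZr hE) //.
transitivity (c^* * (q y0 x - q x0 y) + (q y0 x' - q x0 y')); first by ring.
rewrite (g _ _ _ _ r0) (g' _ _ _ _ r0) !rmorphD !rmorphM /=; ring.
Qed.

(** Against a kernel, Green's identity is nothing but the defining equation of [bdrel] at the point
    [v]. *)
Lemma green_gen v : offR v ->
  green (e v) (v^* *: e v) (- 'i * (a v)^*) ('i * (b v)^*).
Proof.
move=> ov; have Ev := bm_mem M ov; split; first exact: bdrel_gen.
move=> x y al be rxy; have [Ex Ey /(_ _ ov) r] := rxy.
rewrite (hilbZr hE) // conjCK r !rmorphM !rmorphN /= !conjCK conj_i.
transitivity (- ('i ^+ 2) * (al * a v + be * b v)); last by ring.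
by rewrite sqrCi opprK mul1r.
Qed.

(** Green's identity for the pair against itself reads 2 s |x|^2 + 2 Im [g, x] = |be|^2 - |al|^2
    with s = Im w0. After multiplication by s, the mixed term is absorbed by Cauchy-Schwarz and the
    arithmetic-geometric mean inequality. *)
Lemma green_bound w0 g x al be : upper w0 -> E g ->
  green x (g + w0 *: x) al be ->
  Im w0 ^+ 2 * nrm2 x <= nrm2 g + Im w0 * cmod be ^+ 2.
Proof.
move=> up Eg [r gr]; have Ex : E x by [].
have := gr _ _ _ _ r; set s := Im w0.
have s0 : 0 < s by [].
rewrite (hilbDl hE) // (hilbDr hE) // (hilbZl hE) // (hilbZr hE) //.
rewrite (hilbC hE Eg Ex) -!cmod_sqrE (nrm2E hE Ex).
have := cauchy_schwarz hE Eg Ex.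
move: (q g x) => t tle /(congr1 (@complex.Im R)) h.
have {}h : 2 * s * nrm2 x + 2 * Im t = cmod be ^+ 2 - cmod al ^+ 2.
  move: h; rewrite /s conjE; case: (w0) (t) => w1 w2 [t1 t2] /=.
  set N := nrm2 x; set A := cmod al ^+ 2; set B := cmod be ^+ 2.
  move=> h; lra.
have tt : Im t ^+ 2 <= nrm2 g * nrm2 x.
  apply: le_trans tle; rewrite /cmod sqr_sqrtr ?addr_ge0 ?sqr_ge0 //.
  by rewrite lerDr sqr_ge0.
have Ng := nrm2_ge0 hE Eg; have Nx := nrm2_ge0 hE Ex.
have A0 : 0 <= cmod al ^+ 2 by rewrite exprn_ge0 // cmod_ge0.
have key : - (2 * s * Im t) <= s ^+ 2 * nrm2 x + nrm2 g.
  have P0 : 0 <= s ^+ 2 * nrm2 x + nrm2 g.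
    by rewrite addr_ge0 // mulr_ge0 // exprn_ge0 // ltW.
  rewrite (le_trans (ler_norm _)) // -(@ler_pXn2r _ 2) ?nnegrE //.
  rewrite real_normK ?num_real // sqrrN.
  have : 0 <= (s ^+ 2 * nrm2 x - nrm2 g) ^+ 2 by rewrite sqr_ge0.
  have : s ^+ 2 * Im t ^+ 2 <= s ^+ 2 * (nrm2 g * nrm2 x).
    by rewrite ler_wpM2l // exprn_ge0 // ltW.
  move: (nrm2 g) (nrm2 x) (Im t) => G X T; nra.
have : s * (2 * s * nrm2 x + 2 * Im t) = s * (cmod be ^+ 2 - cmod al ^+ 2).
  by rewrite h.
have : 0 <= s * cmod al ^+ 2 by rewrite mulr_ge0 // ltW.
move: (cmod al ^+ 2) (cmod be ^+ 2) (nrm2 g) (nrm2 x) (Im t) key.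
by move=> A B G X T; nra.
Qed.

(** Evaluation at [w0] itself cancels the multiples of [x]; thus [al] is determined by [g] alone. *)
Lemma bdrel_al w0 g x al : upper w0 -> E g -> bdrel x (g + w0 *: x) al 0 ->
  al = q g (e w0).
Proof.
move=> up Eg r; have ow := upper_offR up; have Ew := bm_mem M ow.
have [Ex _ /(_ _ ow)] := r; rewrite (bm_upper M up) mul0r addr0 mulr1 => <-.
by rewrite (hilbDl hE) // (hilbZl hE) // addrK.
Qed.

Lemma bdrel_lim (u v : nat -> V) (al be : nat -> C) x y al0 be0 :
  (forall n, bdrel (u n) (v n) (al n) (be n)) -> E x -> E y ->
  converges_to q u x -> converges_to q v y ->
  al @ \oo --> al0 -> be @ \oo --> be0 -> bdrel x y al0 be0.
Proof.
move=> r Ex Ey ux vy ala beb; split=> // w ow; have Ew := bm_mem M ow.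
have Eu n : E (u n) by case: (r n).
have Ev n : E (v n) by case: (r n).
have c1 : (fun n => q (v n) (e w) - w * q (u n) (e w)) @ \oo -->
    q y (e w) - w * q x (e w).
  apply: cvgCB; first exact: (converges_to_ql hE).
  apply: cvgCM; first exact: cvgC_cst.
  exact: (converges_to_ql hE).
apply: (cvg_eq c1).
have -> : (fun n => q (v n) (e w) - w * q (u n) (e w)) =
          (fun n => al n * a w + be n * b w).
  by apply/funext => n; have [_ _ ->] := r n.
exact: (cvgCD (cvgCM ala (cvgC_cst (a w))) (cvgCM beb (cvgC_cst (b w)))).
Qed.

Lemma green_lim (u v : nat -> V) (al be : nat -> C) x y al0 be0 :
  (forall n, green (u n) (v n) (al n) (be n)) -> E x -> E y ->
  converges_to q u x -> converges_to q v y ->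
  al @ \oo --> al0 -> be @ \oo --> be0 -> green x y al0 be0.
Proof.
move=> r Ex Ey ux vy ala beb; split.
  have r' n : bdrel (u n) (v n) (al n) (be n) by case: (r n).
  exact: bdrel_lim r' Ex Ey ux vy ala beb.
have Eu n : E (u n) by case: (r n) => -[].
have Ev n : E (v n) by case: (r n) => -[].
move=> x1 y1 al1 be1 r1; have [Ex1 Ey1 _] := r1.
have c1 : (fun n => q y1 (u n) - q x1 (v n)) @ \oo --> q y1 x - q x1 y.
  by apply: cvgCB; exact: (converges_to_qr hE).
apply: (cvg_eq c1).
have -> : (fun n => q y1 (u n) - q x1 (v n)) =
          (fun n => - 'i * (al1 * (al n)^* - be1 * (be n)^*)).
  by apply/funext => n; have [_ h] := r n; exact: h r1.
apply: cvgCM; first exact: cvgC_cst.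
exact: (cvgCB (cvgCM (cvgC_cst al1) (cvg_conj ala))
              (cvgCM (cvgC_cst be1) (cvg_conj beb))).
Qed.

(* The set of all g for which x exists is closed by green_bound; for g = e v
   there is an explicit x in the span of e v and e w0^*. *)
Lemma green_resolvent w0 g : upper w0 -> E g ->
  exists x, green x (g + w0 *: x) (q g (e w0)) 0.
Proof.
move=> up; have ow := upper_offR up; have ocw := conj_offR ow.
have Ew := bm_mem M ow; have Ecw := bm_mem M ocw.
pose F := [set g | E g /\ exists x, green x (g + w0 *: x) (q g (e w0)) 0].
have FI x al g0 : E g0 -> green x (g0 + w0 *: x) al 0 -> F g0.
  move=> Eg0 gr; split=> //; exists x.
  by rewrite -(bdrel_al up Eg0 (proj1 gr)).
suff EF : E `<=` F by move=> /EF[_].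
apply: (closed_total hE).
- by move=> x [].
- split; first rewrite inE.
    apply: (FI 0 0) => //.
    have := greenL (-1) (green_gen ow) (green_gen ow).
    by rewrite !mulN1r !scaleN1r !addNr scaler0 addr0.
  move=> c g1 g2; rewrite !inE => -[Eg1 [x1 gr1]] [Eg2 [x2 gr2]].
  apply: (FI (c *: x1 + x2) (c * q g1 (e w0) + q g2 (e w0))) => //.
  have := greenL c gr1 gr2.
  by rewrite mulr0 addr0 !scalerDr !scalerA (mulrC w0) addrACA.
- move=> u g0 Fu Eg0 ug0.
  have Eu n : E (u n) by have [] := Fu n.
  have /choice[x hx] n : exists x, green x (u n + w0 *: x) (q (u n) (e w0)) 0.
    by have [] := Fu n.
  have Ex n : E (x n) by have [[]] := hx n.
  have s0 : 0 < Im w0 by [].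
  have [x0 Ex0 xx0] : exists2 x0, E x0 & converges_to q x x0.
    apply: (hilb_cauchy hE) => // eps eps0.
    have [|N hN] := converges_to_cauchy hE Eu Eg0 ug0 (_ : 0 < Im w0 ^+ 2 * eps).
      by rewrite mulr_gt0 // exprn_gt0.
    exists N => m n Nm Nn; rewrite -(@ltr_pM2l _ (Im w0 ^+ 2)) ?exprn_gt0 //.
    apply: le_lt_trans (hN _ _ Nm Nn).
    have := greenL (-1) (hx n) (hx m).
    rewrite mulr0 addr0 !scaleN1r -[- x n + _]addrC mulN1r.
    have -> : - (u n + w0 *: x n) + (u m + w0 *: x m) =
              u m - u n + w0 *: (x m - x n).
      by rewrite scalerBr opprD addrACA [RHS]addrACA [in RHS]addrC addrACA
        [- u n + _]addrC [- (w0 *: x n) + _]addrC.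
    move=> /green_bound -/(_ up)/(_ _)/wrap[] //.
    by rewrite cmod0 expr0n mulr0 addr0.
  apply: (FI x0 (q g0 (e w0))) => //.
  have cv : converges_to q (fun n => u n + w0 *: x n) (g0 + w0 *: x0).
    have Ewx n : E (w0 *: x n) by [].
    have cx := converges_toZ hE w0 Ex Ex0 xx0.
    exact: (converges_toD hE Eu Ewx Eg0 (hilbZ hE w0 Ex0) ug0 cx).
  have Egx : E (g0 + w0 *: x0) by [].
  have cg := converges_to_ql hE Eu Eg0 Ew ug0.
  exact: (green_lim hx Ex0 Egx xx0 cv cg (cvgC_cst 0)).
(* The kernel at [w0^*] is an eigenvector for [w0], so a multiple of it can be added to [x] without
   changing [g]; [d] is chosen to cancel the coefficient of b. The divisor in [c] vanishes for v =
   [w0^*], which is why totality is stated with one point left out. *)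
- move=> y Ey Fy; apply: (bm_total M Ey (w0 := w0^*)) => v ov vw; apply: Fy.
  have Ev := bm_mem M ov.
  have wv : v^* - w0 != 0.
    by apply: contraNneq vw => /eqP; rewrite subr_eq0 => /eqP <-; rewrite conjCK.
  pose c := (v^* - w0)^-1; pose d := - (c * (b v)^*).
  pose x := c *: e v + d *: e w0^*.
  have := greenL d (green_gen ocw)
    (greenL (-1) (green_gen ov) (green_gen ov)).
  rewrite !mulN1r !scaleN1r !addNr !addr0 => h.
  have {h} := greenL c (green_gen ov) h.
  rewrite -/x (bm_lower M (conj_upper up)) rmorph1 mulr1 conjCK.
  have -> : c * ('i * (b v)^*) + d * 'i = 0 by rewrite /d; ring.
  have -> : c *: (v^* *: e v) + d *: (w0 *: e w0^*) = e v + w0 *: x.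
    rewrite /x scalerDr addrA !scalerA -[X in X + _ + _]scale1r -scalerDl.
    congr (_ *: _ + _ *: _); last exact: mulrC.
    by rewrite -(mulVf wv) -/c; ring.
  exact: FI.
Qed.

(** The relation becomes (w0 - w) [x, e w] = 0, so [x] is orthogonal to all kernels except possibly
    the one at [w0]. *)
Lemma bdrel_eq0 w0 x : bdrel x (w0 *: x) 0 0 -> x = 0.
Proof.
move=> [Ex _ r]; apply: (bm_total M Ex (w0 := w0)) => w ow ww.
have Ew := bm_mem M ow; have := r _ ow; rewrite !mul0r addr0 (hilbZl hE) //.
rewrite -mulrBl => /eqP; rewrite mulf_eq0 subr_eq0 eq_sym (negbTE ww) /=.
by move/eqP.
Qed.

(** A multiple of the kernel at the conjugate of ['i] removes [be]. The remaining pair and the Green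
    pair with the same right-hand side both solve the resolvent equation at ['i]; evaluation there
    gives them the same [al], and [bdrel_eq0] shows that they agree. Adding the kernel back
    preserves [green]. *)
Lemma bdrel_green x y al be : bdrel x y al be -> green x y al be.
Proof.
move=> r; have up := upper_i; have oi := upper_offR up.
have := bdrelL (- (be / 'i)) (bdrel_gen (conj_offR oi)) r.
rewrite (bm_lower M (conj_upper up)) rmorph1 mulr1 conjCK.
have -> : - (be / 'i) * 'i + be = 0 by rewrite mulNr divfK ?neq0Ci // addNr.
set x1 := _ + x; set y1 := _ + y; set al1 := _ + al => r1.
have Eg : E (y1 - 'i *: x1) by [].
have [x2 gr2] := green_resolvent up Eg.
have x12 : x1 = x2.
  have := bdrelL (-1) (proj1 gr2) r1; rewrite !scaleN1r mulr0 addr0.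
  have aux (t u v : V) : - (u - t + v) + u = t - v.
    by rewrite opprD opprB addrAC subrK.
  rewrite aux -scalerBr [- x2 + x1]addrC.
  move=> r2; have := r2; rewrite -[X in bdrel _ X]add0r.
  move/(bdrel_al up (hilb0 hE)); rewrite (hilb0l hE) // => al0.
  by move: r2; rewrite al0 => /bdrel_eq0/eqP; rewrite subr_eq0 => /eqP.
have := bdrel_al up Eg (proj1 gr2).
move: gr2; rewrite -x12 subrK => gr2 _.
have al12 : al1 = q (y1 - 'i *: x1) (e 'i).
  by apply: (bdrel_al up Eg (x := x1)); rewrite subrK; exact: r1.
rewrite -al12 in gr2.
have := greenL (be / 'i) (green_gen (conj_offR oi)) gr2.
rewrite (bm_lower M (conj_upper up)) rmorph1 mulr1 conjCK.
rewrite divfK ?neq0Ci // addr0 /x1 /y1 !scaleNr !addNKr.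
suff -> : be / 'i * (- 'i * (a 'i^*)^*) + al1 = al by [].
by rewrite /al1; ring.
Qed.

Lemma green_identity x y al be x' y' al' be' :
  bdrel x y al be -> bdrel x' y' al' be' ->
  q y x' - q x y' = - 'i * (al * al'^* - be * be'^*).
Proof. by move=> r /bdrel_green[_]; apply. Qed.

Lemma bdrel_bound w0 g x al be : upper w0 -> E g ->
  bdrel x (g + w0 *: x) al be ->
  Im w0 ^+ 2 * nrm2 x <= nrm2 g + Im w0 * cmod be ^+ 2.
Proof. by move=> up Eg /bdrel_green; exact: green_bound. Qed.

(** In B(h) the solution is x = (g - al - be h) / (z - w0), and the hypothesis says that the
    numerator vanishes at [w0]. A multiple of the kernel at [w0^*] contributes the coefficient
    [be]. *)
Lemma resolvent_upper w0 g al be : upper w0 -> E g ->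
  q g (e w0) = al * a w0 + be * b w0 -> exists x, bdrel x (g + w0 *: x) al be.
Proof.
move=> up Eg hab; have ow := upper_offR up; have ocw := conj_offR ow.
have Ew := bm_mem M ow; have Ecw := bm_mem M ocw.
have [x [r _]] := green_resolvent up Eg.
exists ((be / 'i) *: e w0^* + x).
have := bdrelL (be / 'i) (bdrel_gen ocw) r.
rewrite (bm_lower M (conj_upper up)) rmorph1 mulr1 conjCK divfK ?neq0Ci // addr0.
have -> : be / 'i * (- 'i * (a w0^*)^*) + q g (e w0) = al.
  (* At the pair [w0], [w0^*] the left side of the Gram formula is zero, so that the conjugate of
     the value of a at [w0^*] is b w0. *)
  have := bm_gram M ow ocw; rewrite conjCK subrr mulr0 mul0r.
  rewrite (bm_lower M (conj_upper up)) (bm_upper M up) mul1r rmorph1 mulr1.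
  move=> /eqP; rewrite eq_sym subr_eq0 => /eqP ->.
  rewrite hab (bm_upper M up) mulr1 mulrA mulrN divfK ?neq0Ci //; ring.
by rewrite scalerDr !scalerA (mulrC w0) addrCA.
Qed.

End Model.

(* This symmetry exchanges the two half-planes. *)
Lemma boundary_model_opp e a b : boundary_model e a b ->
  boundary_model (e \o -%R) (b \o -%R) (a \o -%R).
Proof.
move=> M; split => /=.
- exact: bm_hilbert M.
- by move=> w /opp_offR/(bm_mem M).
- move=> v w /opp_offR ov /opp_offR ow; have := bm_gram M ov ow.
  rewrite rmorphN /= => h; rewrite -[RHS]opprB -h; ring.
- move=> w0 x Ex h; apply: (bm_total M Ex (w0 := - w0)) => w ow ww.
  rewrite -[w]opprK; apply: h; first exact: opp_offR.
  by apply: contraNneq ww => <-; rewrite opprK.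
- move=> w uw; apply: (bm_lower M); move: uw.
  by rewrite /upper /lower /=; case: w => x y /=; rewrite oppr_lt0.
- move=> w uw; apply: (bm_upper M); move: uw.
  by rewrite /upper /lower /=; case: w => x y /=; rewrite oppr_gt0.
Qed.

Lemma bdrel_resolvent e a b w0 g al be : boundary_model e a b -> offR w0 ->
  E g -> q g (e w0) = al * a w0 + be * b w0 ->
  exists x, bdrel e a b x (g + w0 *: x) al be.
Proof.
move=> M /offRP[up|lo] Eg h; first exact: (resolvent_upper M).
have up : upper (- w0).
  by move: lo; rewrite /upper /lower /=; case: (w0) => x y /=; rewrite oppr_gt0.
(* In the reflected model multiplication by z becomes multiplication by -z, so the two coefficients
   trade places and the solution changes sign. *)
have [|x [Ex Ey r]] := resolvent_upper (boundary_model_opp M) up Eg (al := be) (be := al).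
  by rewrite /= opprK h addrC.
have hE := bm_hilbert M.
exists (- x); split; first exact: (hilbN hE).
  by move: Ey; rewrite scalerN scaleNr.
move=> w ow; have := r _ (opp_offR ow); rewrite /= opprK scalerN scaleNr.
rewrite (hilbNl hE Ex (bm_mem M ow)) => h1.
by rewrite [RHS]addrC -h1; ring.
Qed.

End BoundaryModels.

(** * Symmetric restrictions and their coupling *)

Section Relations.
Context (R : realType) (V : lmodType R[i]).
Local Notation C := R[i].
Local Notation Im := complex.Im.

(** Symmetry gives (Im w)^2 |x|^2 <= |g|^2 for [g] in the range of A - w; since an adjoint is
    closed, so is this range. A vector orthogonal to the range lies in the kernel of A minus the
    conjugate of w, and this kernel is zero by symmetry. *)
Lemma selfadjoint_range (H : set V) (q : V -> V -> C) (A : set (V * V)) (w : C) :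
  hilbert_space H q -> self_adjoint H q A -> offR w ->
  forall g, H g -> exists x, A (x, g + w *: x).
Proof.
move=> hH [[AH [A0 AL]] Aadj] ow.
have Asym x y x' y' : A (x, y) -> A (x', y') -> q x y' = q y x'.
  by rewrite {1}Aadj => -[_ [_ h]] /h.
have AHx x y : A (x, y) -> H x by move=> /AH[].
pose F := [set g | H g /\ exists x, A (x, g + w *: x)].
suff HF : H `<=` F by move=> g /HF[].
have wI : Im w != 0 by [].
have bound g x : H g -> A (x, g + w *: x) ->
    Im w ^+ 2 * nrm2 q x <= nrm2 q g.
  move=> Hg Ax; have Hx := AHx _ _ Ax; have Nx := nrm2_ge0 hH Hx.
  have := Asym _ _ _ _ Ax Ax.
  rewrite (hilbDr hH) ?(hilbDl hH) ?(hilbZr hH) ?(hilbZl hH) //; try exact: (hilbZ hH).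
  rewrite (hilbC hH Hg Hx) (nrm2E hH Hx).
  have := cauchy_schwarz hH Hg Hx.
  move: (q g x) => t tle /(congr1 (@complex.Im R)) h.
  have {h}t2 : Im w * nrm2 q x = - Im t.
    move: h; rewrite !conjE; case: (w) (t) => w1 w2 [t1 t2] /=.
    by set N := nrm2 q x => h; lra.
  have tt : Im t ^+ 2 <= nrm2 q g * nrm2 q x.
    apply: le_trans tle; rewrite /cmod sqr_sqrtr ?addr_ge0 ?sqr_ge0 //.
    by rewrite lerDr sqr_ge0.
  have [->|Nx0] := eqVneq (nrm2 q x) 0; first by rewrite mulr0; exact: (nrm2_ge0 hH Hg).
  rewrite -(@ler_pM2r _ (nrm2 q x)) ?lt_def ?Nx0 //.
  by rewrite -mulrA -expr2 -exprMn t2 sqrrN.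
apply: (closed_total hH (F := F)).
- by move=> g [].
- split; first by rewrite inE; split;
    [exact: hilb0 hH|exists 0; rewrite scaler0 addr0; move: A0; rewrite inE].
  move=> c g1 g2; rewrite !inE => -[Hg1 [x1 A1]] [Hg2 [x2 A2]].
  split; first exact: (hilbL hH).
  exists (c *: x1 + x2); have := AL c (x1, g1 + w *: x1) (x2, g2 + w *: x2).
  rewrite !inE => /(_ A1 A2); suff -> : c *: g1 + g2 + w *: (c *: x1 + x2) =
    c *: (g1 + w *: x1) + (g2 + w *: x2) by [].
  by rewrite !scalerDr !scalerA (mulrC w) addrACA.
- move=> u g Fu Hg ug; have Hu n : H (u n) by have [] := Fu n.
  have /choice[x hx] n : exists x, A (x, u n + w *: x) by have [] := Fu n.
  have Hx n : H (x n) by exact: AHx (hx n).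
  have w0 : 0 < Im w ^+ 2 by rewrite lt_def sqrf_eq0 wI sqr_ge0.
  have [x0 Hx0 xx0] : exists2 x0, H x0 & converges_to q x x0.
    apply: (hilb_cauchy hH) => // eps eps0.
    have eps1 : 0 < Im w ^+ 2 * eps by rewrite mulr_gt0.
    have [N hN] := converges_to_cauchy hH Hu Hg ug eps1.
    exists N => m n Nm Nn; rewrite -(ltr_pM2l w0).
    apply: le_lt_trans (hN _ _ Nm Nn); apply: bound; first exact: (hilbB hH).
    have := AL (-1) (x n, u n + w *: x n) (x m, u m + w *: x m).
    rewrite !inE => /(_ (hx n) (hx m)).
    have -> : (-1 : C) *: (x n, u n + w *: x n) + (x m, u m + w *: x m) =
      (x m - x n, u m + w *: x m - (u n + w *: x n)).
      by rewrite scaleN1r addrC.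
    by rewrite scalerBr addrACA -opprD.
  split=> //; exists x0; rewrite Aadj.
  split=> //=; split; first by apply: (hilbD hH) => //; exact: (hilbZ hH).
  move=> x' y' A'; have Hx' := AHx _ _ A'; have Hy' : H y' by have [] := AH _ A'.
  apply: (cvg_eq (converges_to_ql hH Hx Hx0 Hy' xx0)).
  have -> : (fun n => q (x n) y') = (fun n => q (u n) x' + w * q (x n) x').
    apply/funext => n; rewrite (Asym _ _ _ _ (hx n) A') (hilbDl hH) //.
      by rewrite (hilbZl hH).
    exact: (hilbZ hH).
  rewrite (hilbDl hH Hg (hilbZ hH w Hx0) Hx') (hilbZl hH w Hx0 Hx').
  exact: (cvgCD (converges_to_ql hH Hu Hg Hx' ug)
    (cvgCM (cvgC_cst w) (converges_to_ql hH Hx Hx0 Hx' xx0))).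
- move=> u Hu hF.
  have Au : A (u, w^* *: u).
    rewrite Aadj; split=> //=; split; first exact: (hilbZ hH).
    move=> x y Axy; have Hx := AHx _ _ Axy; have Hy : H y by have [] := AH _ Axy.
    have Fy : F (y - w *: x).
      split; first by apply: (hilbB hH) => //; exact: (hilbZ hH).
      by exists x; rewrite subrK.
    have := hF _ Fy; rewrite (hilbBr hH) //; last exact: (hilbZ hH).
    by rewrite (hilbZr hH) // (hilbZl hH) // => /eqP; rewrite subr_eq0 => /eqP.
  have := Asym _ _ _ _ Au Au; rewrite (hilbZl hH) // (hilbZr hH) // conjCK.
  move/eqP; rewrite -subr_eq0 -mulrBl mulf_eq0 => /orP[|/eqP];
    last exact: hilb_eq0 hH _ Hu.
  rewrite subr_eq0 conjE => /eqP ww; exfalso.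
  move: wI ww; case: (w) => a b /= /eqP b0 [bN]; apply: b0; lra.
Qed.

Lemma has_dim1 (E : set V) v : E v -> v != 0 ->
  (forall x, E x -> exists c, x = c *: v) -> has_dim E 1.
Proof.
move=> Ev v0 h; exists (fun=> v); split=> // x /h[c ->].
exists (\row_(i < 1) c); split; first by rewrite big_ord1 mxE.
move=> c'; rewrite big_ord1 => /eqP; rewrite -subr_eq0 -scalerBl scaler_eq0.
rewrite (negbTE v0) orbF subr_eq0 => /eqP ->.
by apply/rowP => i; rewrite mxE (ord1 i); congr (c' _ _); exact: val_inj.
Qed.

(** * The symmetric restriction in a single boundary model *)

Section Minimal.
Context (E : set V) (q : V -> V -> C) (e : C -> V) (a b : C -> C).
Hypothesis M : boundary_model E q e a b.
Hypothesis nd : forall al be, (forall w, offR w -> al * a w + be * b w = 0) ->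
  al = 0 /\ be = 0.
Let hE : hilbert_space E q := bm_hilbert M.
Local Notation bdrel := (bdrel E q e a b).
Local Notation S := [set p | bdrel p.1 p.2 0 0].

(** If the kernel at [v] were zero, the Gram formula would be a linear relation between a and b with
    coefficients conjugate to a v and - b v. These are not both zero, since a v or b v is 1. *)
Lemma model_vector_neq0 v : offR v -> e v != 0.
Proof.
move=> ov; apply/eqP => ev0.
have [|A B] := nd (al := (a v)^*) (be := - (b v)^*).
  move=> w ow; have Ew := bm_mem M ow; have := bm_gram M ow ov.
  by rewrite ev0 (hilb0l hE) // mulr0 mulNr ![_^* * _]mulrC => <-.
have /eqP := A; have /eqP := B; rewrite oppr_eq0 !conjC_eq0.
case/offRP: ov => [/(bm_upper M)|/(bm_lower M)] ->; rewrite ?oner_eq0 //.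
Qed.

Lemma minimal_linear : linear_relation E S.
Proof.
split; first by move=> [x y] [].
split.
  rewrite inE /=; suff : bdrel 0 0 0 0 by [].
  split; [exact: (hilb0 hE)..|move=> w ow].
  by rewrite (hilb0l hE (bm_mem M ow)) !mul0r mulr0 subr0 addr0.
move=> c [x y] [x' y']; rewrite !inE => r r'.
by have := bdrelL M c r r'; rewrite mulr0 addr0.
Qed.

Lemma minimal_symmetric : symmetric_relation E q S.
Proof.
split; first exact: minimal_linear.
move=> [x y] r; have [Ex Ey _] := r; split=> //; split=> // x' y' r' /=.
apply/esym/eqP; rewrite -subr_eq0 (green_identity M r r').
by rewrite !mul0r subrr mulr0.
Qed.

(** The kernel at v, the conjugate of w, spans the defect space. Removing from [u] its projection
    onto this vector leaves u' orthogonal to it, so u' = y - v x with (x, y) in the symmetric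
    restriction. As u' is also in the defect space, [u', u'] = [u', y] - w [u', x] = 0. *)
Lemma minimal_deficiency w : offR w -> has_dim (ker_sub (adjoint E q S) w) 1.
Proof.
move=> ow; have ov := conj_offR ow; set v := w^* in ov.
have Ev := bm_mem M ov; have ev0 := model_vector_neq0 ov.
have vv : w = v^* by rewrite /v conjCK.
have Kev : ker_sub (adjoint E q S) w (e v).
  split=> //=; split; first exact: (hilbZ hE).
  move=> x y r; apply/esym/eqP.
  have := green_identity M (bdrel_gen M ov) r.
  by rewrite -vv !rmorph0 !mulr0 subrr mulr0 => /eqP; rewrite subr_eq0.
apply: (has_dim1 Kev ev0) => u [/= Eu [_ hu]].
exists (q u (e v) / q (e v) (e v)); set c := _ / _.
have Eu' : E (u - c *: e v) by apply: (hilbB hE) => //; exact: (hilbZ hE).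
have evv : q (e v) (e v) != 0.
  by apply: contra_neq ev0; exact: (hilb_eq0 hE Ev).
have u'v : q (u - c *: e v) (e v) = 0 * a v + 0 * b v.
  rewrite (hilbBl hE) //; last exact: (hilbZ hE).
  by rewrite (hilbZl hE) // /c divfK // subrr !mul0r addr0.
have [x r] := bdrel_resolvent M ov Eu' u'v.
have [Ex Ey _] := r.
apply/eqP; rewrite -subr_eq0; apply/eqP; apply: (hilb_eq0 hE) => //.
have huy := hu _ _ r; have [_ [_ /(_ _ _ r) hevy]] := Kev.
rewrite /= in huy hevy.
set u' := u - _ in Eu' Ey r huy hevy *.
have : q u' (u' + v *: x) = w * q u' x.
  have Ecv := hilbZ hE c Ev.
  rewrite {1}/u' (hilbBl hE Eu Ecv Ey) (hilbZl hE c Ev Ey) huy hevy.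
  rewrite (hilbZl hE w Eu Ex) (hilbZl hE w Ev Ex) /u' (hilbBl hE Eu Ecv Ex).
  by rewrite (hilbZl hE c Ev Ex); ring.
rewrite (hilbDr hE Eu' (hilbZ hE v Ex) Eu') (hilbZr hE v Ex Eu') -vv.
by rewrite -[X in _ = X]add0r => /addIr.
Qed.

(* The range of S2 - w is all of H2 since S2 is self-adjoint, while all vectors
   in the range of S - w are orthogonal to e w. *)
Lemma minimal_simple : simple_relation E q S.
Proof.
move=> H1 H2 S1 S2 hH1 hH2 orth EH [_ [S10 _]] sa2 SS.
have S10' : S1 (0, 0) by rewrite inE in S10.
have H2E x : H2 x -> E x.
  by move=> Hx; rewrite EH; exists 0; [exact: hilb0 hH1|exists x => //; rewrite add0r].
apply/seteqP; split; last by move=> _ ->; exact: hilb0 hH2.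
move=> g Hg /=; have Eg := H2E _ Hg.
apply: (bm_total M Eg (w0 := 0)) => w ow _; have Ew := bm_mem M ow.
have [x S2x] := selfadjoint_range hH2 sa2 ow Hg.
have : S (x, g + w *: x).
  rewrite SS; exists (0, 0) => //; exists (x, g + w *: x) => //.
  by rewrite -[RHS]add0r.
case=> /= Ex _ /(_ _ ow); rewrite !mul0r addr0 (hilbDl hE) //; last exact: (hilbZ hE).
by rewrite (hilbZl hE) // addrK.
Qed.

Lemma minimal_closed : closed_relation E q S.
Proof.
move=> u v x y Suv Ex Ey ux vy.
exact: (bdrel_lim M Suv Ex Ey ux vy (cvgC_cst 0) (cvgC_cst 0)).
Qed.

Lemma minimal_operator : is_operator S.
Proof.
move=> y [/= E0 Ey r]; apply: (bm_total M Ey (w0 := 0)) => w ow _.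
have := r _ ow; rewrite (hilb0l hE (bm_mem M ow)).
by rewrite !mul0r mulr0 subr0 addr0.
Qed.

Lemma minimal_relation_11 : closed_simple_symmetric_11 E q S.
Proof.
split; [exact: minimal_operator|exact: minimal_closed|exact: minimal_simple|
        exact: minimal_symmetric|].
have oi : offR ('i : C) := upper_offR (upper_i R).
by split; apply: minimal_deficiency => //; exact: opp_offR.
Qed.

End Minimal.

(** * The coupling of two boundary models and its resolvent *)

Section Coupling.
Context (K E1 E2 : set V) (q : V -> V -> C).
Context (e1 e2 : C -> V) (a1 b1 a2 b2 : C -> C).
Local Notation qm := (fun x y => - q x y).
Hypothesis M1 : boundary_model E1 q e1 a1 b1.
Hypothesis M2 : boundary_model E2 qm e2 a2 b2.
Hypothesis Ksub : submod_closed (mem K).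
Hypothesis Kherm : hermitian_on K q.
Hypothesis fd : fundamental_decomposition K q E1 E2.
Local Notation bd1 := (bdrel E1 q e1 a1 b1).
Local Notation bd2 := (bdrel E2 qm e2 a2 b2).
Let hE1 : hilbert_space E1 q := bm_hilbert M1.
Let hE2 : hilbert_space E2 qm := bm_hilbert M2.

(** The opposite signs of [al] make it cancel when the two boundary equations are added; the common
    [c] then multiplies h1 + h2, the denominator occurring in L(f). *)
Definition coupling : set (V * V) := [set p | exists x1 x2 y1 y2 al c,
  [/\ p.1 = x1 + x2, p.2 = y1 + y2, bd1 x1 y1 al c & bd2 x2 y2 (- al) c]].

Lemma fd_mem x1 x2 : E1 x1 -> E2 x2 -> K (x1 + x2).
Proof. by rewrite (fd_sum fd) => *; exists x1 => //; exists x2. Qed.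

Lemma fd_dec x : K x -> exists x1 x2, [/\ x = x1 + x2, E1 x1 & E2 x2].
Proof. by rewrite (fd_sum fd) => -[x1 E1x] [x2 E2x] <-; exists x1, x2. Qed.

Lemma fd_uniq x1 x2 y1 y2 : E1 x1 -> E2 x2 -> E1 y1 -> E2 y2 ->
  x1 + x2 = y1 + y2 -> x1 = y1 /\ x2 = y2.
Proof.
move=> ? ? ? ? h.
have h' : x1 - y1 = y2 - x2.
  by apply/eqP; rewrite subr_eq addrAC eq_sym subr_eq h addrC.
have : (E1 `&` E2) (x1 - y1).
  by split; [exact: (hilbB hE1)|rewrite h'; exact: (hilbB hE2)].
rewrite (fd_direct fd) => /= d0; split; apply/eqP.
  by rewrite -subr_eq0 d0.
by rewrite eq_sym -subr_eq0 -h' d0.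
Qed.

Lemma krein_linear c x y : K x -> K y -> K (c *: x + y).
Proof. by move=> Kx Ky; have [_ /(_ c x y)] := Ksub; rewrite !inE; apply. Qed.

Lemma krein0 : K 0. Proof. by have [] := Ksub; rewrite inE. Qed.

Lemma kreinZ c x : K x -> K (c *: x).
Proof. by move=> Kx; rewrite -[_ *: _]addr0; apply: krein_linear => //; exact: krein0. Qed.

Lemma kreinB x y : K x -> K y -> K (x - y).
Proof. by move=> Kx Ky; rewrite addrC -scaleN1r; exact: krein_linear. Qed.

Lemma kreinLl c x y z : K x -> K y -> K z -> q (c *: x + y) z = c * q x z + q y z.
Proof. by case: Kherm => h _; exact: h. Qed.

Lemma kreinC x y : K x -> K y -> q y x = (q x y)^*.
Proof. by case: Kherm => _; apply. Qed.

Lemma kreinBl x y z : K x -> K y -> K z -> q (x - y) z = q x z - q y z.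
Proof. by move=> *; rewrite addrC -scaleN1r kreinLl // mulN1r addrC. Qed.

Lemma krein0l z : K z -> q 0 z = 0.
Proof. by move=> Kz; have := kreinBl Kz Kz Kz; rewrite !subrr. Qed.

Lemma kreinZl c x z : K x -> K z -> q (c *: x) z = c * q x z.
Proof. by move=> Kx Kz; rewrite -[_ *: _]addr0 kreinLl ?krein0l ?addr0 //; exact: krein0. Qed.

Lemma kreinBr x y z : K x -> K y -> K z -> q z (x - y) = q z x - q z y.
Proof.
move=> Kx Ky Kz; rewrite (kreinC (kreinB Kx Ky) Kz) kreinBl // rmorphB /= -!kreinC //.
Qed.

Lemma fd_form x1 x2 y1 y2 : E1 x1 -> E2 x2 -> E1 y1 -> E2 y2 ->
  q (x1 + x2) (y1 + y2) = q x1 y1 + q x2 y2.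
Proof.
move=> X1 X2 Y1 Y2.
have E1K : E1 `<=` K := fd_subp fd; have E2K : E2 `<=` K := fd_subm fd.
have Dl x y z : K x -> K y -> K z -> q (x + y) z = q x z + q y z.
  by move=> *; rewrite -{1}[x]scale1r kreinLl // mul1r.
have Ky : K (y1 + y2) by exact: fd_mem.
have KX1 := E1K _ X1; have KX2 := E2K _ X2.
have KY1 := E1K _ Y1; have KY2 := E2K _ Y2.
rewrite Dl // (kreinC Ky KX1) (kreinC Ky KX2).
rewrite !Dl // !rmorphD /= -!kreinC //.
by rewrite (fd_orth fd X1 Y2) (kreinC KY1 KX2) (fd_orth fd Y1 X2) rmorph0 addr0 add0r.
Qed.

Lemma coupling_linear : linear_relation K coupling.
Proof.
split.
  move=> [x y] [x1 [x2 [y1 [y2 [al [c [/= -> -> [? ? _] [? ? _]]]]]]]].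
  by split; exact: fd_mem.
split.
  rewrite inE; exists 0, 0, 0, 0, 0, 0; rewrite oppr0.
  split; rewrite ?addr0 //.
  - by have [_ []] := minimal_linear M1; rewrite inE.
  - by have [_ []] := minimal_linear M2; rewrite inE.
move=> k [x y] [x' y']; rewrite !inE.
move=> [x1 [x2 [y1 [y2 [al [c [/= -> -> r1 r2]]]]]]].
move=> [x1' [x2' [y1' [y2' [al' [c' [/= -> -> r1' r2']]]]]]].
exists (k *: x1 + x1'), (k *: x2 + x2'), (k *: y1 + y1'), (k *: y2 + y2').
exists (k * al + al'), (k * c + c'); split=> /=.
- by rewrite scalerDr addrACA.
- by rewrite scalerDr addrACA.
- exact: (bdrelL M1).
- by rewrite opprD -mulrN; exact: (bdrelL M2).
Qed.

(** The boundary terms of the two components agree, since changing the sign of both [al] and [al']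
    does not affect them, and the form on [E2] enters with the opposite sign. *)
Lemma coupling_symmetric p p' : coupling p -> coupling p' ->
  q p.1 p'.2 = q p.2 p'.1.
Proof.
move=> [x1 [x2 [y1 [y2 [al [c [-> -> r1 r2]]]]]]].
move=> [x1' [x2' [y1' [y2' [al' [c' [-> -> r1' r2']]]]]]].
have [? ? _] := r1; have [? ? _] := r2; have [? ? _] := r1'; have [? ? _] := r2'.
rewrite !fd_form //; apply/esym/eqP; rewrite -subr_eq0.
have := green_identity M1 r1 r1'; have := green_identity M2 r2 r2'.
rewrite rmorphN mulrNN /= => g2 g1; apply/eqP.
transitivity ((q y1 x1' - q x1 y1') - (- q y2 x2' - - q x2 y2')); first by ring.
by rewrite g1 g2 subrr.
Qed.

(** The solvability conditions in the two components are a 2x2 linear system for [al] and [c],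
    solved by Cramer's rule. *)
Lemma coupling_resolvent w y : offR w -> a1 w * b2 w + a2 w * b1 w != 0 ->
  K y -> exists x1 x2 y1 y2 al,
  let c := (q y1 (e1 w) * a2 w - q y2 (e2 w) * a1 w) / (a1 w * b2 w + a2 w * b1 w) in
  [/\ y = y1 + y2, E1 y1, E2 y2,
      bd1 x1 (y1 + w *: x1) al c & bd2 x2 (y2 + w *: x2) (- al) c].
Proof.
move=> ow D0 /fd_dec[y1 [y2 [-> Y1 Y2]]]; set D := _ + _ in D0 *.
pose al := (q y1 (e1 w) * b2 w + q y2 (e2 w) * b1 w) / D.
set c := (q y1 (e1 w) * a2 w - q y2 (e2 w) * a1 w) / D.
have h1 : q y1 (e1 w) = al * a1 w + c * b1 w.
  by rewrite /al /c /D; field; exact: D0.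
have h2 : - q y2 (e2 w) = - al * a2 w + c * b2 w.
  by rewrite /al /c /D; field; exact: D0.
have [x1 r1] := bdrel_resolvent M1 ow Y1 h1.
have [x2 r2] := bdrel_resolvent M2 ow Y2 h2.
by exists x1, x2, y1, y2, al.
Qed.

Lemma coupling_resolvent_ex w y : offR w -> a1 w * b2 w + a2 w * b1 w != 0 ->
  K y -> exists x, coupling (x, y + w *: x).
Proof.
move=> ow D0 Ky.
have [x1 [x2 [y1 [y2 [al [-> _ _ r1 r2]]]]]] := coupling_resolvent ow D0 Ky.
exists (x1 + x2), x1, x2, (y1 + w *: x1), (y2 + w *: x2), al.
by eexists; split; [..|exact: r1|exact: r2] => //=; rewrite scalerDr addrACA.
Qed.

Lemma coupling_eq0 w x : offR w -> a1 w * b2 w + a2 w * b1 w != 0 ->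
  coupling (x, w *: x) -> x = 0.
Proof.
move=> ow D0 [x1 [x2 [y1 [y2 [al [c [/= -> + r1 r2]]]]]]].
have [X1 Y1 s1] := r1; have [X2 Y2 s2] := r2.
rewrite scalerDr => /fd_uniq[]; [exact: (hilbZ hE1)|exact: (hilbZ hE2)|by []|by []|].
move=> y1E y2E; rewrite -y1E in r1 s1; rewrite -y2E in r2 s2.
have := s1 _ ow; have := s2 _ ow.
rewrite (hilbZl hE1 w X1 (bm_mem M1 ow)) (hilbZl hE2 w X2 (bm_mem M2 ow)) !subrr.
move=> h2 h1.
have al0 : al = 0.
  apply: (mulIf D0); rewrite mul0r.
  transitivity ((al * a1 w + c * b1 w) * b2 w - (- al * a2 w + c * b2 w) * b1 w).
    by ring.
  by rewrite -h1 -h2; ring.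
have c0 : c = 0.
  apply: (mulIf D0); rewrite mul0r.
  transitivity ((al * a1 w + c * b1 w) * a2 w + (- al * a2 w + c * b2 w) * a1 w).
    by ring.
  by rewrite -h1 -h2; ring.
move: r1 r2; rewrite al0 c0 oppr0.
by move=> /(bdrel_eq0 M1) -> /(bdrel_eq0 M2) ->; rewrite addr0.
Qed.

(** By the Gram formula at [w] and its conjugate v, b w is the conjugate of a v in both models. As a
    w = 1 and b v = 1, the two determinants are conjugate to each other. *)
Lemma det_conj w : upper w -> a1 w * b2 w + a2 w * b1 w != 0 ->
  a1 w^* * b2 w^* + a2 w^* * b1 w^* != 0.
Proof.
move=> uw; have ow := upper_offR uw; have lw := conj_upper uw.
have ocw := lower_offR lw.
have := bm_gram M1 ow ocw; have := bm_gram M2 ow ocw.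
rewrite conjCK subrr mulr0 !mul0r (bm_upper M1 uw) (bm_upper M2 uw).
rewrite (bm_lower M1 lw) (bm_lower M2 lw) !rmorph1 !mul1r !mulr1.
move=> /eqP; rewrite eq_sym subr_eq0 => /eqP h2.
move=> /eqP; rewrite eq_sym subr_eq0 => /eqP h1.
by rewrite -h1 -h2 -rmorphD /= conjC_eq0 addrC.
Qed.

(** For a pair (u, v) of the adjoint, surjectivity at [w] gives a pair (x, y) of the coupling with y
    - w x = v - w u. Then u - x is orthogonal to the range at the conjugate of w, which is all of
    [K], and the form on [K] is nondegenerate. *)
Lemma coupling_selfadjoint w : upper w -> a1 w * b2 w + a2 w * b1 w != 0 ->
  self_adjoint K q coupling.
Proof.
move=> uw D0; have ow := upper_offR uw.
split; first exact: coupling_linear.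
have cK p : coupling p -> K p.1 /\ K p.2.
  by case: p => x y /(proj1 coupling_linear) [].
apply/seteqP; split=> [p cp|[u v] /= [Ku [Kv adj]]].
  have [? ?] := cK _ cp; split=> //; split=> // x y cxy.
  exact: (coupling_symmetric cp cxy).
rewrite /= in Ku Kv adj.
have [x cx] := coupling_resolvent_ex ow D0 (kreinB Kv (kreinZ w Ku)).
have [/= Kx Ky] := cK _ cx.
suff ux : u - x = 0.
  have {}ux : u = x by apply/eqP; rewrite -subr_eq0 ux.
  by move: cx; rewrite -ux subrK.
have Kux := kreinB Ku Kx.
have orth y : K y -> q (u - x) y = 0.
  move=> KY.
  have [t ct] := coupling_resolvent_ex (conj_offR ow) (det_conj uw D0) KY.
  have [/= Kt Kt2] := cK _ ct.
  have ut := adj _ _ ct; have xt := coupling_symmetric cx ct; rewrite /= in ut xt.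
  have yE : y = (y + w^* *: t) - w^* *: t by rewrite addrK.
  have KwT := kreinZ w^* Kt.
  rewrite {1}yE kreinBr // kreinBl // ut xt.
  have -> : v - w *: u + w *: x = v - w *: (u - x).
    by rewrite scalerBr opprB addrA addrAC.
  have Kwux := kreinZ w Kux.
  rewrite (@kreinBl v) // kreinZl // (kreinC KwT Kux) kreinZl // rmorphM /= conjCK -(kreinC Kt Kux).
  by ring.
have [u1 [u2 [uE U1 U2]]] := fd_dec Kux.
have E1K := fd_subp fd; have E2K := fd_subm fd.
have h1 := orth _ (E1K _ U1); have h2 := orth _ (E2K _ U2).
have u10 : u1 = 0.
  apply: (hilb_eq0 hE1) => //; move: h1.
  rewrite uE -[X in q _ X]addr0 fd_form //; last exact: hilb0 hE2.
  have K2 := E2K _ U2; by rewrite (kreinC krein0 K2) krein0l // rmorph0 addr0.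
have u20 : - q u2 u2 = 0.
  move: h2; rewrite uE u10 -{1}[X in q _ X]add0r fd_form //; try exact: hilb0 hE1.
  by rewrite krein0l ?add0r => [->|]; [rewrite oppr0|exact: krein0].
by rewrite uE u10 (hilb_eq0 hE2 U2 u20) addr0.
Qed.

Lemma coupling_resolvent_set w : upper w -> a1 w * b2 w + a2 w * b1 w != 0 ->
  resolvent_set K q coupling w.
Proof.
move=> uw D0; have ow := upper_offR uw; split.
  move=> y Ky; have [x cx] := coupling_resolvent_ex ow D0 Ky.
  exists x; split=> // x' cx'; apply/eqP; rewrite -subr_eq0; apply/eqP.
  apply: (coupling_eq0 ow D0); have [_ [_ L]] := coupling_linear.
  have := L (-1) (x', y + w *: x') (x, y + w *: x); rewrite !inE => /(_ cx' cx).
  have -> : (-1 : C) *: (x', y + w *: x') + (x, y + w *: x) =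
    (x - x', y + w *: x - (y + w *: x')) by rewrite scaleN1r addrC.
  by rewrite opprD addrACA subrr add0r -scalerBr.
exists E1, E2; split=> //.
set D := _ + _ in D0; pose s := Im w; have s0 : 0 < s := uw.
pose n1 := nrm2 q (e1 w); pose n2 := nrm2 qm (e2 w); pose d := cmod D ^+ 2.
have d0 : 0 < d by rewrite exprn_gt0 // cmod_gt0.
have ew1 := bm_mem M1 ow; have ew2 := bm_mem M2 ow.
have n10 : 0 <= n1 := nrm2_ge0 hE1 ew1; have n20 : 0 <= n2 := nrm2_ge0 hE2 ew2.
(* [bdrel_bound] in both components gives s^2 |x|^2 <= |y|^2 + 2 s |c|^2 for the norm of the
   decomposition. Adding the boundary equations at [w] eliminates [al] and expresses c D through y;
   Cauchy-Schwarz then yields d |c|^2 <= 2 (n1 + n2) |y|^2. *)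
exists ((1 + 4 * s * (n1 + n2) / d) / s ^+ 2) => xp xm yp ym Xp Xm Yp Ym.
move=> [x1 [x2 [y1 [y2 [al [c [/= xE yE r1 r2]]]]]]].
have [X1 Y1 s1] := r1; have [X2 Y2 s2] := r2.
have [xp1 xm2] := fd_uniq Xp Xm X1 X2 xE; rewrite -xp1 -xm2 in r1 r2 s1 s2.
have [|||||yp1 ym2] := fd_uniq (x1 := yp + w *: xp) (x2 := ym + w *: xm)
  (y1 := y1) (y2 := y2).
- by apply: (hilbD hE1) => //; exact: (hilbZ hE1).
- by apply: (hilbD hE2) => //; exact: (hilbZ hE2).
- by [].
- by [].
- by rewrite -yE scalerDr addrACA.
rewrite -yp1 -ym2 in r1 r2 s1 s2.
have := bdrel_bound M1 uw Yp r1; have := bdrel_bound M2 uw Ym r2.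
have := s1 _ ow; have := s2 _ ow.
rewrite (hilbDl hE1 Yp (hilbZ hE1 w Xp) ew1) (hilbZl hE1 w Xp ew1) addrK.
have := hilbDl hE2 Ym (hilbZ hE2 w Xm) ew2; rewrite /= => ->.
have := hilbZl hE2 w Xm ew2; rewrite /= => ->.
rewrite addrK (bm_upper M1 uw) (bm_upper M2 uw) !mulr1 => h2 h1.
have cD : c * D = q yp (e1 w) + - q ym (e2 w).
  by rewrite h1 h2 /D (bm_upper M1 uw) (bm_upper M2 uw); ring.
have cs1 := cauchy_schwarz hE1 Yp ew1; have cs2 := cauchy_schwarz hE2 Ym ew2.
rewrite /= -/n1 -/n2 in cs1 cs2.
have Nyp := nrm2_ge0 hE1 Yp; have Nym := nrm2_ge0 hE2 Ym.
have cd : cmod c ^+ 2 * d <= 2 * (nrm2 q yp + nrm2 qm ym) * (n1 + n2).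
  rewrite /d -exprMn -cmodM cD.
  apply: (@le_trans _ _ ((cmod (q yp (e1 w)) + cmod (- q ym (e2 w))) ^+ 2)).
    by rewrite ler_pXn2r ?nnegrE ?addr_ge0 ?cmod_ge0 //; exact: cmodD.
  move: (cmod (q yp _)) (cmod (- q ym _)) cs1 cs2 => A B cs1 cs2.
  have : 0 <= (A - B) ^+ 2 by rewrite sqr_ge0.
  have : 0 <= nrm2 q yp * n2 by rewrite mulr_ge0.
  have : 0 <= nrm2 qm ym * n1 by rewrite mulr_ge0.
  by move: (nrm2 q yp) (nrm2 qm ym) cs1 cs2 => Y Z; nra.
rewrite -/s => b2' b1'.
have -> : q xp xp - q xm xm = (nrm2 q xp + nrm2 qm xm)%:C%C.
  by rewrite rmorphD /= -(nrm2E hE1 Xp) -(nrm2E hE2 Xm).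
have -> : q yp yp - q ym ym = (nrm2 q yp + nrm2 qm ym)%:C%C.
  by rewrite rmorphD /= -(nrm2E hE1 Yp) -(nrm2E hE2 Ym).
rewrite -rmorphM /= lecR mulrAC ler_pdivlMr ?exprn_gt0 //.
have : cmod c ^+ 2 <= 2 * (nrm2 q yp + nrm2 qm ym) * (n1 + n2) / d.
  by rewrite ler_pdivlMr.
move=> cc; have : 2 * s * cmod c ^+ 2 <=
    2 * s * (2 * (nrm2 q yp + nrm2 qm ym) * (n1 + n2) / d).
  by rewrite ler_wpM2l // mulr_ge0 // ltW.
move: (nrm2 q yp) (nrm2 qm ym) (nrm2 q xp) (nrm2 qm xm) (cmod c ^+ 2) b1' b2'.
move=> Y1' Y2' X1' X2' c2 b1' b2' cc'.
apply: (@le_trans _ _ (Y1' + Y2' + 2 * s * c2)).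
  by move: b1' b2'; move: (s ^+ 2) => s2'; lra.
apply: (@le_trans _ _ (Y1' + Y2' + 2 * s * (2 * (Y1' + Y2') * (n1 + n2) / d))).
  by rewrite lerD2l.
by rewrite le_eqVlt; apply/orP; left; apply/eqP; ring.
Qed.

Hypothesis nd1 : forall al be, (forall w, offR w -> al * a1 w + be * b1 w = 0) ->
  al = 0 /\ be = 0.
Hypothesis nd2 : forall al be, (forall w, offR w -> al * a2 w + be * b2 w = 0) ->
  al = 0 /\ be = 0.

Lemma coupling_restrict1 :
  coupling `&` (E1 `*` E1) = [set p | bd1 p.1 p.2 0 0].
Proof.
apply/seteqP; split=> [[x y] [] |[x y] /= r].
  move=> [x1 [x2 [y1 [y2 [al [c [/= -> -> r1 r2]]]]]]] [/= Ex Ey].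
  have [X1 Y1 _] := r1; have [X2 Y2 s2] := r2; have F0 := hilb0 hE2.
  have [|_ x20] := fd_uniq X1 X2 Ex F0; first by rewrite addr0.
  have [|_ y20] := fd_uniq Y1 Y2 Ey F0; first by rewrite addr0.
  have [|al0 c0] := nd2 (al := - al) (be := c).
    move=> w ow; rewrite -s2 // x20 y20.
    by have := hilb0l hE2 (bm_mem M2 ow); rewrite /= => ->; rewrite mulr0 subr0.
  move/eqP: al0; rewrite oppr_eq0 => /eqP al0.
  by rewrite x20 y20 !addr0; move: r1; rewrite al0 c0.
have [Ex Ey _] := r; split=> //.
exists x, 0, y, 0, 0, 0; rewrite !addr0 oppr0; split=> //.
by have [_ []] := minimal_linear M2; rewrite inE.
Qed.

Lemma coupling_restrict2 :
  coupling `&` (E2 `*` E2) = [set p | bd2 p.1 p.2 0 0].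
Proof.
apply/seteqP; split=> [[x y] [] |[x y] /= r].
  move=> [x1 [x2 [y1 [y2 [al [c [/= -> -> r1 r2]]]]]]] [/= Ex Ey].
  have [X1 Y1 s1] := r1; have [X2 Y2 _] := r2; have F0 := hilb0 hE1.
  have [|x10 _] := fd_uniq X1 X2 F0 Ex; first by rewrite add0r.
  have [|y10 _] := fd_uniq Y1 Y2 F0 Ey; first by rewrite add0r.
  have [|al0 c0] := nd1 (al := al) (be := c).
    move=> w ow; rewrite -s1 // x10 y10.
    by rewrite (hilb0l hE1 (bm_mem M1 ow)) mulr0 subr0.
  by rewrite x10 y10 !add0r; move: r2; rewrite al0 c0 oppr0.
have [Ex Ey _] := r; split=> //.
exists 0, x, 0, y, 0, 0; rewrite !add0r oppr0; split=> //.
by have [_ []] := minimal_linear M1; rewrite inE.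
Qed.

Lemma coupling_reducible w : upper w -> a1 w * b2 w + a2 w * b1 w != 0 ->
  partially_fundamentally_reducible K q coupling.
Proof.
move=> uw D0; split.
- by split=> //; exists E1, E2.
- exact: coupling_selfadjoint uw D0.
- by exists w; exact: coupling_resolvent_set.
- exists E1, E2; split=> //.
    by rewrite coupling_restrict1; exact: (minimal_relation_11 M1 nd1).
  by rewrite coupling_restrict2; exact: (minimal_relation_11 M2 nd2).
Qed.

End Coupling.
End Relations.

(** * Analytic functions *)

Section PowerSeries.
Context (R : realType).
Local Notation C := R[i].
Implicit Types (a b : nat -> C) (K rho : R) (x y z : C).

Lemma nearCP z (P : C -> Prop) : (\forall x \near z, P x) <->
  exists2 r : R, 0 < r & forall x, cmod (x - z) < r -> P x.
Proof.
split=> [/nbhs_normP[_ /gt0_complexP[r r0 ->] rP]|[r r0 rP]].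
  by exists r => // x xz; apply: rP; rewrite /ball_ /= distrC normC_ltE.
apply/nbhs_normP; exists r%:C%C; first by rewrite /= ltcR.
by move=> x; rewrite /ball_ /= distrC normC_ltE; exact: rP.
Qed.

Lemma dnearCP z (P : C -> Prop) : (\forall x \near z^', P x) <->
  exists2 r : R, 0 < r & forall x, x != z -> cmod (x - z) < r -> P x.
Proof.
rewrite near_withinE; split=> [/nearCP[r r0 rP]|[r r0 rP]].
  by exists r => // x xz; move/rP; apply.
by apply/nearCP; exists r => // x xz xnz; exact: rP.
Qed.

Lemma Re_le_cmod z : `|complex.Re z| <= cmod z.
Proof. by rewrite /cmod -sqrtr_sqr ler_wsqrtr // lerDl sqr_ge0. Qed.

Lemma Im_le_cmod z : `|complex.Im z| <= cmod z.
Proof. by rewrite /cmod -sqrtr_sqr ler_wsqrtr // lerDr sqr_ge0. Qed.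

Lemma cmod_le_ReIm z : cmod z <= `|complex.Re z| + `|complex.Im z|.
Proof.
rewrite -(@ler_pXn2r _ 2) ?nnegrE ?addr_ge0 ?cmod_ge0 //.
rewrite /cmod sqr_sqrtr ?addr_ge0 ?sqr_ge0 // sqrrD !real_normK ?num_real //.
by rewrite lerD2r lerDl mulrn_wge0 // mulr_ge0.
Qed.

Lemma cmod_sum (u : nat -> C) m n :
  cmod (\sum_(m <= k < n) u k) <= \sum_(m <= k < n) cmod (u k).
Proof.
elim/big_ind2: _ => [|z r w s zr ws|k _]; rewrite ?cmod0 //.
exact: le_trans (cmodD _ _) (lerD zr ws).
Qed.

Lemma geom_sum_le (t : R) m n : 0 <= t -> t <= 1 / 2 ->
  \sum_(m <= k < n) t ^+ k <= 2 * t ^+ m.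
Proof.
move=> t0 t2; have [mn|/ltnW nm] := leqP m n; last first.
  by rewrite big_geq // mulr_ge0 // exprn_ge0.
suff : \sum_(m <= k < n) t ^+ k <= 2 * t ^+ m - 2 * t ^+ n.
  by move/le_trans; apply; rewrite gerBl mulr_ge0 // exprn_ge0.
elim: n mn => [|n IH]; first by rewrite leqn0 => /eqP ->; rewrite big_geq // subrr.
rewrite leq_eqVlt => /orP[/eqP ->|]; first by rewrite big_geq // subrr.
rewrite ltnS => mn; rewrite big_nat_recr //=.
have h := IH mn; apply: le_trans (lerD h (lexx _)) _.
have := exprn_ge0 n t0; rewrite exprS; move: (t ^+ n) (t ^+ m) => T S T0.
nra.
Qed.

Definition psum a y : C := lim (series (fun n => a n * y ^+ n) @ \oo).

(** Power series are handled through this Cauchy-type bound and evaluated where rho |y| <= 1/2, so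
    that every geometric tail is at most twice its first term. *)
Definition geo_bounded a K rho := forall k, cmod (a k) <= K * rho ^+ k.

Lemma geo_bounded_ge0 a K rho : geo_bounded a K rho -> 0 <= K.
Proof.
by move=> /(_ 0%N); rewrite expr0 mulr1; apply: le_trans; exact: cmod_ge0.
Qed.

Lemma tail_bound a K rho y m n : geo_bounded a K rho -> 0 <= rho ->
  rho * cmod y <= 1 / 2 -> (m <= n)%N ->
  cmod (series (fun n => a n * y ^+ n) n - series (fun n => a n * y ^+ n) m)
  <= 2 * K * (rho * cmod y) ^+ m.
Proof.
move=> aK rho0 t2 mn; set t := rho * cmod y in t2 *.
have t0 : 0 <= t by rewrite mulr_ge0 // cmod_ge0.
have K0 := geo_bounded_ge0 aK.
rewrite sub_series_geq //; apply: le_trans (cmod_sum _ _ _) _.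
apply: (@le_trans _ _ (\sum_(m <= k < n) K * t ^+ k)).
  apply: ler_sum => k _; rewrite cmodM cmodX /t exprMn mulrA.
  by rewrite ler_wpM2r // exprn_ge0 // cmod_ge0.
by rewrite -mulr_sumr [2 * K]mulrC -mulrA ler_wpM2l // geom_sum_le.
Qed.

Lemma is_cvg_psum a K rho y : geo_bounded a K rho -> 0 <= rho ->
  rho * cmod y <= 1 / 2 ->
  series (fun n => a n * y ^+ n) @ \oo --> psum a y.
Proof.
move=> aK rho0 t2; set t := rho * cmod y in t2.
have t0 : 0 <= t by rewrite mulr_ge0 // cmod_ge0.
have K0 := geo_bounded_ge0 aK.
have t1 : `|t| < 1 by rewrite ger0_norm //; lra.
pose u n := a n * y ^+ n.
have dom (F : C -> R) : (forall z, `|F z| <= cmod z) -> cvgn (series (F \o u)).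
  move=> Fle; apply: normed_cvg.
  have g0 n : 0 <= geometric K t n by rewrite /geometric /= mulr_ge0 // exprn_ge0.
  have ug n : `|F (u n)| <= geometric K t n.
    apply: le_trans (Fle _) _; rewrite /u cmodM cmodX /geometric /= /t exprMn mulrA.
    by rewrite ler_wpM2r // exprn_ge0 // cmod_ge0.
  have cg := @is_cvg_geometric_series R K t t1.
  have u0 n : 0 <= `|F (u n)| by [].
  exact: (series_le_cvg u0 g0 ug cg).
have c1 := dom _ Re_le_cmod; have c2 := dom _ Im_le_cmod.
have Resum n : complex.Re (series u n) = series (@complex.Re R \o u) n.
  rewrite /series /=; elim: n => [|n IH]; first by rewrite !big_geq.
  by rewrite !big_nat_recr //= ReD IH.
have Imsum n : complex.Im (series u n) = series (@complex.Im R \o u) n.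
  rewrite /series /=; elim: n => [|n IH]; first by rewrite !big_geq.
  by rewrite !big_nat_recr //= -IH; case: (\sum_(0 <= i < n) _) (u n) => [? ?] [].
set l1 := lim (series (@complex.Re R \o u) @ \oo) in c1 *.
set l2 := lim (series (@complex.Im R \o u) @ \oo) in c2 *.
have cu : series u @ \oo --> (l1 +i* l2)%C.
  apply/cvgCP => e e0; have e2 : 0 < e / 2 by rewrite divr_gt0.
  move/cvgrPdist_lt : c1 => /(_ _ e2) c1.
  move/cvgrPdist_lt : c2 => /(_ _ e2) c2.
  apply: filterS2 c1 c2 => n h1 h2; apply: le_lt_trans (cmod_le_ReIm _) _.
  rewrite [ltRHS](splitr e) ltrD //.
    by rewrite ReD ReN /= Resum distrC.
  have -> : complex.Im (series u n - (l1 +i* l2)%C) = series (@complex.Im R \o u) n - l2.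
    by rewrite -Imsum; case: (series u n).
  by rewrite distrC.
by rewrite /psum (cvg_lim (@norm_hausdorff _ _) cu).
Qed.

Lemma psum_tail a K rho y m : geo_bounded a K rho -> 0 <= rho ->
  rho * cmod y <= 1 / 2 ->
  cmod (psum a y - series (fun n => a n * y ^+ n) m) <= 2 * K * (rho * cmod y) ^+ m.
Proof.
move=> aK rho0 t2; set s := series _; set B := 2 * K * _.
rewrite leNgt; apply/negP => lt_B.
have e0 : 0 < cmod (psum a y - s m) - B by rewrite subr_gt0.
have /cvgCP/(_ _ e0)[N _ hN] := is_cvg_psum aK rho0 t2.
have := hN (maxn N m) (leq_maxl _ _); rewrite -/s /= => h.
have := tail_bound aK rho0 t2 (leq_maxr N m); rewrite -/s -/B => h'.
have := cmod_distD (s (maxn N m)) (psum a y) (s m).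
rewrite (cmodBC (psum a y) (s (maxn N m))).
by move: h h' lt_B => *; lra.
Qed.

Lemma geo_bounded_vanish a K rho y : geo_bounded a K rho -> 0 <= rho ->
  rho * cmod y <= 1 / 2 -> (fun n => a n * y ^+ n) @ \oo --> (0 : C).
Proof.
move=> aK rho0 t2; set t := rho * cmod y in t2.
have t0 : 0 <= t by rewrite mulr_ge0 // cmod_ge0.
have t1 : `|t| < 1 by rewrite ger0_norm //; lra.
have /cvgrPdist_lt gK := @cvg_geometric R K t t1.
apply/cvgCP => e /gK; apply: filterS => n.
rewrite subr0 sub0r normrN /geometric /= => h; apply: le_lt_trans h.
rewrite ler_normr cmodM cmodX /t exprMn mulrA.
by rewrite ler_wpM2r // exprn_ge0 // cmod_ge0.
Qed.

(** The recursion makes the partial sums of the product on the left telescope. With b_0 = 0 this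
    divides a series by y - d; with b_0 equal to the value at d it produces the difference
    quotient. *)
Lemma psum_div a b K rho L y d : geo_bounded a K rho -> geo_bounded b L rho ->
  0 <= rho -> rho * cmod y <= 1 / 2 ->
  (forall n, d * b n.+1 = b n - a n) ->
  (y - d) * psum (b \o S) y = psum a y - b 0%N.
Proof.
move=> aK bL rho0 t2 rec.
have bS : geo_bounded (b \o S) (L * rho) rho.
  by move=> k /=; rewrite -mulrA -exprS; exact: bL.
have c1 : (fun n => (y - d) * series (fun n => b n.+1 * y ^+ n) n) @ \oo -->
    (y - d) * psum (b \o S) y.
  exact: (cvgCM (cvgC_cst (y - d)) (is_cvg_psum bS rho0 t2)).
have c2 : (fun n => series (fun n => a n * y ^+ n) n - b 0%N + b n * y ^+ n) @ \oo -->
    psum a y - b 0%N + 0.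
  exact: (cvgCD (cvgCB (is_cvg_psum aK rho0 t2) (cvgC_cst (b 0%N)))
    (geo_bounded_vanish bL rho0 t2)).
rewrite addr0 in c2; apply: (cvg_eq c1).
suff -> : (fun n => (y - d) * series (fun n => b n.+1 * y ^+ n) n) = fun n =>
  series (fun n => a n * y ^+ n) n - b 0%N + b n * y ^+ n by exact: c2.
apply/funext => n; rewrite /series /=; elim: n => [|n IH].
  by rewrite !big_geq // mulr0 expr0 mulr1 sub0r addNr.
rewrite !big_nat_recr //= mulrDr IH exprS.
have -> : a n = b n - d * b n.+1 by rewrite rec opprB addrCA subrr addr0.
ring.
Qed.

Definition psum_at f z a K rho := [/\ 0 < rho, geo_bounded a K rho &
  forall x, rho * cmod (x - z) <= 1 / 2 -> f x = psum a (x - z)].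

Lemma geo_bounded_cvg a (r : R) : 0 < r ->
  (fun n => a n * r%:C%C ^+ n) @ \oo --> (0 : C) ->
  exists K, geo_bounded a K r^-1.
Proof.
move=> r0 /cvgCP/(_ _ ltr01)[N _ hN].
exists (1 + \sum_(0 <= k < N) cmod (a k) * r ^+ k) => k.
have rk : 0 < r ^+ k by rewrite exprn_gt0.
rewrite exprVn ler_pdivlMr //.
have S0 n : 0 <= \sum_(0 <= k < n) cmod (a k) * r ^+ k.
  by apply: sumr_ge0 => i _; rewrite mulr_ge0 ?cmod_ge0 // exprn_ge0 // ltW.
have [Nk|kN] := leqP N k.
  have := hN _ Nk; rewrite /= subr0 cmodM cmodX cmod_real gtr0_norm // => h.
  by rewrite (le_trans (ltW h)) // lerDl.
rewrite big_mkord (bigD1 (Ordinal kN)) //= addrCA lerDl addr_ge0 //.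
by apply: sumr_ge0 => i _; rewrite mulr_ge0 ?cmod_ge0 // exprn_ge0 // ltW.
Qed.

(** Convergence at the single point z + r/2 makes the terms there tend to 0, hence |a_k| <= K
    (2/r)^k. Pointwise convergence thereby becomes convergence at a uniform geometric rate. *)
Lemma analytic_psum f z : analytic_at f z -> exists a K rho, psum_at f z a K rho.
Proof.
move=> [a /nearCP[r r0 fa]].
have r2 : 0 < r / 2 by rewrite divr_gt0.
have cv : series (fun n => a n * (r / 2)%:C%C ^+ n) @ \oo --> f (z + (r / 2)%:C%C).
  have := fa (z + (r / 2)%:C%C); rewrite [_ + _ - z]addrAC subrr add0r.
  by rewrite cmod_real gtr0_norm //; apply; lra.
have [K aK] : exists K, geo_bounded a K (r / 2)^-1.
  apply: (geo_bounded_cvg r2).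
  have c1 : (fun n => series (fun n => a n * (r / 2)%:C%C ^+ n) n.+1) @ \oo -->
     f (z + (r / 2)%:C%C) by rewrite (cvg_shiftS (series _)).
  have := cvgCB (FF := eventually_filter) c1 cv; rewrite subrr.
  suff -> : (fun n => series (fun n => a n * (r / 2)%:C%C ^+ n) n.+1 -
    series (fun n => a n * (r / 2)%:C%C ^+ n) n) = fun n => a n * (r / 2)%:C%C ^+ n.
    exact: id.
  by apply/funext => n; rewrite /series /= big_nat_recr //= addrAC subrr add0r.
exists a, K, (r / 2)^-1; split=> //; first by rewrite invr_gt0.
move=> x; rewrite mulrC ler_pdivrMr // => xz.
have t2 : (r / 2)^-1 * cmod (x - z) <= 1 / 2 by rewrite mulrC ler_pdivrMr.
apply: cvg_eq (is_cvg_psum aK _ t2); last by rewrite invr_ge0 ltW.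
by apply: fa; lra.
Qed.

Lemma psum_analytic f z a K rho : psum_at f z a K rho -> analytic_at f z.
Proof.
move=> [rho0 aK fa]; exists a; apply/nearCP; exists ((2 * rho)^-1).
  by rewrite invr_gt0 mulr_gt0.
have rho2 : 0 < 2 * rho by rewrite mulr_gt0.
move=> x; rewrite -(ltr_pM2l rho2) mulfV ?gt_eqF // => h.
have t2 : rho * cmod (x - z) <= 1 / 2 by lra.
by rewrite (fa _ t2); exact: (is_cvg_psum aK (ltW rho0) t2).
Qed.

Lemma analytic_at_near f g z : (\forall x \near z, f x = g x) ->
  analytic_at f z -> analytic_at g z.
Proof.
move=> /nearCP[r r0 fg] [a /nearCP[s s0 fa]]; exists a; apply/nearCP.
exists (Num.min r s); first by rewrite lt_min r0 s0.
by move=> x; rewrite lt_min => /andP[/fg <- /fa].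
Qed.

Lemma analytic_continuous f z : analytic_at f z -> f x @[x --> z] --> f z.
Proof.
move=> /analytic_psum[a [K [rho [rho0 aK fa]]]].
have K0 := geo_bounded_ge0 aK.
have fE x : rho * cmod (x - z) <= 1 / 2 ->
    cmod (f x - a 0%N) <= 2 * K * (rho * cmod (x - z)).
  move=> t2; rewrite (fa _ t2).
  have := psum_tail 1 aK (ltW rho0) t2.
  by rewrite /series /= big_nat1 expr0 mulr1 expr1.
have fz : f z = a 0%N.
  apply/eqP; rewrite -subr_eq0 -cmod_eq0 eq_le cmod_ge0 andbT.
  have := fE z; rewrite subrr cmod0 !mulr0; apply.
  by lra.
apply/(cvgCP (FF := nbhs_filter z)) => e e0; apply/nearCP.
have M0 : 0 < rho * (2 * K + 1) by rewrite mulr_gt0 // ltr_pwDr // mulr_ge0.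
pose r := Num.min (1 / 2 / rho) (e / (rho * (2 * K + 1))).
exists r; first by rewrite lt_min; apply/andP; split; rewrite ?divr_gt0.
move=> x; rewrite lt_min !ltr_pdivlMr // => /andP[h1 h2].
have h : rho * cmod (x - z) <= 1 / 2 by lra.
rewrite fz; apply: le_lt_trans (fE _ h) _; apply: le_lt_trans h2.
have : 0 <= rho * cmod (x - z) by rewrite mulr_ge0 ?cmod_ge0 // ltW.
lra.
Qed.

(** Either all Taylor coefficients vanish, or near [z] the first nonzero one, of index m, dominates
    the tail, which is of order |x - z|^(m+1). *)
Lemma analytic_zeros f z : analytic_at f z ->
  (\forall x \near z, f x = 0) \/ (\forall x \near z^', f x != 0).
Proof.
move=> /analytic_psum[a [K [rho [rho0 aK fa]]]].
have K0 := geo_bounded_ge0 aK.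
have r0 : 0 < (2 * rho)^-1 by rewrite invr_gt0 mulr_gt0.
have rP x : cmod (x - z) < (2 * rho)^-1 -> rho * cmod (x - z) <= 1 / 2.
  rewrite -(@ltr_pM2l _ (2 * rho)) ?mulr_gt0 // mulfV ?gt_eqF ?mulr_gt0 // => h.
  by lra.
have [[m0 am0]|a0] := pselect (exists m, a m != 0); last first.
  left; apply/nearCP; exists (2 * rho)^-1 => // x /rP h.
  have {}a0 k : a k = 0.
    by apply/eqP; apply: contrapT => ak; apply: a0; exists k; apply/negP.
  rewrite (fa _ h); apply: (cvg_eq (is_cvg_psum aK (ltW rho0) h)).
  suff -> : series (fun n => a n * (x - z) ^+ n) = (fun=> 0) by exact: cvgC_cst.
  apply/funext => n; rewrite /series /= big1 // => i _.
  by rewrite a0 mul0r.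
right; have [m am mmin] := @ex_minnP (fun m => a m != 0) (ex_intro _ m0 am0).
have Ka : 0 < 2 * K * rho ^+ m.+1 + 1.
  by rewrite ltr_pwDr // !mulr_ge0 // exprn_ge0 // ltW.
pose r := Num.min (2 * rho)^-1 (cmod (a m) / (2 * K * rho ^+ m.+1 + 1)).
apply/dnearCP; exists r; first by rewrite lt_min r0 divr_gt0 // cmod_gt0.
move=> x xz; rewrite lt_min => /andP[/rP h]; rewrite ltr_pdivlMr // => h2.
apply/eqP => fx0; have y0 : 0 < cmod (x - z) by rewrite cmod_gt0 subr_eq0.
have := psum_tail m.+1 aK (ltW rho0) h; rewrite -(fa _ h) fx0 sub0r cmodN.
rewrite /series /= big_nat_recr //= big_nat big1 ?add0r; last first.
  move=> i /andP[_ im]; have [->|ai] := eqVneq (a i) 0; first by rewrite mul0r.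
  by have := mmin _ ai; rewrite leqNgt im.
have ym : 0 < cmod (x - z) ^+ m by rewrite exprn_gt0.
rewrite cmodM cmodX exprMn [cmod (x - z) ^+ m.+1]exprS !mulrA ler_pM2r //.
rewrite leNgt => /negP; apply; apply: le_lt_trans h2.
by rewrite mulrDr mulr1 mulrC lerDl ltW.
Qed.

Lemma geo_bounded_le a K L rho sigma : K <= L -> 0 <= rho -> rho <= sigma ->
  geo_bounded a K rho -> geo_bounded a L sigma.
Proof.
move=> krein_linear rho0 rs aK k; apply: le_trans (aK k) _.
have K0 := geo_bounded_ge0 aK.
by apply: ler_pM => //; rewrite ?exprn_ge0 // lerXn2r // nnegrE (le_trans rho0).
Qed.

Lemma analytic_div f z c : analytic_at f z -> z != c ->
  analytic_at (fun x => f x / (x - c)) z.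
Proof.
move=> /analytic_psum[a [K [rho [rho0 aK fa]]]] zc.
have K0 := geo_bounded_ge0 aK.
pose d := c - z; have d0 : d != 0 by rewrite subr_eq0 eq_sym.
have cd0 : 0 < cmod d by rewrite cmod_gt0.
pose b := fix b n := if n is n'.+1 then (b n' - a n') / d else 0.
(* The recursion adds two terms bounded by K sigma^n and divides by d, so sigma |d| >= 2 preserves
   the bound. It also keeps [c] out of the disc on which the quotient is expanded. *)
pose sigma := Num.max rho (2 / cmod d).
have rs : rho <= sigma by rewrite le_max lexx.
have ds : 2 <= sigma * cmod d by rewrite -ler_pdivrMr // le_max lexx orbT.
have s0 : 0 < sigma by rewrite (lt_le_trans rho0).
have aS : geo_bounded a K sigma by exact: geo_bounded_le (lexx K) (ltW rho0) rs aK.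
have bS : geo_bounded b K sigma.
  elim=> [|n IH] /=; first by rewrite cmod0 mulr_ge0 // exprn_ge0 // ltW.
  rewrite cmodM cmodV ler_pdivrMr // exprSr -mulrA -mulrA.
  apply: le_trans (cmodB _ _) _; have := aS n.
  have : 0 <= K * sigma ^+ n by rewrite mulr_ge0 // exprn_ge0 // ltW.
  move: (K * sigma ^+ n) (mulrA K (sigma ^+ n) (sigma * cmod d)) IH => T -> IH.
  by move: (sigma * cmod d) ds => D ds T0 h; nra.
apply: (@psum_analytic _ _ (b \o S) (K * sigma) sigma); split => //.
  by move=> k; rewrite -mulrA -exprS; exact: (bS k.+1).
move=> x xz.
have xd : x - z != d.
  apply/eqP => xzd; move: xz; rewrite xzd; lra.
have xz' : rho * cmod (x - z) <= 1 / 2.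
  by apply: le_trans xz; rewrite ler_wpM2r // cmod_ge0.
have := psum_div (y := x - z) (d := d) aS bS (ltW s0) xz.
rewrite subr0 -(fa _ xz') => <-; last by move=> n /=; rewrite mulrC divfK.
have -> : x - c = x - z - d by rewrite /d opprB addrA subrK.
by rewrite mulrC mulKf // subr_eq0.
Qed.

(** This is the sum of a_k d^(k-n) over k >= n, written through the tail of the series at [d]; for d
    = 0 only k = n survives. Shifted by one, these are the Taylor coefficients of the difference
    quotient at [d]. *)
Definition divided_coeff d a n : C := if d == 0 then a n else
  (psum a d - series (fun n => a n * d ^+ n) n) / d ^+ n.

Definition divided_series d a := divided_coeff d a \o S.

Lemma divided_seriesP a K rho d : geo_bounded a K rho -> 0 < rho ->
  rho * cmod d <= 1 / 2 ->
  geo_bounded (divided_series d a) (K * (2 * rho)) rho /\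
  forall y, rho * cmod y <= 1 / 2 ->
    psum a y = psum a d + (y - d) * psum (divided_series d a) y.
Proof.
move=> aK rho0 d2; have K0 := geo_bounded_ge0 aK.
have bK : geo_bounded (divided_coeff d a) (2 * K) rho.
  move=> k; rewrite /divided_coeff; case: eqVneq => [_|d0].
    apply: le_trans (aK k) _; rewrite ler_wpM2r ?exprn_ge0 ?(ltW rho0) //.
    lra.
  have cd : 0 < cmod d by rewrite cmod_gt0.
  rewrite cmodM cmodV cmodX ler_pdivrMr ?exprn_gt0 //.
  by have := psum_tail k aK (ltW rho0) d2; rewrite exprMn mulrA.
split.
  move=> k; have := bK k.+1; rewrite exprS /divided_series /=.
  by move/le_trans; apply; rewrite !mulrA [2 * K]mulrC.
have b0 : divided_coeff d a 0%N = psum a d.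
  rewrite /divided_coeff; case: eqVneq => [->|d0].
    have rc0 : rho * cmod 0 <= 1 / 2 by rewrite cmod0 mulr0 divr_ge0.
    have := psum_div (y := 0) (d := 0) aK aK (ltW rho0) rc0.
    rewrite subr0 mul0r => /(_ _)/esym/eqP; rewrite subr_eq0 => h.
    by apply/eqP; rewrite eq_sym; apply: h => n; rewrite mul0r subrr.
  by rewrite expr0 divr1 /series /= big_geq // subr0.
move=> y y2.
rewrite (@psum_div a (divided_coeff d a) K rho (2 * K) y d) //; last 2 first.
- exact: ltW.
- move=> n; rewrite /divided_coeff; case: eqVneq => [->|d0].
    by rewrite mul0r subrr.
  rewrite /series /= big_nat_recr //= exprS.
  by field; rewrite d0 expf_neq0.
by rewrite b0 addrC subrK.
Qed.

(* Iterating f = f x0 + (x - x0) * f1 gives the Taylor expansion at x0. *)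
Lemma analytic_near f z : analytic_at f z -> \forall x \near z, analytic_at f x.
Proof.
move=> /analytic_psum[a [K [rho [rho0 aK fa]]]].
have K0 := geo_bounded_ge0 aK; have rho4 : 0 < 4 * rho by rewrite mulr_gt0.
(* Each division by x - x0 costs a factor 2 rho, so the n-th remainder is at most 2 K (2 rho |x -
   x0|)^n. The radius 1/(4 rho) makes this tend to 0 and keeps rho |x - z| <= 1/2. *)
apply/nearCP; exists (4 * rho)^-1; first by rewrite invr_gt0.
move=> x0; rewrite -(ltr_pM2l rho4) mulfV ?gt_eqF // => hd.
set d := x0 - z in hd; have d2 : rho * cmod d <= 1 / 2 by lra.
pose A n := iter n (divided_series d) a.
have AK n : geo_bounded (A n) (K * (2 * rho) ^+ n) rho.
  elim: n => [|n IH]; first by rewrite expr0 mulr1.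
  by rewrite exprSr mulrA; have [] := divided_seriesP IH rho0 d2.
have AE n y : rho * cmod y <= 1 / 2 ->
    psum (A n) y = psum (A n) d + (y - d) * psum (A n.+1) y.
  by move=> y2; have [_] := divided_seriesP (AK n) rho0 d2; apply.
pose c n := psum (A n) d; exists c; apply/nearCP.
exists (4 * rho)^-1; first by rewrite invr_gt0.
move=> x; rewrite -(ltr_pM2l rho4) mulfV ?gt_eqF // => hx.
have y2 : rho * cmod (x - z) <= 1 / 2.
  have := cmod_distD x0 x z; rewrite -/d => h.
  have : rho * cmod (x - z) <= rho * (cmod (x - x0) + cmod d) by rewrite ler_pM2l.
  lra.
have fx n : f x = series (fun n => c n * (x - x0) ^+ n) n +
    (x - x0) ^+ n * psum (A n) (x - z).
  elim: n => [|n ->].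
    by rewrite /series /= big_geq // add0r expr0 mul1r fa.
  rewrite (AE n _ y2) -/(c n) /series /= big_nat_recr //=.
  have -> : x - z - d = x - x0 by rewrite /d opprB addrA subrK.
  by rewrite exprS; ring.
have t0 : 0 <= 2 * rho * cmod (x - x0) by rewrite !mulr_ge0 ?cmod_ge0 // ltW.
have t1 : `|2 * rho * cmod (x - x0)| < 1 by rewrite ger0_norm //; lra.
have /cvgrPdist_lt gK := @cvg_geometric R (2 * K) _ t1.
apply/cvgCP => e /gK; apply: filterS => n.
rewrite sub0r normrN /geometric /= => h; apply: le_lt_trans h.
rewrite (fx n) opprD addrA subrr sub0r cmodN cmodM cmodX.
have /= := psum_tail 0%N (AK n) (ltW rho0) y2.
rewrite /series /= big_geq // subr0 expr0 mulr1 => h.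
rewrite ler_normr; apply/orP; left.
apply: le_trans (ler_wpM2l _ h) _; first by rewrite exprn_ge0 // cmod_ge0.
by rewrite !exprMn le_eqVlt; apply/orP; left; apply/eqP; ring.
Qed.

End PowerSeries.

(** * Poles and the identity theorem *)

Section Meromorphic.
Context (R : realType).
Local Notation C := R[i].
Implicit Types (f g : C -> C) (z w : C).

Lemma analytic_divX f z c n : analytic_at f z -> z != c ->
  analytic_at (fun x => f x / (x - c) ^+ n) z.
Proof.
move=> fz zc; elim: n => [|n IH].
  by apply: analytic_at_near fz; apply/nearCP; exists 1 => // x _; rewrite expr0 divr1.
apply: analytic_at_near (analytic_div IH zc).
by apply/nearCP; exists 1 => // x _; rewrite exprSr invfM mulrA.
Qed.

Lemma analyticD f g z : analytic_at f z -> analytic_at g z ->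
  analytic_at (fun x => f x + g x) z.
Proof.
move=> [a /nearCP[r r0 fa]] [b /nearCP[s s0 gb]].
exists (fun n => a n + b n); apply/nearCP.
exists (Num.min r s); first by rewrite lt_min r0 s0.
move=> x; rewrite lt_min => /andP[/fa xa /gb xb].
suff -> : series (fun n => (a n + b n) * (x - z) ^+ n) = fun n =>
    series (fun n => a n * (x - z) ^+ n) n + series (fun n => b n * (x - z) ^+ n) n.
  exact: (cvgCD xa xb).
apply/funext => n; rewrite /series /= -big_split /=.
by apply: eq_bigr => i _; rewrite mulrDl.
Qed.

Lemma analyticN f z : analytic_at f z -> analytic_at (fun x => - f x) z.
Proof.
move=> [a /nearCP[r r0 fa]]; exists (fun n => - a n); apply/nearCP.
exists r; [exact: r0|move=> x /fa xa].
suff -> : series (fun n => - a n * (x - z) ^+ n) = fun n =>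
    0 - series (fun n => a n * (x - z) ^+ n) n.
  by rewrite -[- f x]sub0r; exact: (cvgCB (cvgC_cst 0) xa).
apply/funext => n; rewrite /series /= sub0r -sumrN.
by apply: eq_bigr => i _; rewrite mulNr.
Qed.

Lemma pole_analytic_near f z : pole_at f z -> \forall x \near z^', analytic_at f x.
Proof.
move=> [n [g [n0 /analytic_near/nearCP[r r0 ga] _ /dnearCP[s s0 fg]]]].
apply/dnearCP; exists (Num.min r s); first by rewrite lt_min r0 s0.
move=> x xz; rewrite lt_min => /andP[/ga gx xs].
apply: analytic_at_near (analytic_divX n gx xz); apply/nearCP.
have xz0 : 0 < cmod (x - z) by rewrite cmod_gt0 subr_eq0.
exists (Num.min (cmod (x - z)) (s - cmod (x - z))).
  by rewrite lt_min xz0 subr_gt0.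
move=> y; rewrite lt_min ltrBrDr => /andP[yx ys]; rewrite fg //.
  by apply: contraTneq yx => ->; rewrite cmodBC ltxx.
exact: le_lt_trans (cmod_distD x y z) ys.
Qed.

Lemma meromorphic_analytic_near (U : set C) f z : meromorphic_on U f -> U z ->
  \forall x \near z^', analytic_at f x.
Proof.
move=> fU /fU[/analytic_near/nearCP[r r0 h]|]; last exact: pole_analytic_near.
by apply/dnearCP; exists r => // x _; exact: h.
Qed.

Lemma pole_unbounded f z (M : R) : pole_at f z -> \forall x \near z^', M < cmod (f x).
Proof.
move=> [n [g [n0 /analytic_continuous gz gz0 /dnearCP[s s0 fg]]]].
have gz2 : 0 < cmod (g z) / 2 by rewrite divr_gt0 // cmod_gt0.
move/(cvgCP (FF := nbhs_filter z)) : gz => /(_ _ gz2)/nearCP[r r0 gr].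
pose M1 := `|M| + 1; have M0 : 0 < M1 by rewrite ltr_wpDl.
(* Within distance 1 of [z] the power |x - z|^n is at most |x - z|, because n > 0; this reduces the
   estimate to a linear one. *)
pose t := Num.min 1 (cmod (g z) / 2 / M1).
have t0 : 0 < t by rewrite lt_min ltr01 divr_gt0.
apply/dnearCP; exists (Num.min t (Num.min r s)); first by rewrite lt_min t0 lt_min r0 s0.
move=> x xz; rewrite lt_min => /andP[xt]; rewrite lt_min => /andP[xr xs].
move: xt; rewrite lt_min => /andP[x1 xM].
have d0 : 0 < cmod (x - z) by rewrite cmod_gt0 subr_eq0.
rewrite fg // cmodM cmodV cmodX ltr_pdivlMr ?exprn_gt0 //.
have gx : cmod (g z) / 2 < cmod (g x).
  have := cmod_distD (g x) (g z) 0; rewrite !subr0 (cmodBC (g z)).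
  have := gr _ xr; lra.
apply: le_lt_trans gx; move: xM; rewrite ltr_pdivlMr // => xM.
apply: (@le_trans _ _ (M1 * cmod (x - z))); last by rewrite mulrC ltW.
apply: (@le_trans _ _ (M1 * cmod (x - z) ^+ n)).
  rewrite ler_wpM2r ?exprn_ge0 ?cmod_ge0 // /M1.
  by rewrite (le_trans (ler_norm _)) // lerDl.
rewrite ler_wpM2l ?(ltW M0) // -[leRHS]expr1.
by rewrite ler_wiXn2l // ?cmod_ge0 // ltW.
Qed.

Lemma upper_segment z w (t : R) : upper z -> upper w -> 0 <= t -> t <= 1 ->
  upper (z + t%:C%C * (w - z)).
Proof.
case: z w => [a b] [c d]; rewrite /upper /= => b0 d0 t0 t1.
rewrite mul0r addr0.
have [b1|d1] := leP b d; nra.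
Qed.

(** Otherwise [f] vanishes near some point z0. On the segment from z0 to any z1, the supremum of the
    parameters near whose points [f] vanishes is again such a parameter, by [analytic_zeros], and
    cannot be less than 1. *)
Lemma analytic_identity f : analytic_on (@upper R) f ->
  ~ (forall z, upper z -> f z = 0) ->
  forall z, upper z -> \forall x \near z^', f x != 0.
Proof.
move=> fa fn0 z0 uz0.
have [f0|//] := analytic_zeros (fa _ uz0); exfalso; apply: fn0 => z1 uz1.
pose g t := z0 + t%:C%C * (z1 - z0).
pose S := [set t : R | 0 <= t <= 1 /\ \forall x \near g t, f x = 0].
have S0 : S 0.
  by split; [rewrite lexx ler01|rewrite /g rmorph0 mul0r addr0].
have Sub : has_sup S by split; [exists 0|exists 1 => t [/andP[]]].
set s := sup S.
have s0 : 0 <= s by apply: sup_ubound => //; exact: (proj2 Sub).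
have s1 : s <= 1 by apply: ge_sup; [exists 0|move=> t [/andP[]]].
have ug : upper (g s) by exact: upper_segment.
have gE t : cmod (g t - g s) = `|t - s| * cmod (z1 - z0).
  rewrite /g opprD addrACA subrr add0r -mulrBl cmodM.
  by rewrite -rmorphB cmod_real.
have D1 : 0 < cmod (z1 - z0) + 1 by rewrite ltr_wpDl // cmod_ge0.
have gs : \forall x \near g s, f x = 0.
  have [//|/dnearCP[r r0 fr]] := analytic_zeros (fa _ ug).
  have rD : 0 < r / (cmod (z1 - z0) + 1) by rewrite divr_gt0.
  have [t [/andP[t0 t1] ft] ts] := sup_adherent rD Sub.
  have ts' : t <= s by apply: sup_ubound; [exact: (proj2 Sub)|split; rewrite ?t0].
  have gt : cmod (g t - g s) < r.
    rewrite gE ler0_norm ?subr_le0 // opprB.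
    apply: (@le_lt_trans _ _ ((s - t) * (cmod (z1 - z0) + 1))).
      by rewrite ler_wpM2l ?subr_ge0 // lerDl.
    by rewrite -ltr_pdivlMr //; move: ts; rewrite -/s; lra.
  have [gts|gts] := eqVneq (g t) (g s); first by rewrite -gts.
  move/nearCP : ft => [r' r'0 /(_ (g t))]; rewrite subrr cmod0 => /(_ r'0) fgt.
  by exfalso; have := fr _ gts gt; rewrite fgt eqxx.
suff s1' : s = 1.
  move/nearCP : gs => [r r0 /(_ z1)]; apply.
  by rewrite /g s1' rmorph1 mul1r (addrCA z0) subrr addr0 subrr cmod0.
apply/eqP; rewrite eq_le s1 /= leNgt; apply/negP => s_lt1.
move/nearCP : gs => [r r0 fr].
pose d := Num.min (1 - s) (r / 2 / (cmod (z1 - z0) + 1)).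
have d0 : 0 < d by rewrite lt_min subr_gt0 s_lt1 !divr_gt0.
have : s + d <= s.
  apply: sup_ubound; first exact: (proj2 Sub).
  split.
    by rewrite addr_ge0 ?(ltW d0) //= -lerBrDl ge_min lexx.
  apply/nearCP; exists (r / 2); first by rewrite divr_gt0.
  move=> x xd; apply: fr; have := cmod_distD (g (s + d)) x (g s).
  have : cmod (g (s + d) - g s) <= r / 2.
    rewrite gE addrAC subrr add0r gtr0_norm //.
    apply: (@le_trans _ _ (d * (cmod (z1 - z0) + 1))).
      by rewrite ler_wpM2l ?(ltW d0) // lerDl.
    by rewrite -ler_pdivlMr // ge_min lexx orbT.
  by lra.
by rewrite gerDl leNgt d0.
Qed.

End Meromorphic.

(** * The boundary model of B(h) *)

Section KernelSpace.
Context (R : realType).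
Local Notation C := R[i].
Context (h : C -> C) (B : set (C -> C)) (ip : (C -> C) -> (C -> C) -> C).
Hypothesis Sh : S0 h.
Hypothesis HB : is_Bspace h B ip.
(** Supplied later by the form on L(f), which sees functions only modulo [mero_eq]. *)
Hypothesis Hnull : forall g, B g -> mero_eq (@offR R) g 0 -> g = 0.
Let hB : hilbert_space B ip := Bspace_hilbert HB.

Lemma offR_open (z : C) : offR z -> \forall x \near z, offR x.
Proof.
move=> oz; apply/nearCP; exists `|complex.Im z|; first by rewrite normr_gt0.
move=> x xz; rewrite /offR /=; apply/eqP => x0.
have := le_lt_trans (Im_le_cmod (x - z)) xz.
have -> : complex.Im (x - z) = - complex.Im z.
  by rewrite -[RHS]add0r -[in RHS]x0; case: (x) (z) => [? ?] [].
by rewrite normrN ltxx.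
Qed.

Definition regular (w : C) := offR w /\ analytic_at h w.

Lemma regular_Uext w : regular w -> Uext h w.
Proof. by move=> rw; left. Qed.

Lemma lower_open (z : C) : lower z -> \forall x \near z, lower x.
Proof.
move=> lz; have z0 : 0 < - complex.Im z by rewrite oppr_gt0.
apply/nearCP; exists (- complex.Im z); first exact: z0.
move=> x xz; have := le_lt_trans (Im_le_cmod (x - z)) xz.
have -> : complex.Im (x - z) = complex.Im x - complex.Im z.
  by case: (x) (z) => [? ?] [].
by rewrite /lower /= ltr_norml ltrBlDr addNr => /andP[].
Qed.

Lemma dnear_seq (z : C) (P : C -> Prop) : (\forall x \near z^', P x) ->
  exists2 u : nat -> C, (forall n, P (u n)) & u @ \oo --> z.
Proof.
move=> /dnearCP[r r0 hr]; pose u n := z + (r / n.+2%:R)%:C%C.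
have ur n : cmod (u n - z) = r / n.+2%:R.
  by rewrite /u addrAC subrr add0r cmod_real gtr0_norm // divr_gt0.
exists u => [n|].
  apply: hr.
    by rewrite -subr_eq0 -cmod_eq0 ur gt_eqF // divr_gt0.
  by rewrite ur ltr_pdivrMr // ltr_pMr // ltr1n.
apply/cvgCP => e e0.
have [N hN] : exists N : nat, r / e < N%:R.
  by exists (Num.truncn (r / e)).+1; exact: truncnS_gt.
exists N => // n /= Nn; rewrite ur ltr_pdivrMr // mulrC -ltr_pdivrMr //.
apply: lt_le_trans hN _; rewrite ler_nat.
by apply: leq_trans Nn _; rewrite -addn2 leq_addr.
Qed.

Lemma analytic_seq (f : C -> C) z (u : nat -> C) : analytic_at f z ->
  u @ \oo --> z -> (fun n => f (u n)) @ \oo --> f z.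
Proof.
move=> /analytic_continuous/(cvgCP (FF := nbhs_filter z)) fz /cvgCP uz.
apply/cvgCP => e /fz/nearCP[r r0 hr].
by apply: filterS (uz _ r0) => n; exact: hr.
Qed.

Lemma regular_upper w : upper w -> regular w.
Proof.
by move=> uw; split; [exact: upper_offR|have [h1 _] := S0_Hinfty Sh; exact: h1].
Qed.

Lemma regular_near z : offR z -> \forall x \near z^', regular x.
Proof.
move=> oz; have [[hm _ _] _ _ _ _] := Sh.
have /dnearCP[r r0 hr] := meromorphic_analytic_near hm oz.
have /nearCP[s s0 hs] := offR_open oz.
apply/dnearCP; exists (Num.min r s); first by rewrite lt_min r0 s0.
by move=> x xz; rewrite lt_min => /andP[xr /hs xs]; split=> //; exact: hr.
Qed.

Lemma within_offR z : offR z -> within (@offR R) z^' = z^'.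
Proof.
move=> /offR_open/nearCP[s s0 hs]; apply/seteqP; split=> P.
  move=> /dnearCP[r r0 hr]; apply/dnearCP.
  exists (Num.min r s); first by rewrite lt_min r0 s0.
  by move=> x xz; rewrite lt_min => /andP[xr xs]; apply: hr => //; exact: hs.
by move=> /dnearCP[r r0 hr]; apply/dnearCP; exists r => // x xz xr _; exact: hr.
Qed.

Lemma ext_regular z : regular z -> ext h z = h z.
Proof.
move=> [oz hz]; rewrite /ext within_offR //.
suff hl : h x @[x --> z^'] --> h z by exact: (cvg_lim (@norm_hausdorff C C) hl).
apply/(cvgCP (FF := dnbhs_filter z)) => e e0.
move/(cvgCP (FF := nbhs_filter z)): (analytic_continuous hz) => /(_ e e0).
by move=> /nearCP[r r0 hr]; apply/dnearCP; exists r => // x _; exact: hr.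
Qed.

Lemma s_fun_regular z w : regular z -> regular w -> z != w^* ->
  s_fun h w z = (1 - h z * (h w)^*) / (- 'i * (z - w^*)).
Proof.
move=> rz rw zw; rewrite /s_fun patchT; last by rewrite inE; exact: regular_Uext.
by rewrite /s_kernel (negbTE zw) /s_quot !ext_regular.
Qed.

(** The kernel is nonnegative on the diagonal, where it equals (1 - |h w|^2) / (2 Im w), and here Im
    w < 0. The bound excludes the value 0 that inversion of 0 would produce in [S0_lower]. *)
Lemma regular_lower_ge1 w : lower w -> regular w -> 1 <= cmod (h w).
Proof.
move=> lw rw; have Uw := regular_Uext rw.
have ww : w != w^*.
  by apply/eqP => ww; have := conj_lower lw; move: lw;
    rewrite -ww /upper /lower /= => /lt_trans h1 /h1; rewrite ltxx.
have := hilb_ge0 hB (Bspace_kernel HB Uw).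
rewrite (Bspace_repro HB (Bspace_kernel HB Uw) Uw) s_fun_regular //.
rewrite -cmod_sqrE.
have -> : - 'i * (w - w^*) = (2 * complex.Im w)%:C%C.
  rewrite conjE; case: (w) => a b; apply/eqP; rewrite eq_complex /=.
  by apply/andP; split; apply/eqP; ring.
rewrite -(rmorph1 (real_complex R)) -rmorphB -fmorphV -rmorphM /= ler0c.
have iw : (2 * complex.Im w)^-1 < 0 by rewrite invr_lt0 pmulr_rlt0.
rewrite (nmulr_lge0 _ iw) subr_le0 => h1; rewrite leNgt; apply/negP => h2.
by move: h1; rewrite leNgt expr_lt1 ?cmod_ge0 // h2.
Qed.

(** [S0_lower] speaks only of punctured neighbourhoods; the identity passes to [w] by continuity of
    [h] at [w] and at its conjugate. *)
Lemma regular_lower_conj w : lower w -> regular w -> h w * (h w^*)^* = 1.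
Proof.
move=> lw rw; have [ow hw] := rw.
have uw := conj_lower lw; have [_ hw'] := regular_upper uw.
have [u Pu uw'] : exists2 u : nat -> C,
    (forall n, h (u n) * (h (u n)^*)^* = 1) & u @ \oo --> w.
  apply: (dnear_seq (P := fun x => h x * (h x^*)^* = 1)).
  have /dnearCP[r r0 hr] := S0_lower Sh lw.
  have /dnearCP[s s0 hs] := regular_near ow.
  have /nearCP[t t0 ht] := lower_open lw.
  apply/dnearCP; exists (Num.min r (Num.min s t)).
    by rewrite !lt_min r0 s0 t0.
  move=> x xw; rewrite !lt_min => /and3P[/(hr _ xw) hx /(hs _ xw) rx /ht lx].
  have := regular_lower_ge1 lx rx; rewrite hx /SR => h1.
  rewrite mulVf //; apply/eqP => h0.
  by move: h1; rewrite h0 invr0 cmod0 ler10.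
have c1 : (fun n => h (u n) * (h (u n)^*)^*) @ \oo --> h w * (h w^*)^*.
  exact: (cvgCM (analytic_seq hw uw')
    (cvg_conj (analytic_seq hw' (cvg_conj uw')))).
apply: (cvg_eq c1).
suff -> : (fun n => h (u n) * (h (u n)^*)^*) = (fun=> 1) by exact: cvgC_cst.
exact/funext.
Qed.

Lemma lower_Nupper (w : C) : lower w -> ~ upper w.
Proof. by rewrite /lower /upper /= => /lt_trans h1 /h1; rewrite ltxx. Qed.

(** The squared norm of the kernel at [z] is (1 - |h z|^2) / (2 Im z) = 0, so this kernel vanishes
    at every [w], that is, h w times the conjugate of h z is 1. This takes the place of the maximum
    principle. *)
Lemma unimodular_constant z : upper z -> cmod (h z) = 1 ->
  forall w, upper w -> h w = h z.
Proof.
move=> uz hz w uw; have rz := regular_upper uz; have rw := regular_upper uw.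
have Nconj (x y : C) : upper x -> upper y -> x != y^*.
  move=> ux uy; apply/eqP => xy; have := conj_upper uy.
  by rewrite -xy => /lower_Nupper.
have hzz : h z * (h z)^* = 1 by rewrite -cmod_sqrE hz expr1n.
have Uz := regular_Uext rz; have Bz := Bspace_kernel HB Uz.
have sz0 : s_fun h z = 0.
  apply: (hilb_eq0 hB Bz); rewrite (Bspace_repro HB Bz Uz).
  by rewrite s_fun_regular ?Nconj // hzz subrr mul0r.
have : s_fun h z w = 0 by rewrite sz0.
rewrite s_fun_regular ?Nconj // => /eqP; rewrite mulf_eq0 invr_eq0.
rewrite mulf_eq0 oppr_eq0 (negbTE (neq0Ci _)) /= [w - _ == _]subr_eq0.
rewrite (negbTE (Nconj _ _ uw uz)) orbF subr_eq0 => /eqP hw.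
transitivity (h w * (h z)^* * h z); last by rewrite -hw mul1r.
by rewrite -mulrA [_^* * _]mulrC hzz mulr1.
Qed.

(** With [num], these are homogeneous coordinates of [h]. On the lower half-plane h = 1 / SR h, so
    the pair is (SR h : 1) there, which stays finite at the poles of [h]. *)
Definition den w : C := if `[< upper w >] then 1 else (h w^*)^*.
Definition num w : C := if `[< upper w >] then h w else 1.

Lemma den_upper w : upper w -> den w = 1.
Proof. by rewrite /den => /asboolT ->. Qed.

Lemma num_upper w : upper w -> num w = h w.
Proof. by rewrite /num => /asboolT ->. Qed.

Lemma den_lower w : lower w -> den w = (h w^*)^*.
Proof. by rewrite /den => /lower_Nupper/asboolF ->. Qed.

Lemma num_lower w : lower w -> num w = 1.
Proof. by rewrite /num => /lower_Nupper/asboolF ->. Qed.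

Lemma num_regular w : regular w -> num w = den w * h w.
Proof.
move=> rw; have [/offRP[uw|lw] _] := rw.
  by rewrite num_upper // den_upper // mul1r.
by rewrite num_lower // den_lower // mulrC regular_lower_conj.
Qed.

Lemma den_regular_neq0 w : regular w -> den w != 0.
Proof.
move=> rw; have [/offRP[uw|lw] _] := rw; first by rewrite den_upper ?oner_neq0.
rewrite den_lower //; apply: contra_eq_neq (regular_lower_conj lw rw) => ->.
by rewrite mulr0 eq_sym oner_neq0.
Qed.

(** The factor compensates the growth of the kernel as [w] approaches a pole. *)
Definition reg_vector w : C -> C := (den w)^* *: s_fun h w.

Lemma reg_vector_mem w : regular w -> B (reg_vector w).
Proof.
by move=> rw; apply: (hilbZ hB); apply: (Bspace_kernel HB); exact: regular_Uext.
Qed.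

Lemma reg_vectorE g w : B g -> regular w -> ip g (reg_vector w) = den w * g w.
Proof.
move=> Bg rw; have Uw := regular_Uext rw.
rewrite /reg_vector (hilbZr hB) //; last exact: (Bspace_kernel HB).
by rewrite conjCK (Bspace_repro HB).
Qed.

Lemma reg_gram v w : regular v -> regular w ->
  - 'i * (v - w^*) * ip (reg_vector w) (reg_vector v) =
  den v * (den w)^* - num v * (num w)^*.
Proof.
move=> rv rw; rewrite reg_vectorE //; last exact: reg_vector_mem.
rewrite !num_regular //.
(* Here the kernel is defined as a limit, but the factor v - w^* annihilates it; on the right the
   two products cancel by the choice of coordinates. *)
have [vw|vw] := eqVneq v w^*.
  rewrite {1}vw subrr mulr0 mul0r.
  have [/offRP[uw|lw] _] := rw.
    have lv : lower v by rewrite vw; exact: conj_upper.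
    rewrite -!num_regular // (num_lower lv) (num_upper uw) (den_lower lv).
    by rewrite (den_upper uw) vw conjCK rmorph1 mulr1 mul1r subrr.
  have uv : upper v by rewrite vw; exact: conj_lower.
  rewrite -!num_regular // (num_lower lw) (num_upper uv) (den_lower lw).
  by rewrite (den_upper uv) vw conjCK rmorph1 mulr1 mul1r subrr.
have -> : reg_vector w v = (den w)^* * s_fun h w v by [].
rewrite s_fun_regular // rmorphM /=.
have vw0 : v - w^* != 0 by rewrite subr_eq0.
have iv0 : - 'i * (v - w^*) != 0 by rewrite mulf_neq0 ?oppr_eq0 ?neq0Ci.
move: (- 'i * (v - w^*)) iv0 => D D0.
by field.
Qed.

(* At a pole of h the vector is a limit of vectors at regular points. *)
Lemma model_vector_exists w : offR w -> exists e, [/\ B e,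
  (regular w -> e = reg_vector w) &
  exists u : nat -> C, [/\ forall n, regular (u n), u @ \oo --> w,
    (fun n => den (u n)) @ \oo --> den w, (fun n => num (u n)) @ \oo --> num w &
    forall g, B g -> (fun n => ip g (reg_vector (u n))) @ \oo --> ip g e]].
Proof.
move=> ow; have [rw|nrw] := pselect (regular w).
  exists (reg_vector w); split; [exact: reg_vector_mem|by []|].
  by exists (fun=> w); split; [by []|exact: cvgC_cst..|move=> g _; exact: cvgC_cst].
have lw : lower w by case/offRP: (ow) => // /regular_upper.
have uw := conj_lower lw; have [_ hw'] := regular_upper uw.
have [u Pu cu] : exists2 u : nat -> C, (forall n, regular (u n) /\ lower (u n)) &
    u @ \oo --> w.
  apply: (dnear_seq (P := fun x => regular x /\ lower x)).
  have /dnearCP[s s0 hs] := regular_near ow.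
  have /nearCP[t t0 ht] := lower_open lw.
  apply/dnearCP; exists (Num.min s t); first by rewrite !lt_min s0 t0.
  by move=> x xw; rewrite lt_min => /andP[/(hs _ xw) rx /ht lx].
have ru n : regular (u n) by have [] := Pu n.
have lu n : lower (u n) by have [] := Pu n.
have cden : (fun n => den (u n)) @ \oo --> den w.
  suff -> : (fun n => den (u n)) = (fun n => (h (u n)^*)^*).
    rewrite (den_lower lw); exact: (cvg_conj (analytic_seq hw' (cvg_conj cu))).
  by apply/funext => n; rewrite den_lower.
have cnum : (fun n => num (u n)) @ \oo --> num w.
  suff -> : (fun n => num (u n)) = (fun=> num w) by exact: cvgC_cst.
  by apply/funext => n; rewrite !num_lower.
have Bu n : B (reg_vector (u n)) by exact: reg_vector_mem.
suff [e Be ce] : exists2 e, B e & converges_to ip (fun n => reg_vector (u n)) e.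
  exists e; split; [exact: Be|by []|exists u].
  split; [exact: ru|exact: cu|exact: cden|exact: cnum|move=> g Bg].
  exact: (converges_to_qr hB Bu Be Bg ce).
have cfst : (fun p : nat * nat => u p.1) @ (\oo, \oo) --> w by exact: cvg_comp cvg_fst cu.
have csnd : (fun p : nat * nat => u p.2) @ (\oo, \oo) --> w by exact: cvg_comp cvg_snd cu.
have cdfst : (fun p : nat * nat => den (u p.1)) @ (\oo, \oo) --> den w.
  exact: cvg_comp cvg_fst cden.
have cdsnd : (fun p : nat * nat => den (u p.2)) @ (\oo, \oo) --> den w.
  exact: cvg_comp cvg_snd cden.
have ne (x y : C) : lower x -> lower y -> - 'i * (x - y^*) != 0.
  move=> lx ly; rewrite mulf_neq0 ?oppr_eq0 ?neq0Ci // subr_eq0.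
  apply/eqP => xy; have := conj_lower ly; rewrite -xy; exact: lower_Nupper.
(* At lower points [num] is 1, so the Gram entries are continuous functions of the points and of
   [den], and they converge even if [w] is a pole. *)
apply: (hilb_gram_cvg hB Bu (G := (den w * (den w)^* - 1) / (- 'i * (w - w^*)))).
suff -> : (fun p : nat * nat => ip (reg_vector (u p.1)) (reg_vector (u p.2))) =
    fun p => (den (u p.2) * (den (u p.1))^* - 1) * (- 'i * (u p.2 - (u p.1)^*))^-1.
  have n0 := ne _ _ lw lw.
  exact: (cvgCM (cvgCB (cvgCM cdsnd (cvg_conj cdfst)) (cvgC_cst 1))
    (cvgCV n0 (cvgCM (cvgC_cst (- 'i)) (cvgCB csnd (cvg_conj cfst))))).
apply/funext => -[m n] /=; have n0 := ne _ _ (lu n) (lu m).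
apply: (mulfI n0); rewrite reg_gram // !num_lower // rmorph1 mulr1.
by rewrite mulrCA divff // mulr1.
Qed.

Lemma kernel_space_model : exists e,
  boundary_model B ip e den num /\ forall w, regular w -> e w = reg_vector w.
Proof.
have ex w : exists e, offR w -> [/\ B e,
  (regular w -> e = reg_vector w) &
  exists u : nat -> C, [/\ forall n, regular (u n), u @ \oo --> w,
    (fun n => den (u n)) @ \oo --> den w, (fun n => num (u n)) @ \oo --> num w &
    forall g, B g -> (fun n => ip g (reg_vector (u n))) @ \oo --> ip g e]].
  have [/model_vector_exists[e he]|nw] := pselect (offR w); last by exists 0.
  by exists e.
have [e he] := choice ex; exists e.
have eB w : offR w -> B (e w) by move=> /he[].
have eR w : regular w -> e w = reg_vector w.
  by move=> rw; have [ow _] := rw; have [_ h1 _] := he _ ow; exact: h1.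
split; last exact: eR.
(* The Gram formula is passed to the limit in one argument at a time. *)
have gram1 v w : regular v -> offR w ->
    - 'i * (v - w^*) * ip (e w) (reg_vector v) =
    den v * (den w)^* - num v * (num w)^*.
  move=> rv ow; have [Be _ [u [ru cu cd cn cg]]] := he _ ow.
  have Bv := reg_vector_mem rv.
  have c1 : (fun n => - 'i * (v - (u n)^*) * ip (reg_vector (u n)) (reg_vector v))
      @ \oo --> - 'i * (v - w^*) * ip (e w) (reg_vector v).
    rewrite (hilbC hB Bv Be).
    suff -> : (fun n => - 'i * (v - (u n)^*) * ip (reg_vector (u n)) (reg_vector v)) =
        fun n => - 'i * (v - (u n)^*) * (ip (reg_vector v) (reg_vector (u n)))^*.
      exact: (cvgCM (cvgCM (cvgC_cst (- 'i)) (cvgCB (cvgC_cst v) (cvg_conj cu)))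
        (cvg_conj (cg _ Bv))).
    by apply/funext => n; rewrite (hilbC hB Bv (reg_vector_mem (ru n))).
  apply: (cvg_eq c1).
  suff -> : (fun n => - 'i * (v - (u n)^*) * ip (reg_vector (u n)) (reg_vector v)) =
      fun n => den v * (den (u n))^* - num v * (num (u n))^*.
    exact: (cvgCB (cvgCM (cvgC_cst (den v)) (cvg_conj cd))
      (cvgCM (cvgC_cst (num v)) (cvg_conj cn))).
  by apply/funext => n; exact: reg_gram.
split.
- exact: hB.
- exact: eB.
- move=> v w ov ow; have [Be _ [u [ru cu cd cn cg]]] := he _ ov.
  have c1 : (fun n => - 'i * (u n - w^*) * ip (e w) (reg_vector (u n)))
      @ \oo --> - 'i * (v - w^*) * ip (e w) (e v).
    exact: (cvgCM (cvgCM (cvgC_cst (- 'i)) (cvgCB cu (cvgC_cst w^*)))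
        (cg _ (eB _ ow))).
  apply: (cvg_eq c1).
  suff -> : (fun n => - 'i * (u n - w^*) * ip (e w) (reg_vector (u n))) =
      fun n => den (u n) * (den w)^* - num (u n) * (num w)^*.
    exact: (cvgCB (cvgCM cd (cvgC_cst (den w)^*)) (cvgCM cn (cvgC_cst (num w)^*))).
  by apply/funext => n; exact: gram1.
- move=> w0 x Bx hx; apply: Hnull => // z oz.
  have /dnearCP[s s0 hs] := regular_near oz.
  pose t := if z == w0 then 1 else cmod (z - w0).
  have t0 : 0 < t.
    by rewrite /t; case: eqVneq => // zw; rewrite cmod_gt0 subr_eq0.
  apply/dnearCP; exists (Num.min s t); first by rewrite lt_min s0 t0.
  move=> y yz; rewrite lt_min => /andP[/(hs _ yz) ry yt].
  have [oy _] := ry.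
  have yw : y != w0.
    move: yt; rewrite /t; case: (eqVneq z w0) => [<- //|zw].
    by apply: contraTneq => ->; rewrite cmodBC ltxx.
  have := hx _ oy yw; rewrite eR // reg_vectorE // => /eqP.
  by rewrite mulf_eq0 (negbTE (den_regular_neq0 ry)) => /eqP.
- exact: den_upper.
- exact: num_lower.
Qed.

End KernelSpace.

(** * The model space *)

Section Transport.
Context (R : realType) (V W : lmodType R[i]) (E : set V).
Context (q : V -> V -> R[i]) (q' : W -> W -> R[i]) (phi : V -> W).
Hypothesis phiL : forall c x y, E x -> E y -> phi (c *: x + y) = c *: phi x + phi y.
Hypothesis phiq : forall x y, E x -> E y -> q' (phi x) (phi y) = q x y.

Lemma hilbert_transport : hilbert_space E q -> hilbert_space (phi @` E) q'.
Proof.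
move=> hE; have E0 := hilb0 hE.
have phiB x y : E x -> E y -> phi x - phi y = phi (x - y).
  by move=> Ex Ey; rewrite addrC -scaleN1r -phiL // scaleN1r addrC.
have phi0 : phi 0 = 0 by rewrite -[X in phi X](subrr 0) -phiB // subrr.
split.
- split; first by rewrite inE; exists 0.
  move=> c _ _ /[!inE] -[x Ex <-] [y Ey <-].
  by exists (c *: x + y); [exact: hilbL hE _ _ _ Ex Ey|exact: phiL].
- split=> [c _ _ _ [x Ex <-] [y Ey <-] [z Ez <-]|_ _ [x Ex <-] [y Ey <-]].
    by rewrite -phiL // !phiq //; [exact: (hilbLl hE)|exact: (hilbL hE)].
  by rewrite !phiq //; exact: (hilbC hE).
- move=> _ [x Ex <-] x0; rewrite phiq //; apply: (hilbert_pos hE) => //.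
  by apply: contra_neq x0 => ->.
- move=> u Fu cu.
  have /choice[v hv] : forall n, exists x, E x /\ phi x = u n.
    by move=> n; have [x Ex xu] := Fu n; exists x.
  have Ev n : E (v n) by have [] := hv n.
  have vE n : phi (v n) = u n by have [] := hv n.
  have uv n x : E x -> q' (u n - phi x) (u n - phi x) = q (v n - x) (v n - x).
    move=> Ex; have Ed := hilbB hE (Ev n) Ex.
    by rewrite -vE phiB // phiq.
  have [e e0|x Ex vx] := hilbert_complete hE Ev.
    by have [N hN] := cu e e0; exists N => m n Nm Nn; rewrite -uv // vE; exact: hN.
  exists (phi x); first by exists x.
  suff -> : converges_to q' u (phi x) = converges_to q v x by exact: vx.
  rewrite /converges_to; suff -> : (fun n => q' (u n - phi x) (u n - phi x)) =
    (fun n => q (v n - x) (v n - x)) by [].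
  by apply/funext => n; exact: uv.
Qed.

Lemma boundary_model_transport e a b : boundary_model E q e a b ->
  boundary_model (phi @` E) q' (phi \o e) a b.
Proof.
move=> M; have hE := bm_hilbert M; have phiE := hilbert_transport hE.
have phi0 : phi 0 = 0.
  have E0 := hilb0 hE.
  by apply: (hilb_eq0 phiE); [exists 0|rewrite phiq // (hilb0l hE)].
split.
- exact: phiE.
- by move=> w /(bm_mem M) Ew; exists (e w).
- move=> v w ov ow; rewrite /= phiq; [exact: (bm_gram M)|exact: (bm_mem M)..].
- move=> w0 _ [x Ex <-] hx; rewrite (bm_total M Ex (w0 := w0)) // => w ow ww.
  by rewrite -(hx w ow ww) /= phiq //; exact: (bm_mem M).
- exact: bm_upper M.
- exact: bm_lower M.
Qed.

Lemma bdrel_transport e a b x y al be : (forall w, offR w -> E (e w)) -> E x -> E y ->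
  bdrel (phi @` E) q' (phi \o e) a b (phi x) (phi y) al be <->
  bdrel E q e a b x y al be.
Proof.
move=> Ee Ex Ey; split=> -[_ _ r].
  by split=> // w ow; rewrite -r //= !phiq //; exact: Ee.
split; [by exists x|by exists y|move=> w ow].
by rewrite -r //= !phiq //; exact: Ee.
Qed.

End Transport.

(** * Cayley transforms that are Herglotz-Nevanlinna functions *)

Section Herglotz.
Context (R : realType).
Local Notation C := R[i].

(** A pole is excluded because [f] is unbounded near it; otherwise [f] is continuous at [z]. The
    lemma turns equalities known only on punctured neighbourhoods into pointwise ones. *)
Lemma mero_limit (f : C -> C) z l : analytic_at f z \/ pole_at f z ->
  (forall e : R, 0 < e -> \forall x \near z^', cmod (f x - l) < e) ->
  analytic_at f z /\ f z = l.
Proof.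
move=> fz fl; have two (P Q : C -> Prop) : (\forall x \near z^', P x) ->
    (\forall x \near z^', Q x) -> exists x, P x /\ Q x.
  move=> /dnearCP[r r0 hP] /dnearCP[s s0 hQ].
  pose t := Num.min r s / 2.
  have t0 : 0 < Num.min r s by rewrite lt_min r0 s0.
  exists (z + t%:C%C).
  have tz : cmod (z + t%:C%C - z) = t.
    by rewrite addrAC subrr add0r cmod_real gtr0_norm // divr_gt0.
  have tlt : t < Num.min r s by rewrite /t ltr_pdivrMr // ltr_pMr // ltr1n.
  have zz : z + t%:C%C != z by rewrite -subr_eq0 -cmod_eq0 tz gt_eqF // divr_gt0.
  move: tlt; rewrite -{1}tz lt_min => /andP[tr ts].
  by split; [exact: (hP _ zz tr)|exact: (hQ _ zz ts)].
case: fz => [fz|/(pole_unbounded (cmod l + 1)) big]; last first.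
  have [x [h1 h2]] := two _ _ big (fl _ ltr01); exfalso.
  have := cmodD (f x - l) l; rewrite subrK; lra.
split=> //; apply/eqP; rewrite -subr_eq0 -cmod_eq0 eq_le cmod_ge0 andbT.
rewrite leNgt; apply/negP => d0.
have d2 : 0 < cmod (f z - l) / 2 by rewrite divr_gt0.
have [x [h1 h2]] : exists x, cmod (f x - f z) < cmod (f z - l) / 2 /\
    cmod (f x - l) < cmod (f z - l) / 2.
  apply: two; last exact: fl.
  move/(cvgCP (FF := nbhs_filter z)): (analytic_continuous fz) => /(_ _ d2).
  by move=> /nearCP[r r0 hr]; apply/dnearCP; exists r => // x _; exact: hr.
have := cmod_distD (f x) (f z) l; rewrite (cmodBC (f z) (f x)); lra.
Qed.

(** The imaginary part is (|k|^2 - |t|^2) / |k + t|^2. *)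
Lemma cayley_Im_ge0 (k t : C) : cmod t <= cmod k -> k + t != 0 ->
  0 <= complex.Im ('i * (k - t) / (k + t)).
Proof.
move=> tk kt0; set x := (k - t) / (k + t).
have -> : complex.Im ('i * (k - t) / (k + t)) = complex.Re x.
  by rewrite -mulrA -/x; case: (x) => a b /=; rewrite mul0r mul1r add0r.
have D0 : 0 < cmod (k + t) ^+ 2 by rewrite exprn_gt0 // cmod_gt0.
have : (cmod (k + t) ^+ 2)%:C%C * x = (k - t) * (k + t)^*.
  by rewrite cmod_sqrE /x; field.
move=> /(congr1 (@complex.Re R)); rewrite ReZ => hx.
rewrite -(pmulr_rge0 _ D0) hx.
have : cmod t ^+ 2 <= cmod k ^+ 2 by rewrite ler_pXn2r ?nnegrE ?cmod_ge0.
rewrite /cmod !sqr_sqrtr ?addr_ge0 ?sqr_ge0 // conjE.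
by case: (k) (t) => [a b] [c d] /=; nra.
Qed.

(** For constant h2 = k, [f] is a Cayley transform of h1 whose denominator has no zero in the upper
    half-plane. The hypotheses describe [f] only up to isolated points, so [mero_limit] supplies its
    values, on the lower half-plane by reflection. *)
Lemma herglotz_constant (f h1 h2 : C -> C) (k : C) :
  meromorphic_on (@offR R) f -> mero_eq (@lower R) f (SR f) ->
  mero_eq (@upper R) f (fun z => 'i * (h2 z - h1 z) / (h2 z + h1 z)) ->
  analytic_on (@upper R) h1 -> (forall z, upper z -> cmod (h1 z) <= 1) ->
  (forall z, upper z -> h2 z = k) -> cmod k = 1 ->
  (forall z, upper z -> k + h1 z != 0) -> herglotz_nevanlinna f.
Proof.
move=> fm fsym fe h1a h1b h2k k1 kh1.
pose g z := 'i * (k - h1 z) / (k + h1 z).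
have fu z : upper z -> analytic_at f z /\ f z = g z.
  move=> uz; apply: mero_limit => [|e e0]; first exact: (fm _ (upper_offR uz)).
  have hc := analytic_continuous (h1a _ uz).
  have gc : g x @[x --> z] --> g z.
    exact: (cvgCM (FF := nbhs_filter z)
      (cvgCM (FF := nbhs_filter z) (cvgC_cst (FF := nbhs_filter z) 'i)
        (cvgCB (FF := nbhs_filter z) (cvgC_cst (FF := nbhs_filter z) k) hc))
      (cvgCV (FF := nbhs_filter z) (kh1 _ uz)
        (cvgCD (FF := nbhs_filter z) (cvgC_cst (FF := nbhs_filter z) k) hc))).
  move/(cvgCP (FF := nbhs_filter z)): gc => /(_ _ e0)/nearCP[r r0 gr].
  have /dnearCP[s s0 fs] := fe _ uz.
  have /nearCP[t t0 ht] : \forall x \near z, upper x.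
    have lz := conj_upper uz; have /nearCP[t t0 ht] := lower_open lz.
    apply/nearCP; exists t => // x xz; rewrite -[x]conjCK.
    by apply: conj_lower; apply: ht; rewrite -rmorphB cmod_conj.
  apply/dnearCP; exists (Num.min r (Num.min s t)); first by rewrite !lt_min r0 s0 t0.
  move=> x xz; rewrite !lt_min => /and3P[/gr gx /(fs _ xz) -> /ht ux].
  by rewrite h2k.
have fl z : lower z -> analytic_at f z /\ f z = (f z^*)^*.
  move=> lz; have [fz' _] := fu _ (conj_lower lz).
  apply: mero_limit => [|e e0]; first exact: (fm _ (lower_offR lz)).
  move/(cvgCP (FF := nbhs_filter z^*)): (analytic_continuous fz').
  move=> /(_ _ e0)/nearCP[r r0 hr]; have /dnearCP[s s0 fs] := fsym _ lz.
  apply/dnearCP; exists (Num.min r s); first by rewrite lt_min r0 s0.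
  move=> x xz; rewrite lt_min => /andP[xr /(fs _ xz) ->].
  by rewrite /SR -rmorphB cmod_conj; apply: hr; rewrite -rmorphB cmod_conj.
split.
- by move=> z /offRP[/fu[]|/fl[]].
- move=> z /offRP[uz|lz].
    by have [_ ->] := fl _ (conj_upper uz); rewrite conjCK.
  by have [_ ->] := fl _ lz; rewrite conjCK.
- move=> z uz; have [_ ->] := fu _ uz.
  by apply: cayley_Im_ge0; [rewrite k1; exact: h1b|exact: kh1].
Qed.

End Herglotz.

(** * Components of L(f) and identification of the model relation with the coupling *)

Section ModelSpace.
Context (R : realType).
Local Notation C := R[i].
Context (h1 h2 : C -> C) (B1 B2 : set (C -> C)).
Context (ip1 ip2 : (C -> C) -> (C -> C) -> C).
Context (L : set (mero R)) (q : mero R -> mero R -> C).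
Hypothesis Sh1 : S0 h1.
Hypothesis Sh2 : S0 h2.
Hypothesis Hsum : ~ (forall z, upper z -> h2 z + h1 z = 0).
Hypothesis HB1 : is_Bspace h1 B1 ip1.
Hypothesis HB2 : is_Bspace h2 B2 ip2.
Hypothesis LE : L = [set model_fun h1 h2 g1 g2 | g1 in B1 & g2 in B2].
Hypothesis qE : forall g1 g2 g1' g2', B1 g1 -> B2 g2 -> B1 g1' -> B2 g2' ->
  q (model_fun h1 h2 g1 g2) (model_fun h1 h2 g1' g2') = ip1 g1 g1' - ip2 g2 g2'.
Let hB1 : hilbert_space B1 ip1 := Bspace_hilbert HB1.
Let hB2 : hilbert_space B2 ip2 := Bspace_hilbert HB2.
Local Notation model_fun := (model_fun h1 h2).
Local Notation qm := (fun x y => - q x y).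

Lemma model_funL c g1 g2 g1' g2' : model_fun (c *: g1 + g1') (c *: g2 + g2') =
  c *: model_fun g1 g2 + model_fun g1' g2'.
Proof.
rewrite /Defs.model_fun.
have Z (g : C -> C) : c *: mclass g = mclass (c *: g) by rewrite mclassZ.
rewrite Z -mclassD; congr mclass; apply/funext => z.
pose s := sqrtC 2 / (h1 z + h2 z).
suff : s * ((c * g1 z + g1' z) + (c * g2 z + g2' z)) =
  c * (s * (g1 z + g2 z)) + s * (g1' z + g2' z) by [].
by ring.
Qed.

Lemma model_fun0 : model_fun 0 0 = 0.
Proof.
have := model_funL (-1) 0 0 0 0; rewrite !scaler0 !addr0 scaleN1r addNr.
by [].
Qed.

Definition model_plus g : mero R := model_fun g 0.
Definition model_minus g : mero R := model_fun 0 g.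

Lemma model_plusL c x y : B1 x -> B1 y -> model_plus (c *: x + y) = c *: model_plus x + model_plus y.
Proof. by move=> _ _; rewrite /model_plus -model_funL scaler0 addr0. Qed.

Lemma model_minusL c x y : B2 x -> B2 y -> model_minus (c *: x + y) = c *: model_minus x + model_minus y.
Proof. by move=> _ _; rewrite /model_minus -model_funL scaler0 addr0. Qed.

Lemma model_plus_form x y : B1 x -> B1 y -> q (model_plus x) (model_plus y) = ip1 x y.
Proof.
move=> Bx By; have F0 := hilb0 hB2.
by rewrite /model_plus qE // (hilb0l hB2) // subr0.
Qed.

Lemma model_minus_form x y : B2 x -> B2 y -> - q (model_minus x) (model_minus y) = ip2 x y.
Proof.
move=> Bx By; have F0 := hilb0 hB1.
by rewrite /model_minus qE // (hilb0l hB1) // sub0r opprK.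
Qed.

Lemma model_funD g1 g2 : model_fun g1 g2 = model_plus g1 + model_minus g2.
Proof.
rewrite /model_plus /model_minus -[model_fun g1 0]scale1r -model_funL.
by rewrite !scale1r addr0 add0r.
Qed.

(** A null [g] gives the same class under [model_plus] as 0. The form on that class is 0, and by
    [qE] it is also [ip1 g g]. *)
Lemma mero_null_eq0_plus g : B1 g -> mero_eq (@offR R) g 0 -> g = 0.
Proof.
move=> Bg g0; have F0 := hilb0 hB1.
have e : model_plus g = model_plus 0.
  apply/mclassP => z oz; have /dnearCP[r r0 hr] := g0 _ oz.
  by apply/dnearCP; exists r => // x xz xr; rewrite (hr _ xz xr).
apply: (hilb_eq0 hB1 Bg); rewrite -model_plus_form // {1}e model_plus_form //.
exact: (hilb0l hB1).
Qed.

Lemma mero_null_eq0_minus g : B2 g -> mero_eq (@offR R) g 0 -> g = 0.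
Proof.
move=> Bg g0; have F0 := hilb0 hB2.
have e : model_minus g = model_minus 0.
  apply/mclassP => z oz; have /dnearCP[r r0 hr] := g0 _ oz.
  by apply/dnearCP; exists r => // x xz xr; rewrite (hr _ xz xr).
apply: (hilb_eq0 hB2 Bg); rewrite -model_minus_form // {1}e model_minus_form //.
exact: (hilb0l hB2).
Qed.

Lemma model_submod : submod_closed (mem L).
Proof.
have F1 := hilb0 hB1; have F2 := hilb0 hB2.
split; first by rewrite inE LE; exists 0 => //; exists 0 => //; exact: model_fun0.
move=> c x y; rewrite !inE LE => -[g1 Bg1 [g2 Bg2 <-]] [k1 Bk1 [k2 Bk2 <-]].
rewrite -model_funL; exists (c *: g1 + k1); first exact: (hilbL hB1).
by exists (c *: g2 + k2) => //; exact: (hilbL hB2).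
Qed.

Lemma model_hermitian : hermitian_on L q.
Proof.
split=> [c x y z|x y]; rewrite LE.
  move=> -[g1 Bg1 [g2 Bg2 <-]] [k1 Bk1 [k2 Bk2 <-]] [l1 Bl1 [l2 Bl2 <-]].
  rewrite -model_funL !qE //; [|exact: (hilbL hB1)|exact: (hilbL hB2)].
  by rewrite (hilbLl hB1) // (hilbLl hB2) //; ring.
move=> -[g1 Bg1 [g2 Bg2 <-]] [k1 Bk1 [k2 Bk2 <-]].
by rewrite !qE // rmorphB /= -(hilbC hB1) // -(hilbC hB2).
Qed.

Lemma model_fundamental :
  fundamental_decomposition L q (model_plus @` B1) (model_minus @` B2).
Proof.
have F1 := hilb0 hB1; have F2 := hilb0 hB2.
split.
- by move=> _ [g Bg <-]; rewrite LE; exists g => //; exists 0.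
- by move=> _ [g Bg <-]; rewrite LE; exists 0 => //; exists g.
- apply/seteqP; split=> x.
    rewrite LE => -[g1 Bg1 [g2 Bg2 <-]]; exists (model_plus g1); first by exists g1.
    by exists (model_minus g2); [exists g2|rewrite model_funD].
  move=> [_ [g1 Bg1 <-]] [_ [g2 Bg2 <-]] <-; rewrite LE.
  by exists g1 => //; exists g2 => //; rewrite model_funD.
- apply/seteqP; split=> x.
    (* A common element is orthogonal to itself, because [qE] makes the two components
       orthogonal. *)
    move=> [[g1 Bg1 <-]] [g2 Bg2 e].
    have : ip1 g1 g1 = 0.
      rewrite -model_plus_form // -{1}e /model_plus /model_minus qE //.
      by rewrite (hilb0l hB1) // (hilb0r hB2) // subrr.
    by move/(hilb_eq0 hB1 Bg1) ->; exact: model_fun0.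
  by move=> ->; split; exists 0 => //; exact: model_fun0.
- move=> _ _ [g1 Bg1 <-] [g2 Bg2 <-]; rewrite /model_plus /model_minus qE //.
  by rewrite (hilb0r hB1) // (hilb0l hB2) // subrr.
- exact: (hilbert_transport model_plusL model_plus_form).
- exact: (hilbert_transport (q' := qm) model_minusL model_minus_form).
Qed.

(** The identity theorem settles the upper half-plane. On the lower one, the relation of each
    function to its reflection shows that a zero of h1 + h2 at a regular point would give a zero at
    the conjugate point. *)
Lemma sum_neq0_near z : offR z -> \forall x \near z^', h1 x + h2 x != 0.
Proof.
move=> oz.
have [a1 _] := S0_Hinfty Sh1; have [a2 _] := S0_Hinfty Sh2.
have up w : upper w -> \forall x \near w^', h2 x + h1 x != 0.
  move=> uw; apply: (analytic_identity (f := fun x => h2 x + h1 x) _ Hsum uw).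
  by move=> t ut; apply: analyticD; [exact: (a2 _ ut)|exact: (a1 _ ut)].
case/offRP: oz => [/up/dnearCP[r r0 hr]|lz].
  by apply/dnearCP; exists r => // x xz xr; rewrite addrC; exact: hr.
have oz := lower_offR lz.
have /dnearCP[r r0 hr] := up _ (conj_lower lz).
have /dnearCP[s s0 hs] := regular_near Sh1 oz.
have /dnearCP[t t0 ht] := regular_near Sh2 oz.
have /nearCP[p p0 hp] := lower_open lz.
apply/dnearCP; exists (Num.min (Num.min r s) (Num.min t p)).
  by rewrite !lt_min r0 s0 t0 p0.
move=> x xz; rewrite !lt_min => /andP[/andP[xr /(hs _ xz) r1]].
move=> /andP[/(ht _ xz) r2 /hp lx].
have e1 := regular_lower_conj Sh1 HB1 lx r1.
have e2 := regular_lower_conj Sh2 HB2 lx r2.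
have xz' : x^* != z^* by rewrite (inj_eq (inv_inj conjCK)).
have : (h2 x^* + h1 x^*)^* != 0.
  by rewrite conjC_eq0; apply: hr => //; rewrite -rmorphB cmod_conj.
rewrite rmorphD /= => sum0; apply: contra_neq sum0 => s12.
transitivity (h1 x * (h1 x^*)^* * (h2 x^*)^* + h2 x * (h2 x^*)^* * (h1 x^*)^*).
  by rewrite e1 e2 !mul1r.
transitivity ((h1 x + h2 x) * (h1 x^*)^* * (h2 x^*)^*); first by ring.
by rewrite s12 !mul0r.
Qed.

Section WithVectors.
Context (e1 e2 : C -> C -> C).
Hypothesis M1 : boundary_model B1 ip1 e1 (den h1) (num h1).
Hypothesis M2 : boundary_model B2 ip2 e2 (den h2) (num h2).
Hypothesis reg1 : forall w, regular h1 w -> e1 w = reg_vector h1 w.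
Hypothesis reg2 : forall w, regular h2 w -> e2 w = reg_vector h2 w.

Let T1 : boundary_model (model_plus @` B1) q (model_plus \o e1) (den h1) (num h1) :=
  boundary_model_transport model_plusL model_plus_form M1.
Let T2 : boundary_model (model_minus @` B2) qm (model_minus \o e2) (den h2) (num h2) :=
  boundary_model_transport (q' := qm) model_minusL model_minus_form M2.
Local Notation coupled := (coupling (model_plus @` B1) (model_minus @` B2) q
  (model_plus \o e1) (model_minus \o e2) (den h1) (num h1) (den h2) (num h2)).

Lemma coupling_sub_model p : coupled p -> model_relation L p.
Proof.
move=> [x1 [x2 [y1 [y2 [al [c [pE1 pE2 r1 r2]]]]]]].
have [[f1 Bf1 f1E] [g1 Bg1 g1E] _] := r1; have [[f2 Bf2 f2E] [g2 Bg2 g2E] _] := r2.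
have Be1 w : offR w -> B1 (e1 w) by exact: bm_mem M1 _.
have Be2 w : offR w -> B2 (e2 w) by exact: bm_mem M2 _.
move: r1 r2; rewrite -f1E -g1E -f2E -g2E.
move=> /(bdrel_transport model_plus_form _ _ _ _ Be1 Bf1 Bg1)[_ _ r1].
move=> /(bdrel_transport (q' := qm) model_minus_form _ _ _ _ Be2 Bf2 Bg2)[_ _ r2].
split.
- by rewrite pE1 -f1E -f2E -model_funD LE; exists f1 => //; exists f2.
- by rewrite pE2 -g1E -g2E -model_funD LE; exists g1 => //; exists g2.
exists (fun z => sqrtC 2 / (h1 z + h2 z) * (f1 z + f2 z)).
exists (fun z => sqrtC 2 / (h1 z + h2 z) * (g1 z + g2 z)), (sqrtC 2 * c).
split; [by rewrite pE1 -f1E -f2E -model_funD|by rewrite pE2 -g1E -g2E -model_funD|].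
move=> z oz.
have /dnearCP[r r0 hr] := sum_neq0_near oz.
have /dnearCP[s s0 hs] := regular_near Sh1 oz.
have /dnearCP[t t0 ht] := regular_near Sh2 oz.
apply/dnearCP; exists (Num.min r (Num.min s t)); first by rewrite !lt_min r0 s0 t0.
move=> x xz; rewrite !lt_min => /and3P[/(hr _ xz) H0 /(hs _ xz) rg1 /(ht _ xz) rg2].
have [ox _] := rg1.
(* The boundary equation is [den] times the equation between function values, and [den] is nonzero
   at regular points. *)
have k1 : g1 x - x * f1 x = al + c * h1 x.
  apply: (mulfI (den_regular_neq0 Sh1 HB1 rg1)).
  have := r1 _ ox; rewrite reg1 // !(reg_vectorE HB1) // (num_regular Sh1 HB1 rg1).
  by move=> k; transitivity (den h1 x * g1 x - x * (den h1 x * f1 x));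
    [ring|rewrite k; ring].
have k2 : g2 x - x * f2 x = - al + c * h2 x.
  apply: (mulfI (den_regular_neq0 Sh2 HB2 rg2)).
  have := r2 _ ox; rewrite reg2 // !(reg_vectorE HB2) // (num_regular Sh2 HB2 rg2).
  by move=> k; transitivity (den h2 x * g2 x - x * (den h2 x * f2 x));
    [ring|rewrite k; ring].
transitivity (sqrtC 2 / (h1 x + h2 x) * ((g1 x - x * f1 x) + (g2 x - x * f2 x))).
  by ring.
rewrite k1 k2 addrACA subrr add0r -mulrDr.
by field.
Qed.

(* The resolvent of the coupling at w0 is everywhere defined and a pair
   (d, w0 d) of the model relation vanishes since d is regular at w0. *)
Lemma model_sub_coupling w0 : upper w0 -> h2 w0 + h1 w0 != 0 ->
  model_relation L `<=` coupled.
Proof.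
move=> uw H0 [x y] [/= Lx Ly [u [v [c [xE yE uv]]]]].
have ow := upper_offR uw.
have D0 : den h1 w0 * num h2 w0 + den h2 w0 * num h1 w0 != 0.
  by rewrite !den_upper // !num_upper // !mul1r.
have LB := kreinB model_submod; have LZ := kreinZ model_submod.
have fdm := model_fundamental.
have [x' cx'] := coupling_resolvent_ex T1 T2 fdm ow D0 (LB _ _ Ly (LZ w0 _ Lx)).
suff xx : x - x' = 0.
  have {}xx : x = x' by apply/eqP; rewrite -subr_eq0 xx.
  by move: cx'; rewrite -xx subrK.
have [/= Lx' _ [u' [v' [c' [xE' yE' uv']]]]] := coupling_sub_model cx'.
have : L (x - x') by exact: LB.
rewrite LE => -[g1 Bg1 [g2 Bg2 dE]].
pose G z := sqrtC 2 / (h1 z + h2 z) * (g1 z + g2 z).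
have mB (k l : C -> C) : mclass k - mclass l = mclass (k - l).
  have -> : mclass k - mclass l = (-1 : C) *: mclass l + mclass k.
    by rewrite scaleN1r addrC.
  have -> : (-1 : C) *: mclass l = mclass ((-1 : C) *: l) by rewrite mclassZ.
  by rewrite -mclassD scaleN1r addrC.
have e1' : mclass G = mclass (u - u') by rewrite -mB -xE -xE'; exact: dE.
have e2' : mclass (fun z => w0 * G z) = mclass (v - v').
  rewrite -mB -yE -yE'.
  have -> : y - (y - w0 *: x + w0 *: x') = w0 *: (x - x').
    by rewrite scalerBr opprD opprB addrA addrCA subrr addr0.
  by rewrite -dE /Defs.model_fun -/G; have -> : w0 *: mclass G = mclass (w0 *: G)
    by rewrite mclassZ.
move/mclassP: e1' => e1'; move/mclassP: e2' => e2'.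
have main z : offR z -> \forall x \near z^', (w0 - x) * G x = c - c'.
  move=> oz.
  have /dnearCP[r r0 hr] := e1' _ oz; have /dnearCP[s s0 hs] := e2' _ oz.
  have /dnearCP[t t0 ht] := uv _ oz; have /dnearCP[p p0 hp] := uv' _ oz.
  apply/dnearCP; exists (Num.min (Num.min r s) (Num.min t p)).
    by rewrite !lt_min r0 s0 t0 p0.
  move=> a az; rewrite !lt_min => /andP[/andP[/(hr _ az) ra /(hs _ az) sa]].
  move=> /andP[/(ht _ az) <- /(hp _ az) <-].
  by rewrite mulrBl sa ra !fctE; ring.
(* As the argument tends to [w0], the factor w0 - x tends to 0 while [G] has a finite limit. *)
have cc : c - c' = 0.
  have [a Pa ca] := dnear_seq (main _ ow).
  have [_ ah1] := regular_upper Sh1 uw; have [_ ah2] := regular_upper Sh2 uw.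
  have ag1 : analytic_at g1 w0.
    by apply: (Bspace_analytic HB1 Bg1); apply: regular_Uext; exact: regular_upper.
  have ag2 : analytic_at g2 w0.
    by apply: (Bspace_analytic HB2 Bg2); apply: regular_Uext; exact: regular_upper.
  have H0' : h1 w0 + h2 w0 != 0 by rewrite addrC.
  have c1 : (fun n => (w0 - a n) * G (a n)) @ \oo --> (w0 - w0) * G w0.
    exact: (cvgCM (cvgCB (cvgC_cst w0) ca) (cvgCM (cvgCM (cvgC_cst (sqrtC 2))
      (cvgCV H0' (cvgCD (analytic_seq ah1 ca) (analytic_seq ah2 ca))))
      (cvgCD (analytic_seq ag1 ca) (analytic_seq ag2 ca)))).
  suff <- : (w0 - w0) * G w0 = c - c' by rewrite subrr mul0r.
  apply: (cvg_eq c1).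
  suff -> : (fun n => (w0 - a n) * G (a n)) = (fun=> c - c') by exact: cvgC_cst.
  exact/funext.
rewrite -dE -model_fun0; apply/mclassP => z oz.
have /dnearCP[r r0 hr] := main _ oz.
pose t := if z == w0 then 1 else cmod (z - w0).
have t0 : 0 < t.
  by rewrite /t; case: eqVneq => // zw; rewrite cmod_gt0 subr_eq0.
apply/dnearCP; exists (Num.min r t); first by rewrite lt_min r0 t0.
move=> a az; rewrite lt_min => /andP[/(hr _ az) ha at_].
have aw : w0 - a != 0.
  rewrite subr_eq0 eq_sym; move: at_; rewrite /t; case: (eqVneq z w0) => [<- //|zw].
  by apply: contraTneq => ->; rewrite cmodBC ltxx.
move: ha; rewrite cc => /eqP; rewrite mulf_eq0 (negbTE aw) /= => /eqP Ga.
suff : G a = sqrtC 2 / (h1 a + h2 a) * (0 + 0) by [].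
by rewrite Ga addr0 mulr0.
Qed.

End WithVectors.

Lemma model_reducible :
  (forall al be, (forall w, offR w -> al * den h1 w + be * num h1 w = 0) ->
    al = 0 /\ be = 0) ->
  (forall al be, (forall w, offR w -> al * den h2 w + be * num h2 w = 0) ->
    al = 0 /\ be = 0) ->
  partially_fundamentally_reducible L q (model_relation L).
Proof.
move=> nd1 nd2.
have [w0 uw H0] : exists2 w0, upper w0 & h2 w0 + h1 w0 != 0.
  apply: contrapT => h; apply: Hsum => z uz; apply/eqP.
  by apply: contrapT => hz; apply: h; exists z => //; apply/negP.
have [e1 [M1 r1]] := kernel_space_model Sh1 HB1 mero_null_eq0_plus.
have [e2 [M2 r2]] := kernel_space_model Sh2 HB2 mero_null_eq0_minus.
have T1 := boundary_model_transport model_plusL model_plus_form M1.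
have T2 := boundary_model_transport (q' := qm) model_minusL model_minus_form M2.
have D0 : den h1 w0 * num h2 w0 + den h2 w0 * num h1 w0 != 0.
  by rewrite !den_upper // !num_upper // !mul1r.
have -> : model_relation L = coupling (model_plus @` B1) (model_minus @` B2) q
    (model_plus \o e1) (model_minus \o e2) (den h1) (num h1) (den h2) (num h2).
  apply/seteqP; split; first exact: (model_sub_coupling M1 M2 r1 r2 uw H0).
  by move=> p; exact: (coupling_sub_model M1 M2 r1 r2).
exact: (coupling_reducible T1 T2 model_submod model_hermitian model_fundamental
  nd1 nd2 uw D0).
Qed.

End ModelSpace.

(** A relation al + be h = 0 on the upper half-plane makes [h] a constant k = - al / be. At the
    conjugate of ['i] the same relation reads al conj(k) + be = 0, which gives |k| = 1. *)
Lemma nondegenerate (R : realType) (h : R[i] -> R[i]) al be :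
  (forall w, offR w -> al * den h w + be * num h w = 0) ->
  ~ (exists2 k, cmod k = 1 & forall z, upper z -> h z = k) -> al = 0 /\ be = 0.
Proof.
move=> hw; apply: contra_notP => nab.
have up w : upper w -> al + be * h w = 0.
  move=> uw; have := hw _ (upper_offR uw).
  by rewrite den_upper // num_upper // mulr1.
have be0 : be != 0.
  apply: contra_notN nab => /eqP be0; split=> //.
  by have := up _ (upper_i R); rewrite be0 mul0r addr0.
pose k := - al / be.
have hk z : upper z -> h z = k.
  move=> /up /eqP; rewrite addrC addr_eq0 => /eqP hz.
  by rewrite /k -hz mulrC mulKf.
exists k => //; have ui := upper_i R.
have li := conj_upper ui.
have := hw _ (lower_offR li); rewrite den_lower // num_lower // conjCK hk // mulr1.
have -> : al = - be * k by rewrite /k mulrA mulNr mulrN opprK mulrC mulKf.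
rewrite -mulrA -cmod_sqrE mulNr addrC => /eqP; rewrite subr_eq0.
rewrite -{1}[be]mulr1 => /eqP/(mulfI be0)/esym.
rewrite -(rmorph1 (real_complex R)) => /complexI/eqP.
by rewrite sqrp_eq1 ?cmod_ge0 // => /eqP.
Qed.

Lemma S0_cmod_le1 (R : realType) (h : R[i] -> R[i]) : S0 h ->
  forall z, upper z -> cmod (h z) <= 1.
Proof.
by move=> Sh z uz; rewrite -lecR -cmodE; exact: (S0_le1 Sh).
Qed.

(* |h1 z| = 1 at a single z would make h1 constant, so that h1 + h2 = 0. *)
Lemma sum_constant_neq0 (R : realType) (h1 h2 : R[i] -> R[i]) B ip k :
  S0 h1 -> is_Bspace h1 B ip -> (forall z, upper z -> h2 z = k) -> cmod k = 1 ->
  ~ (forall z, upper z -> h2 z + h1 z = 0) ->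
  forall z, upper z -> k + h1 z != 0.
Proof.
move=> Sh1 HB h2k k1 Hsum z uz; apply/eqP => kz; apply: Hsum => w uw.
have hz : h1 z = - k by apply/eqP; rewrite -subr_eq0 opprK addrC kz.
rewrite h2k // (unimodular_constant Sh1 HB uz) ?hz ?cmodN // subrr.
by [].
Qed.

Theorem theorem5p3 (R : realType) (f : R[i]%C -> R[i]%C)
    (L : set (mero R)) (q : mero R -> mero R -> R[i]%C)
    (A : set (mero R * mero R)) :
  Nsym f ->
  ~ herglotz_nevanlinna f ->
  ~ herglotz_nevanlinna (fun z => (- f z)%R) ->
  is_model_relation f L q A ->
  partially_fundamentally_reducible L q A.
Proof.
move=> [[fm _ _] fsym] nf nNf.
move=> [h1 [h2 [B1 [B2 [ip1 [ip2 [cp HB1 HB2 [LE qE ->]]]]]]]].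
have [Sh1 Sh2 _ Hsum fE] := cp.
have Hsum' : ~ (forall z, upper z -> h1 z + h2 z = 0).
  by move=> h; apply: Hsum => z uz; rewrite addrC; exact: h.
have fE1 : mero_eq (@upper R) f (fun z => 'i * (h2 z - h1 z) / (h2 z + h1 z)).
  by move=> z uz; apply: fE; exact: upper_offR.
apply: (model_reducible Sh1 Sh2 Hsum HB1 HB2 LE qE) => al be /nondegenerate; apply.
  (* Interchanging h1 and h2 replaces [f] by its negative, so a unimodular constant h1 makes -f a
     Herglotz-Nevanlinna function. *)
  move=> [k k1 hk]; apply: nNf.
  have [h2a _] := S0_Hinfty Sh2.
  have sum0 := sum_constant_neq0 Sh2 HB2 hk k1 Hsum'.
  apply: (herglotz_constant _ _ _ h2a (S0_cmod_le1 Sh2) hk k1 sum0).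
  - move=> z /fm[fz|[n [g [n0 ga gz /dnearCP[r r0 hr]]]]].
      by left; exact: analyticN.
    right; exists n, (fun x => - g x).
    split; [exact: n0|exact: analyticN|by rewrite oppr_eq0|apply/dnearCP].
    by exists r => // x xz xr; rewrite (hr _ xz xr) mulNr.
  - move=> z lz; have /dnearCP[r r0 hr] := fsym _ lz; apply/dnearCP.
    by exists r => // x xz xr; rewrite (hr _ xz xr) /SR rmorphN.
  - move=> z uz; have /dnearCP[r r0 hr] := fE1 _ uz; apply/dnearCP.
    exists r => // x xz xr; rewrite (hr _ xz xr) -mulNr -mulrN opprB.
    by rewrite [h2 x + h1 x]addrC.
move=> [k k1 hk]; apply: nf.
have [h1a _] := S0_Hinfty Sh1.
have sum0 := sum_constant_neq0 Sh1 HB1 hk k1 Hsum.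
exact: (herglotz_constant fm fsym fE1 h1a (S0_cmod_le1 Sh1) hk k1 sum0).
Qed.
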